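(* For every integer $d\ge 1$ there is a constant $C_d>0$ depending only on $d$ such that the following holds. Let $K\ge 1$ and $n\ge 1$ be integers with $K$ dividing $n$, let $\mu_\star(1),\dots,\mu_\star(K)$ be Borel probability measures supported on the unit ball $B_1^d(0)\subset\mathbb{R}^d$, and let $\hat\mu_n(1),\dots,\hat\mu_n(K)$ be the empirical measures of $n/K$ samples from each of them. Then $$\mathbb{E}\left[\left|\mathrm{MW}_2^2(\hat\mu_n)-\mathrm{MW}_2^2(\mu_\star)\right|\right]\le C_d\left(n^{-1/2}+\min\left\{\frac1K,\ r_{n,K,d}\right\}\right),$$ where $$r_{n,K,d}=\begin{cases}K^{-1/2}(n/K)^{-2/d}, & d>4,\\ n^{-1/2}\log(n/K), & d=4,\\ n^{-1/2}, & d<4.\end{cases}$$ In particular, for $d\le 4$, $\mathbb{E}\left[\left|\mathrm{MW}_2^2(\hat\mu_n)-\mathrm{MW}_2^2(\mu_\star)\right|\right]$ is at most $n^{-1/2}$ up to a constant depending only on $d$ and a factor polynomial in $1+\log n$.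
   Context: For probability measures $\mu(1),\dots,\mu(K)$ on $\mathbb{R}^d$, $\Gamma(\mu(1),\dots,\mu(K))$ denotes the set of all couplings, i.e. probability measures $\gamma$ on $(\mathbb{R}^d)^K$ whose $k$-th marginal is $\mu(k)$ for all $k\in\{1,\dots,K\}$. Points of $(\mathbb{R}^d)^K$ are written $y=(y(1),\dots,y(K))$ with $y(k)\in\mathbb{R}^d$. Define $$\mathrm{MW}_2^2(\mu)=\mathrm{MW}_2^2(\mu(1),\dots,\mu(K)):=\inf_{\gamma\in\Gamma(\mu(1),\dots,\mu(K))}\int\left\|\frac{1}{K}\sum_{k=1}^K y(k)\right\|_2^2\,\gamma(dy).$$ $B_1^d(0)$ is the Euclidean unit ball of $\mathbb{R}^d$ centered at $0$. Sampling: $Y_i(k)$, $1\le i\le n/K$, $1\le k\le K$, are $n$ mutually independent random vectors with $Y_i(k)\sim\mu_\star(k)$, and $\hat\mu_n(k)$ is the uniform distribution on $\{Y_i(k)\}_{1\le i\le n/K}$ (the empirical measure). $\mathrm{MW}_2^2(\mu_\star)$ and $\mathrm{MW}_2^2(\hat\mu_n)$ are shorthand for $\mathrm{MW}_2^2(\mu_\star(1),\dots,\mu_\star(K))$ and $\mathrm{MW}_2^2(\hat\mu_n(1),\dots,\hat\mu_n(K))$. *)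

(* Defs.v *)
From HB Require Import structures.
From mathcomp Require Import all_boot all_order all_algebra.
From mathcomp Require Import all_classical all_reals all_analysis.

Set Implicit Arguments.
Unset Strict Implicit.
Unset Printing Implicit Defensive.

Import Order.TTheory GRing.Theory Num.Theory.
Import numFieldNormedType.Exports.

Local Open Scope classical_set_scope.
Local Open Scope ring_scope.

(* The space R^d is [d.-tuple R], whose canonical sigma-algebra (generated by
   the coordinates) is the Borel one; likewise (R^d)^K is
   [K.-tuple (d.-tuple R)]. *)

Definition norm2 (R : realType) (d : nat) (x : d.-tuple R) : R :=
  Num.sqrt (\sum_(j < d) tnth x j ^+ 2).

Definition unit_ball (R : realType) (d : nat) : set (d.-tuple R) :=
  [set x | norm2 x <= 1].

Definition barycenter (R : realType) (d K : nat)
    (y : K.-tuple (d.-tuple R)) : d.-tuple R :=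
  [tuple K%:R^-1 * \sum_(k < K) tnth (tnth y k) j | j < d].

Definition couplings (R : realType) (d K : nat)
    (mu : 'I_K -> probability (d.-tuple R) R) :
    set (probability (K.-tuple (d.-tuple R)) R) :=
  [set gamma | forall (k : 'I_K) (A : set (d.-tuple R)), measurable A ->
     pushforward gamma (fun y => tnth y k) A = mu k A].

(* Extended-real valued, since the second moments of the marginals may be
   infinite. *)
Definition MW2sq (R : realType) (d K : nat)
    (mu : 'I_K -> probability (d.-tuple R) R) : \bar R :=
  ereal_inf [set (\int[gamma]_y (norm2 (barycenter y) ^+ 2)%:E)%E
            | gamma in couplings mu].

Section empirical.
Context {disp : measure_display} {T : measurableType disp} (R : realType).
Context {m : nat}.

(* The positivity proof does not enter the value: it is there only for the
   instance of probability measure below. *)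
Definition empirical (m_gt0 : (0 < m)%N) (x : 'I_m -> T) (A : set T) : \bar R :=
  (m%:R^-1%:E * \sum_(i < m) \d_(x i) A)%E.

Variables (m_gt0 : (0 < m)%N) (x : 'I_m -> T).

Let ord_of_nat (i : nat) : 'I_m := insubd (Ordinal m_gt0) i.

Let minv_ge0 : 0 <= m%:R^-1 :> R.
Proof. by rewrite invr_ge0. Qed.

Let empiricalE : empirical m_gt0 x =
  mscale (NngNum minv_ge0) (msum (fun i => \d_(x (ord_of_nat i))) m).
Proof.
apply/funext => A; rewrite /empirical /mscale /msum /=; congr (_ * _)%E.
by apply: eq_bigr => i _; rewrite /ord_of_nat valKd.
Qed.

Let empirical0 : empirical m_gt0 x set0 = 0%E.
Proof. by rewrite empiricalE measure0. Qed.

Let empirical_ge0 A : (0 <= empirical m_gt0 x A)%E.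
Proof. by rewrite empiricalE measure_ge0. Qed.

Let empirical_sigma_additive : semi_sigma_additive (empirical m_gt0 x).
Proof. by rewrite empiricalE; exact: measure_semi_sigma_additive. Qed.

HB.instance Definition _ := isMeasure.Build _ _ _ (empirical m_gt0 x)
  empirical0 empirical_ge0 empirical_sigma_additive.

Let empirical_setT : empirical m_gt0 x setT = 1%E.
Proof.
rewrite /empirical (eq_bigr (fun=> (1 : R)%:E)); last first.
  by move=> i _; rewrite diracT.
by rewrite sumEFin sumr_const card_ord -EFinM mulVf// pnatr_eq0 -lt0n.
Qed.

HB.instance Definition _ := Measure_isProbability.Build _ _ _
  (empirical m_gt0 x) empirical_setT.

End empirical.
Arguments empirical {disp T} R {m} m_gt0 x A.

Definition mutually_independent (disp disp' : measure_display)
    (Omega : measurableType disp) (T : measurableType disp') (R : realType)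
    (P : probability Omega R) (I : finType) (X : I -> {RV P >-> T}) : Prop :=
  forall (J : {set I}) (A : I -> set T),
    (forall i, i \in J -> measurable (A i)) ->
    P (\bigcap_(i in [set` J]) X i @^-1` A i) =
    (\prod_(i in J) P (X i @^-1` A i))%E.

Definition rate (R : realType) (n K d : nat) : R :=
  if (4 < d)%N then
    K%:R `^ (- (1 / 2)) * (n%:R / K%:R) `^ (- (2 / d%:R))
  else if d == 4%N then n%:R `^ (- (1 / 2)) * ln (n%:R / K%:R)
  else n%:R `^ (- (1 / 2)).

Lemma sample_size_gt0 (K n : nat) :
  (0 < K)%N -> (0 < n)%N -> (K %| n)%N -> (0 < n %/ K)%N.
Proof. by move=> K0 n0 Kn; rewrite divn_gt0 // dvdn_leq. Qed.

(* Main.v *)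
(* By duality the sampled problem has potentials F_1, ..., F_K with
   sum_k F_k(y(k)) <= |mean y|^2 on the ball.  Once they are tightened, F_k is
   2 <z, x> / K + |x|^2 / K^2, with z the sample mean, minus K^(-3/2) times a
   convex function with O(1) subgradients, because a configuration at which the
   constraint is nearly an equality has its mean within O(K^(-1/2)) of z.  These
   potentials are feasible for mu as well, so MW(hat mu) - MW(mu) is at most a
   fluctuation of means, of order n^(-1/2), plus K^(-1/2) times an average over k
   of empirical processes over bounded Lipschitz convex functions, which
   Bronshtein's entropy bound and chaining control.  Replacing duality by Jensen's
   inequality for the lower bounds gives the error 1/K instead.  Conversely,
   averaging optimal couplings of the samples gives a coupling of mu, hence
   E MW(hat mu) >= MW(mu), and E|X| <= 2 E X^+ for the error
   X = MW(hat mu) - MW(mu). *)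
From HB Require Import structures.
Require Import Defs.
From mathcomp Require Import all_boot all_order all_algebra.
From mathcomp Require Import all_classical all_reals all_analysis.
From mathcomp Require Import measurable_realfun.
From mathcomp Require Import ring lra zify.

Set Implicit Arguments.
Unset Strict Implicit.
Unset Printing Implicit Defensive.

Import Order.TTheory GRing.Theory Num.Theory.
Import numFieldNormedType.Exports.

Local Open Scope classical_set_scope.
Local Open Scope ring_scope.

(** Convexity, and not just a Lipschitz bound, sets the rate. With exp(O(2^(J d))) functions one
    reaches accuracy 4^(-J) on convex functions but only 2^(-J) on Lipschitz ones; this gives
    (n/K)^(-2/d) and the critical dimension 4. The gain comes from adding |x|^2/2: rounding slopes
    to a grid of side 2^(-J) then costs only order 4^(-J). Measurability shapes the rest. The
    sampled cost is never shown to be measurable in the sample. The integral of a nonnegative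
    function is a supremum over simple functions below it, so upper bounds by measurable functions
    still make sense, and the expected sampled cost is compared with MW(mu) through the minimum of
    the costs of finitely many fixed plans. Likewise the potentials, which are infima over
    uncountable families and are controlled only on the ball, are never integrated: functions built
    from finite nets are integrated in their place, and the event that some sample point leaves the
    ball is put into a null set. *)

Section convex_cover.
Context {R : realType} {d : nat}.
Implicit Types (x y : d.-tuple R) (h : d.-tuple R -> R).

Lemma unit_ballP x : unit_ball x <-> \sum_(i < d) tnth x i ^+ 2 <= 1.
Proof.
by rewrite /unit_ball /norm2 /= -[X in _ <= X]sqrtr1 ler_sqrt.
Qed.

Lemma unit_ball_coord x i : unit_ball x -> `|tnth x i| <= 1.
Proof.
move=> /unit_ballP xB; rewrite -(@expr_le1 _ 2)// -normrX ger0_norm ?sqr_ge0//.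
apply: le_trans xB; rewrite (bigD1 i)//= lerDl.
by apply: sumr_ge0 => j _; exact: sqr_ge0.
Qed.

(** * Dyadic cells of a box *)

Definition mesh j : R := 2^-1 ^+ j.

Lemma mesh_gt0 j : 0 < mesh j.
Proof. by rewrite exprn_gt0// invr_gt0. Qed.

Lemma mesh_le1 j : mesh j <= 1.
Proof. by rewrite exprn_ile1// ?invr_ge0// invf_le1// ler1n. Qed.

Lemma meshS j : mesh j = 2 * mesh j.+1.
Proof. by rewrite /mesh exprS mulrA divff ?mul1r// pnatr_eq0. Qed.

Lemma meshK j : 2 ^+ j * mesh j = 1.
Proof. by rewrite -exprMn divff ?expr1n// pnatr_eq0. Qed.

Section cells.
Variable A : nat.

(** The grid of side [mesh j] on the box of half-width [A+2]. Points of [near_box] keep a distance 1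
    from its boundary, so [truncn] rounds down a nonnegative number and [inord] returns the true
    index. *)
Definition cells (j : nat) := {ffun 'I_d -> 'I_((2 * A + 4) * 2 ^ j).+1}.

Definition cell j (u : 'I_d -> R) : cells j :=
  [ffun i => inord (Num.truncn ((u i + A.+2%:R) * 2 ^+ j))].

Definition corner j (q : cells j) (i : 'I_d) : R :=
  (q i)%:R * mesh j - A.+2%:R.

Definition parent j (q : cells j.+1) : cells j := [ffun i => inord (q i)./2].

(** [A+1] bounds the coordinates of a point of the ball plus a subgradient with entries at most
    [A]. *)
Definition near_box (u : 'I_d -> R) := forall i, `|u i| <= A.+1%:R.

Let box_ge0 u i j : near_box u -> 0 <= (u i + A.+2%:R) * 2 ^+ j.
Proof.
move=> /(_ i); rewrite ler_norml => /andP[u1 _].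
apply: mulr_ge0; last exact: exprn_ge0.
have : A.+1%:R <= A.+2%:R :> R by rewrite ler_nat.
lra.
Qed.

Let truncn_cell u i j : near_box u ->
  (Num.truncn ((u i + A.+2%:R) * 2 ^+ j) < ((2 * A + 4) * 2 ^ j).+1)%N.
Proof.
move=> uA; have u0 := box_ge0 i j uA.
have /andP[+ _] := truncn_itv u0 => tu.
rewrite ltnS -(ler_nat R); apply: le_trans tu _.
rewrite natrM natrX ler_wpM2r ?exprn_ge0//.
move: (uA i); rewrite ler_norml => /andP[_ u1].
have -> : (2 * A + 4)%:R = A.+1%:R + A.+2%:R + 1 :> R.
  by rewrite -natrD natr1; congr _%:R; lia.
lra.
Qed.

Lemma corner_cell u j i : near_box u ->
  corner (cell j u) i <= u i <= corner (cell j u) i + mesh j.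
Proof.
move=> uA; have u0 := box_ge0 i j uA.
rewrite /corner ffunE inordK ?truncn_cell//.
have /andP[tu ut] := truncn_itv u0.
move: tu ut; set t := Num.truncn _; rewrite -[t.+1%:R]natr1 => tu ut.
have -> : u i = (u i + A.+2%:R) * 2 ^+ j * mesh j - A.+2%:R.
  by rewrite -mulrA meshK mulr1 addrK.
have m0 := mesh_gt0 j.
have := ler_wpM2r (ltW m0) (ltW ut); rewrite [(t%:R + 1) * _]mulrDl mul1r.
have := ler_wpM2r (ltW m0) tu.
lra.
Qed.

Lemma parent_cell u j : near_box u -> parent (cell j.+1 u) = cell j u.
Proof.
move=> uA; apply/ffunP => i; rewrite !ffunE inordK ?truncn_cell//.
have u0 := box_ge0 i j uA; have u1 := box_ge0 i j.+1 uA.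
congr inord; apply/esym/eqP; rewrite truncn_eq//.
have /andP[] := truncn_itv u1; set t := Num.truncn _.
rewrite exprS mulrCA => t1 t2.
have : (t./2.*2 <= t)%N by rewrite -[leqRHS]odd_double_half leq_addl.
have : (t.+1 <= t./2.+1.*2)%N.
  by rewrite -[in leqLHS](odd_double_half t) doubleS; case: odd.
rewrite -!(ler_nat R) -!mul2n !natrM => h1 h2.
by apply/andP; split; lra.
Qed.

Lemma corner_parent j (q : cells j.+1) i :
  corner (parent q) i <= corner q i <= corner (parent q) i + mesh j.+1.
Proof.
rewrite /corner ffunE inordK; last first.
  rewrite ltnS leq_half_double; apply: leq_trans (leq_ord (q i)) _.
  by rewrite expnS mulnCA -mul2n.
have E : (q i)%:R = (odd (q i))%:R + 2 * (q i)./2%:R :> R.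
  move: (nat_of_ord (q i)) => t.
  by rewrite -natrM -natrD mul2n odd_double_half.
rewrite E (meshS j) mulrDl.
have m0 := mesh_gt0 j.+1.
by case: odd => /=; rewrite ?mulr1n ?mulr0n; apply/andP; split; lra.
Qed.
End cells.
End convex_cover.

Lemma sqr_le_sqr {R : realDomainType} (a b : R) : `|a| <= b -> a ^+ 2 <= b ^+ 2.
Proof.
move=> ab; have b0 : 0 <= b := le_trans (normr_ge0 a) ab.
by rewrite -(real_normK (num_real a)) ler_sqr// nnegrE.
Qed.

Lemma norm_le_sqr {R : realDomainType} (a b : R) :
  0 <= b -> a ^+ 2 <= b ^+ 2 -> `|a| <= b.
Proof.
by move=> b0; rewrite -(real_normK (num_real a)) ler_sqr// nnegrE.
Qed.

(** * Convex functions with bounded subgradients *)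

Section convex_class.
Context {R : realType} {d : nat}.
Implicit Types (x y : d.-tuple R) (h : d.-tuple R -> R) (A j : nat).

(* Subgradients up to every [e], since the infimum that defines a tight potential
   need not be attained. *)
Definition approx_subgradients A h (p : d.-tuple R -> 'I_d -> R) (e : R) :=
  forall x, unit_ball x -> (forall i, `|p x i| <= A%:R) /\
    forall y, unit_ball y ->
      h x + \sum_i p x i * (tnth y i - tnth x i) - e <= h y.

Definition convex_lip A h := h [tuple 0 | i < d] = 0 /\
  forall e, 0 < e -> exists p, approx_subgradients A h p e.

Section fixed_selection.
Variables (A : nat) (h : d.-tuple R -> R) (p : d.-tuple R -> 'I_d -> R).
Variables (e : R).
Hypothesis ph : approx_subgradients A h p e.

(* As in Minty's theorem, [x |-> x + p x] is expansive, so the cell of its value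
   locates [x] up to [mesh j] and the intercept up to [mesh j ^+ 2]. *)
Definition resolvent x (i : 'I_d) : R := tnth x i + p x i.

Definition potential x : R := h x + (\sum_i tnth x i ^+ 2) / 2.

(** Approximately the convex conjugate of [potential] at the corner of the cell of [resolvent x]. *)
Definition intercept j x : R :=
  \sum_i tnth x i * corner (cell A j (resolvent x)) i - potential x.

Lemma resolvent_box x : unit_ball x -> near_box A (resolvent x).
Proof.
move=> xB i; have [/(_ i) pA _] := ph xB.
rewrite -natr1 addrC; apply: le_trans (ler_normD _ _) _.
by apply: lerD => //; exact: unit_ball_coord.
Qed.

(** [resolvent] is an approximate subgradient of [potential], and the square is its strong
    convexity, inherited from |x|^2/2. *)
Lemma potential_lb x y : unit_ball x -> unit_ball y ->
  potential x + \sum_i resolvent x i * (tnth y i - tnth x i)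
    + (\sum_i (tnth y i - tnth x i) ^+ 2) / 2 - e <= potential y.
Proof.
move=> xB yB; have [_ /(_ _ yB)] := ph xB; rewrite /potential.
have -> : \sum_i resolvent x i * (tnth y i - tnth x i) =
  \sum_i p x i * (tnth y i - tnth x i) + (\sum_i tnth y i ^+ 2) / 2
  - (\sum_i tnth x i ^+ 2) / 2 - (\sum_i (tnth y i - tnth x i) ^+ 2) / 2.
  rewrite !mulr_suml -big_split/= -!sumrB; apply: eq_bigr => i _.
  by rewrite /resolvent; field.
lra.
Qed.

Lemma sum_le_const (F : 'I_d -> R) (c : R) :
  (forall i, F i <= c) -> \sum_i F i <= d%:R * c.
Proof.
move=> Fc; rewrite mulr_natl -[d in _ *+ d]card_ord -sumr_const.
exact: ler_sum.
Qed.

Section same_cell.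
Variables (j : nat) (x y : d.-tuple R).
Hypotheses (xB : unit_ball x) (yB : unit_ball y).
Hypothesis (xy : cell A j (resolvent x) = cell A j (resolvent y)).
Hypothesis (ej : e <= mesh j ^+ 2).

Let resolvent_close i : (resolvent x i - resolvent y i) ^+ 2 <= mesh j ^+ 2.
Proof.
have /andP[x1 x2] := corner_cell j i (resolvent_box xB).
have /andP[y1 y2] := corner_cell j i (resolvent_box yB).
apply: sqr_le_sqr.
by move: x1 x2 y1 y2; rewrite xy ler_norml => *; apply/andP; split; lra.
Qed.

(** With r the resolvent, adding [potential_lb] in both directions gives |x - y|^2 <= <r x - r y, x
    - y> + 2 e. Young's inequality, in the form of the nonnegative sum [S0], turns this into |x -
    y|^2 <= |r x - r y|^2 + 4 e. *)
Lemma same_cell_close i : `|tnth x i - tnth y i| <= (d + 4)%:R * mesh j.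
Proof.
have m0 : 0 <= mesh j :> R by rewrite ltW// mesh_gt0.
apply: norm_le_sqr; first exact: mulr_ge0.
have h1 := potential_lb xB yB; have h2 := potential_lb yB xB.
have S : \sum_i (tnth x i - tnth y i) ^+ 2 <= (d + 4)%:R * mesh j ^+ 2.
  have -> : (d + 4)%:R * mesh j ^+ 2 = d%:R * mesh j ^+ 2 + 4 * mesh j ^+ 2 :> R.
    by rewrite natrD mulrDl.
  have := sum_le_const resolvent_close.
  have S0 : 0 <= \sum_i (resolvent x i - resolvent y i
                         + (tnth y i - tnth x i)) ^+ 2.
    by apply: sumr_ge0 => k _; exact: sqr_ge0.
  have E1 : \sum_i (resolvent x i - resolvent y i + (tnth y i - tnth x i)) ^+ 2 =
     \sum_i (resolvent x i - resolvent y i) ^+ 2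
     + 2 * (\sum_i resolvent x i * (tnth y i - tnth x i)
           + \sum_i resolvent y i * (tnth x i - tnth y i))
     + \sum_i (tnth y i - tnth x i) ^+ 2.
    rewrite -big_split mulr_sumr -!big_split; apply: eq_bigr => k _ /=; ring.
  have E2 : \sum_i (tnth x i - tnth y i) ^+ 2 =
    \sum_i (tnth y i - tnth x i) ^+ 2.
    by apply: eq_bigr => k _; ring.
  move: S0 h1 h2 ej; rewrite E1 E2; lra.
rewrite exprMn; apply: le_trans (_ : (d + 4)%:R * mesh j ^+ 2 <= _).
  apply: le_trans S; rewrite (bigD1 i)//= lerDl.
  by apply: sumr_ge0 => k _; exact: sqr_ge0.
rewrite ler_wpM2r ?sqr_ge0// -natrX ler_nat.
by rewrite -{1}[(d + 4)%N]expn1 leq_pexp2l// addn4.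
Qed.

(** The error is at most <c - r y, x - y> - |x - y|^2/2 + e, with c the common corner and r the
    resolvent. Strong convexity absorbs the part that is linear in x - y, which leaves |c - r y|^2/2
    + e, of second order in the mesh. *)
Lemma same_cell_intercept_le :
  intercept j x - intercept j y <= (d + 1)%:R * mesh j ^+ 2.
Proof.
have h2 := potential_lb yB xB; rewrite /intercept xy.
set c := corner _.
have S0 : 0 <= \sum_i (c i - resolvent y i - (tnth x i - tnth y i)) ^+ 2.
  by apply: sumr_ge0 => k _; exact: sqr_ge0.
have E1 : \sum_i (c i - resolvent y i - (tnth x i - tnth y i)) ^+ 2 =
     \sum_i (c i - resolvent y i) ^+ 2
     - 2 * (\sum_i tnth x i * c i - \sum_i tnth y i * c i
           - \sum_i resolvent y i * (tnth x i - tnth y i))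
     + \sum_i (tnth x i - tnth y i) ^+ 2.
  rewrite -!sumrB mulr_sumr -sumrB -big_split; apply: eq_bigr => k _ /=; ring.
have : \sum_i (c i - resolvent y i) ^+ 2 <= d%:R * mesh j ^+ 2.
  apply: sum_le_const => i; apply: sqr_le_sqr.
  have /andP[] := corner_cell j i (resolvent_box yB).
  by rewrite -/(c i) ler_norml => *; apply/andP; split; lra.
have : 0 <= d%:R * mesh j ^+ 2 :> R by rewrite mulr_ge0// sqr_ge0.
move: S0 h2 ej; rewrite E1 natrD mulrDl mul1r; lra.
Qed.
End same_cell.

Lemma same_cell_intercept j x y : unit_ball x -> unit_ball y ->
  cell A j (resolvent x) = cell A j (resolvent y) -> e <= mesh j ^+ 2 ->
  `|intercept j x - intercept j y| <= (d + 1)%:R * mesh j ^+ 2.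
Proof.
move=> xB yB xy ej; rewrite ler_norml; apply/andP; split.
  by rewrite lerNl opprB; exact: same_cell_intercept_le.
exact: same_cell_intercept_le.
Qed.
End fixed_selection.
End convex_class.

(** * Coding a convex function cell by cell *)

Section coding.
Context {R : realType} {d : nat}.
Implicit Types (x y : d.-tuple R) (h : d.-tuple R -> R) (A j M : nat).

(* Occupied cells, approximate intercepts and approximate contact points. *)
Definition cell_data A j : Type :=
  ((@cells d A j -> bool) * (@cells d A j -> R) *
   (@cells d A j -> 'I_d -> R))%type.

Definition faithful_data A h p j (D : cell_data A j) :=
  [/\ forall x, unit_ball x -> D.1.1 (cell A j (resolvent p x)),
      forall q, D.1.1 q ->
        exists2 x, unit_ball x & cell A j (resolvent p x) = q,
      forall x, unit_ball x ->
        `|D.1.2 (cell A j (resolvent p x)) - intercept A h p j x|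
          <= (d + 2)%:R * mesh j ^+ 2 &
      forall x, unit_ball x -> forall i,
        `|D.2 (cell A j (resolvent p x)) i - tnth x i| <= (d + 5)%:R * mesh j].

(** The symbol written in one cell: whether it is occupied, and by how many units of [mesh j ^+ 2]
    and [mesh j] a predicted intercept and contact point are to be corrected. *)
Definition letter M : finType :=
  (bool * 'I_(2 * M).+1 * {ffun 'I_d -> 'I_(2 * M).+1})%type.

Definition offset M (k : 'I_(2 * M).+1) : R := k%:R - M%:R.

Lemma offsetP M (t : R) : `|t| <= M%:R -> exists k, `|t - @offset M k| <= 1.
Proof.
rewrite ler_norml => /andP[t1 t2].
have t0 : 0 <= t + M%:R by lra.
have /andP[k1 k2] := truncn_itv t0.
have kM : (Num.truncn (t + M%:R) < (2 * M).+1)%N.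
  rewrite ltnS -(ler_nat R); apply: le_trans k1 _.
  by rewrite mul2n -addnn natrD; lra.
exists (Ordinal kM); rewrite /offset /=; move: k1 k2.
set k := Num.truncn _; rewrite -[k.+1%:R]natr1 => k1 k2.
by rewrite ler_norml; apply/andP; split; lra.
Qed.

Lemma offset_scaledP M (t s c : R) : 0 < c -> `|s - t| <= M%:R * c ->
  exists k, `|s + @offset M k * c - t| <= c.
Proof.
move=> c0 st; have [|k kP] := @offsetP M ((t - s) / c).
  by rewrite normrM normfV (gtr0_norm c0) ler_pdivrMr// distrC.
exists k; have -> : s + offset k * c - t = - (((t - s) / c - offset k) * c).
  by field; rewrite gt_eqF.
by rewrite normrN normrM (gtr0_norm c0) ler_piMl// ltW.
Qed.

Definition refine A j M (pa : @cells d A j -> R) (px : @cells d A j -> 'I_d -> R)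
    (c : {ffun @cells d A j -> letter M}) : cell_data A j :=
  (fun q => (c q).1.1,
   fun q => pa q + offset (c q).1.2 * mesh j ^+ 2,
   fun q i => px q i + offset ((c q).2 i) * mesh j).

(** The letter of an occupied cell corrects the prediction to within one unit at a single contact
    point. The other contact points of that cell add [d + 1] and [d + 4] units, whence the constants
    [d + 2] and [d + 5] of [faithful_data]. *)
Lemma refineP A M h p e j pa px : 0 < e -> approx_subgradients A h p e ->
  e <= mesh j ^+ 2 ->
  (forall x, unit_ball x ->
    `|pa (cell A j (resolvent p x)) - intercept A h p j x|
      <= M%:R * mesh j ^+ 2) ->
  (forall x, unit_ball x -> forall i,
    `|px (cell A j (resolvent p x)) i - tnth x i| <= M%:R * mesh j) ->
  exists c : {ffun @cells d A j -> letter M}, faithful_data h p (refine pa px c).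
Proof.
move=> e0 ph ej paP pxP.
have m0 := @mesh_gt0 R j; have m20 : 0 < mesh j ^+ 2 :> R by exact: exprn_gt0.
pose occ q := `[< exists2 x, unit_ball x & cell A j (resolvent p x) = q >].
have cP q : exists l : letter M, l.1.1 = occ q /\ (occ q ->
    exists2 x, unit_ball x & [/\ cell A j (resolvent p x) = q,
    `|pa q + offset l.1.2 * mesh j ^+ 2 - intercept A h p j x| <= mesh j ^+ 2 &
    forall i, `|px q i + offset (l.2 i) * mesh j - tnth x i| <= mesh j]).
  case: (boolP (occ q)) => [oq|_]; last first.
    by exists (false, ord0, [ffun=> ord0]).
  have /asboolP[x xB xq] := oq.
  have [k kP] : exists k, `|pa q + @offset M k * mesh j ^+ 2
      - intercept A h p j x| <= mesh j ^+ 2.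
    by apply: offset_scaledP => //; rewrite -xq; exact: paP.
  have /choice[f fP] : forall i, exists k,
      `|px q i + @offset M k * mesh j - tnth x i| <= mesh j.
    by move=> i; apply: offset_scaledP => //; rewrite -xq; exact: pxP.
  exists (true, k, finfun f); split=> // _; exists x => //; split=> // i.
  by rewrite ffunE.
have {cP} /choice[c cP] := cP.
exists (finfun c); split => /=.
- move=> x xB; rewrite ffunE (cP _).1; apply/asboolP.
  by exists x.
- by move=> q; rewrite ffunE (cP _).1 => /asboolP.
- move=> x xB; set q := cell A j _.
  have oq : occ q by apply/asboolP; exists x.
  have [_ /(_ oq) [y yB [yq ya _]]] := cP q; rewrite ffunE.
  have := same_cell_intercept ph yB xB yq ej.
  move: ya; set a := _ + _ * _ => ya yx.
  have := ler_distD (intercept A h p j y) a (intercept A h p j x).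
  move: ya yx; rewrite !natrD !mulrDl; lra.
- move=> x xB i; set q := cell A j _.
  have oq : occ q by apply/asboolP; exists x.
  have [_ /(_ oq) [y yB [yq _ /(_ i) yx]]] := cP q; rewrite ffunE.
  have := same_cell_close ph yB xB yq ej i.
  move: yx; set a := _ + _ * _ => ya yx.
  have := ler_distD (tnth y i) a (tnth x i).
  move: ya yx; rewrite !natrD !mulrDl; lra.
Qed.

(** The terms pay, in order, for the parent's error in the intercept (4 because squared meshes
    quarter), for its error in the contact point times the shift of the corner, for its error in the
    contact point, and for the initial prediction 0 at level 0. *)
Definition letter_range A : nat :=
  (4 * (d + 2) + 2 * (d * (d + 5)) + 2 * (d + 5) + d * (2 * A + 10) + 10)%N.

Lemma convex_bound A h p e x : approx_subgradients A h p e ->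
  h [tuple 0 | i < d] = 0 -> unit_ball x -> `|h x| <= d%:R * A%:R + e.
Proof.
move=> ph h0 xB.
have oB : unit_ball ([tuple 0 | i < d] : d.-tuple R).
  apply/unit_ballP; rewrite big1// => i _.
  by rewrite tnth_mktuple expr0n.
have B (z : 'I_d -> R) : (forall i, `|z i| <= A%:R) ->
    `|\sum_i z i * tnth x i| <= d%:R * A%:R.
  move=> zA; apply: le_trans (ler_norm_sum _ _ _) _.
  apply: sum_le_const => i; rewrite normrM.
  by rewrite -[leRHS]mulr1 ler_pM// unit_ball_coord.
have [/B pA /(_ _ xB)] := ph _ oB.
have [/B qA /(_ _ oB)] := ph _ xB.
rewrite h0 add0r.
under eq_bigr do rewrite tnth_mktuple sub0r mulrN.
rewrite sumrN.
under [in X in _ -> X -> _]eq_bigr do rewrite tnth_mktuple subr0.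
move: pA qA; rewrite !ler_norml => /andP[? ?] /andP[? ?] *.
by apply/andP; split; lra.
Qed.

(** Each level is coded relative to its parent, so the alphabet does not grow with the level. Coding
    the finest level from scratch would need corrections of about 4^J units and lose a factor J in
    the entropy. *)
Lemma exists_code A J : exists (I : finType) (F : I -> cell_data A J),
  (#|I| <= #|letter (letter_range A)| ^ \sum_(j < J.+1) #|@cells d A j|)%N /\
  forall h p e, 0 < e -> approx_subgradients A h p e ->
    h [tuple 0 | i < d] = 0 -> e <= mesh J ^+ 2 ->
    exists i, faithful_data h p (F i).
Proof.
set M := letter_range A.
elim: J => [|J [I [F [cardI FP]]]].
  exists {ffun @cells d A 0 -> letter M}.
  exists (refine (fun=> 0) (fun _ _ => 0)); split.
    by rewrite card_ffun big_ord_recl big_ord0 addn0.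
  move=> h p e e0 ph h0 eJ; apply: (refineP e0 ph eJ) => // x xB; last first.
    move=> i; rewrite sub0r normrN /mesh expr0 mulr1.
    apply: le_trans (unit_ball_coord i xB) _.
    by rewrite ler1n /M /letter_range; lia.
  rewrite sub0r normrN /mesh expr0 expr1n mulr1 /intercept /potential.
  have hx := convex_bound ph h0 xB.
  have e1 : e <= 1 by apply: le_trans eJ _; rewrite /mesh expr0 expr1n.
  have S1 : `|\sum_i tnth x i * corner (cell A 0 (resolvent p x)) i|
      <= d%:R * (A + 2)%:R.
    apply: le_trans (ler_norm_sum _ _ _) _; apply: sum_le_const => i.
    rewrite normrM -[leRHS]mul1r ler_pM// ?unit_ball_coord//.
    have /andP[] := corner_cell 0 i (resolvent_box ph xB).
    have := resolvent_box ph xB i; rewrite /mesh expr0 !ler_norml.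
    rewrite -natr1 natrD => /andP[? ?] *; apply/andP; split; lra.
  have /unit_ballP S2 := xB.
  have S3 : 0 <= \sum_i tnth x i ^+ 2 by apply: sumr_ge0 => i _; exact: sqr_ge0.
  have : d%:R * (2 * A + 10)%:R + 10 <= M%:R :> R.
    by rewrite -natrM -natrD ler_nat /M /letter_range; lia.
  have : 0 <= d%:R :> R by [].
  move: S1 hx; rewrite !natrD !mulrDr !natrM !ler_norml => /andP[? ?] /andP[? ?] *.
  apply/andP; split; lra.
exists (I * {ffun @cells d A J.+1 -> letter M})%type.
(* For a fixed contact point x, passing to the next level changes the intercept by exactly <x,
   change of corner>. The prediction uses the parent's approximation of x. *)
exists (fun ic => refine
  (fun q => (F ic.1).1.2 (parent q) + \sum_i (F ic.1).2 (parent q) i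
     * (corner q i - corner (parent q) i))
  (fun q => (F ic.1).2 (parent q)) ic.2); split.
  by rewrite card_prod card_ffun big_ord_recr/= expnD leq_mul.
move=> h p e e0 ph h0 eJ.
have mS := @mesh_gt0 R J.+1.
have eJ' : e <= mesh J ^+ 2.
  apply: le_trans eJ _; rewrite (meshS J) exprMn ler_peMl ?sqr_ge0//.
  by rewrite -natrX ler1n.
have [i [_ _ Fa Fx]] := FP _ _ _ e0 ph h0 eJ'.
have [||c cP] := @refineP A M h p e J.+1
  (fun q => (F i).1.2 (parent q) + \sum_k (F i).2 (parent q) k
     * (corner q k - corner (parent q) k)) (fun q => (F i).2 (parent q)) e0 ph eJ.
- move=> x xB; have bx := resolvent_box ph xB.
  rewrite parent_cell//; have := Fa _ xB; have := Fx _ xB.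
  set q := cell A J _; move=> hx ha.
  have qq : parent (cell A J.+1 (resolvent p x)) = q by exact: parent_cell.
  set q' := cell A J.+1 _ in qq *.
  have -> : (F i).1.2 q + \sum_k (F i).2 q k * (corner q' k - corner q k)
      - intercept A h p J.+1 x = ((F i).1.2 q - intercept A h p J x)
      + \sum_k ((F i).2 q k - tnth x k) * (corner q' k - corner q k).
    rewrite /intercept -/q -/q'.
    have -> : \sum_k ((F i).2 q k - tnth x k) * (corner q' k - corner q k) =
       \sum_k (F i).2 q k * (corner q' k - corner q k)
       - \sum_k tnth x k * corner q' k + \sum_k tnth x k * corner q k.
      rewrite -sumrB -big_split; apply: eq_bigr => k _ /=; ring.
    ring.
  apply: le_trans (ler_normD _ _) _.
  have S : `|\sum_k ((F i).2 q k - tnth x k) * (corner q' k - corner q k)|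
      <= d%:R * ((d + 5)%:R * mesh J * mesh J.+1).
    apply: le_trans (ler_norm_sum _ _ _) _; apply: sum_le_const => k.
    rewrite normrM ler_pM//.
    have := @corner_parent R _ _ _ q' k; rewrite qq => /andP[? ?].
    by rewrite ger0_norm; lra.
  have M4 : (4 * (d + 2) + 2 * (d * (d + 5)))%:R * mesh J.+1 ^+ 2 <=
      M%:R * mesh J.+1 ^+ 2 :> R.
    by rewrite ler_wpM2r ?sqr_ge0// ler_nat /M /letter_range; lia.
  apply: le_trans M4; rewrite natrD [in leRHS]mulrDl !natrM; apply: lerD.
    by apply: le_trans ha _; rewrite (meshS J) exprMn -natrX mulrCA mulrA.
  apply: le_trans S _; rewrite (meshS J) le_eqVlt; apply/orP; left; apply/eqP.
  ring.
- move=> x xB k; rewrite parent_cell//; last exact: (resolvent_box ph xB).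
  apply: le_trans (Fx _ xB k) _.
  rewrite (meshS J) mulrA ler_wpM2r ?(ltW mS)//.
  by rewrite -(natrM _ _ 2) ler_nat /M /letter_range; lia.
by exists (i, c).
Qed.
End coding.

(** * Decoding, and the covering bound *)

Section covering.
Context {R : realType} {d : nat}.
Implicit Types (x y : d.-tuple R) (h : d.-tuple R -> R) (A j M : nat).

(** The maximum of the coded affine functions approximates [potential], and the quadratic is then
    removed. By [convex_bound] the default value lies below [potential] on the ball when
    [e <= 1]. *)
Definition decode A j (D : @cell_data R d A j) x : R :=
  \big[Order.max/- (d * A + 2)%:R]_(q | D.1.1 q)
    (\sum_i corner q i * tnth x i - D.1.2 q) - (\sum_i tnth x i ^+ 2) / 2.

Lemma measurable_coord (i : 'I_d) :
  measurable_fun [set: d.-tuple R] (fun x => tnth x i).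
Proof. exact: measurable_tnth. Qed.

Lemma measurable_sum_sqr :
  measurable_fun [set: d.-tuple R] (fun x => \sum_i tnth x i ^+ 2).
Proof.
apply: measurable_sum => i; apply: measurable_funX; exact: measurable_coord.
Qed.

Lemma measurable_bigmax dT (T : measurableType dT) (I : Type) (s : seq I)
    (P : pred I) (c : R) (f : I -> T -> R) :
  (forall i, measurable_fun setT (f i)) ->
  measurable_fun setT (fun w => \big[Order.max/c]_(i <- s | P i) f i w).
Proof.
move=> mf; elim: s => [|i s IHs].
  by under eq_fun do rewrite big_nil; exact: measurable_cst.
under eq_fun do rewrite big_cons; case: (P i) => //.
exact: measurable_maxr.
Qed.

Lemma measurable_decode A j (D : @cell_data R d A j) :
  measurable_fun setT (decode D).
Proof.
apply: measurable_funB; last first.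
  apply: measurable_funM; [exact: measurable_sum_sqr|exact: measurable_cst].
apply: measurable_bigmax => q; apply: measurable_funB => //.
apply: measurable_sum => i; apply: measurable_funM => //.
exact: measurable_coord.
Qed.

(** The cell of x itself gives the lower bound on the maximum. For the upper bound, an affine
    function with contact point y and slope off by order [mesh j] could exceed [potential] at x by
    that order times |x - y|; strong convexity takes back |x - y|^2/2, which leaves order
    [mesh j ^+ 2]. *)
Lemma decodeP A j h p e (D : @cell_data R d A j) x :
  approx_subgradients A h p e -> h [tuple 0 | i < d] = 0 ->
  e <= mesh j ^+ 2 -> faithful_data h p D -> unit_ball x ->
  `|h x - decode D x| <= (2 * d + 3)%:R * mesh j ^+ 2.
Proof.
move=> ph h0 ej [D1 D2 D3 _] xB.
have m0 := @mesh_gt0 R j; have m20 : 0 < mesh j ^+ 2 :> R by exact: exprn_gt0.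
have d0 : 0 <= d%:R :> R by [].
have dm0 : 0 <= d%:R * mesh j ^+ 2 :> R by rewrite mulr_ge0// ltW.
rewrite /decode; set g := \big[_/_]_(_ | _) _.
have e1 : e <= 1.
  by apply: le_trans ej _; rewrite exprn_ile1// ?mesh_le1// ltW.
have S0 : 0 <= \sum_i tnth x i ^+ 2 by apply: sumr_ge0 => i _; exact: sqr_ge0.
have gub : g <= potential h x + (2 * d + 3)%:R * mesh j ^+ 2.
  apply/bigmax_le => [|q /D2[y yB yq]].
    have := convex_bound ph h0 xB.
    have : 0 <= (2 * d + 3)%:R * mesh j ^+ 2 :> R by rewrite mulr_ge0// ltW.
    rewrite /potential natrD natrM ler_norml => ? /andP[? _]; lra.
  have := D3 _ yB; rewrite /intercept yq ler_norml => /andP[ay _].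
  have := potential_lb ph yB xB.
  have : 0 <= \sum_i (corner q i - resolvent p y i - (tnth x i - tnth y i)) ^+ 2.
    by apply: sumr_ge0 => i _; exact: sqr_ge0.
  have -> : \sum_i (corner q i - resolvent p y i - (tnth x i - tnth y i)) ^+ 2 =
     \sum_i (corner q i - resolvent p y i) ^+ 2
     - 2 * (\sum_i corner q i * tnth x i - \sum_i tnth y i * corner q i
           - \sum_i resolvent p y i * (tnth x i - tnth y i))
     + \sum_i (tnth x i - tnth y i) ^+ 2.
    rewrite -!sumrB mulr_sumr -sumrB -big_split; apply: eq_bigr => k _ /=; ring.
  have : \sum_i (corner q i - resolvent p y i) ^+ 2 <= d%:R * mesh j ^+ 2.
    apply: sum_le_const => i; apply: sqr_le_sqr.
    have := corner_cell j i (resolvent_box ph yB); rewrite yq => /andP[? ?].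
    by rewrite ler_norml; apply/andP; split; lra.
  by move: ay ej; rewrite !natrD !mulrDl ?natrM; lra.
have glb : potential h x - (d + 2)%:R * mesh j ^+ 2 <= g.
  apply: bigmax_sup (D1 _ xB) _; have := D3 _ xB.
  rewrite /intercept ler_norml => /andP[_].
  under [in X in _ -> _ <= X - _]eq_bigr do rewrite mulrC.
  lra.
move: gub glb; rewrite /potential !natrD !mulrDl ?natrM ler_norml => gub glb.
by apply/andP; split; lra.
Qed.

Lemma sum_cells A J : (0 < d)%N ->
  (\sum_(j < J.+1) #|@cells d A j| <= 2 * (2 * A + 5) ^ d * 2 ^ (J * d))%N.
Proof.
move=> d0; apply: (@leq_trans (\sum_(j < J.+1) (2 * A + 5) ^ d * 2 ^ (j * d))%N).
  apply: leq_sum => j _; rewrite card_ffun !card_ord expnM -expnMn leq_exp2r//.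
  have : (0 < 2 ^ j)%N by rewrite expn_gt0.
  by move: (2 ^ j)%N => t; nia.
rewrite -big_distrr/= -mulnA mulnCA leq_mul2l; apply/orP; right.
elim: J => [|J IH]; first by rewrite big_ord_recl big_ord0 mul0n.
rewrite big_ord_recr/=; apply: leq_trans (leq_add IH (leqnn _)) _.
rewrite [leqRHS]mulnC muln2 -addnn leq_add2r [(J.+1 * d)%N]mulSn expnD leq_mul2r.
by apply/orP; right; rewrite -{1}[2%N]expn1 leq_pexp2l.
Qed.

(* Bronshtein's entropy bound. *)
Lemma convex_lip_covering A : (0 < d)%N -> exists2 a : R, 0 < a & forall J,
  exists (I : finType) (F : I -> d.-tuple R -> R),
    [/\ forall i, measurable_fun setT (F i),
        #|I|%:R <= expR (a * 2 ^+ (J * d)) &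
        forall h, convex_lip A h -> exists i, forall x, unit_ball x ->
          `|h x - F i x| <= a * mesh J ^+ 2].
Proof.
move=> d0; set L := #|@letter d (@letter_range d A)|.
have L0 : 0 < L%:R :> R.
  rewrite ltr0n; apply/card_gt0P.
  by exists ((false, ord0), [ffun=> ord0]).
have lnL : 0 <= ln L%:R :> R by rewrite ln_ge0// ler1n -(ltr0n R).
set c : R := (2 * (2 * A + 5) ^ d)%:R.
have c0 : 0 <= c by [].
have cL : 0 <= ln L%:R * c by exact: mulr_ge0.
exists (ln L%:R * c + (2 * d + 3)%:R) => [|J].
  by rewrite ltr_wpDl// ltr0n addn3.
have [I [F [cardI FP]]] := @exists_code R d A J.
exists I, (fun i => decode (F i)); split=> [i||h [h0 hp]].
- exact: measurable_decode.
- apply: le_trans (_ : (L ^ (2 * (2 * A + 5) ^ d * 2 ^ (J * d)))%:R <= _).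
    rewrite ler_nat; apply: leq_trans cardI _.
    by rewrite leq_pexp2l ?sum_cells// -(ltr0n R).
  rewrite natrX -{1}[L%:R]lnK ?posrE// -expRM_natl ler_expR natrM -/c natrX.
  rewrite mulrDl [c * _ * _]mulrC mulrA lerDl.
  by rewrite mulr_ge0// exprn_ge0.
- have [p ph] := hp (mesh J ^+ 2) (exprn_gt0 _ (mesh_gt0 _)).
  have [i iP] := FP h p _ (exprn_gt0 _ (mesh_gt0 _)) ph h0 (lexx _).
  exists i => x xB; apply: le_trans (decodeP ph h0 (lexx _) iP xB) _.
  by rewrite ler_wpM2r ?sqr_ge0// lerDr.
Qed.
End covering.

(** * From independence of events to expectations of products *)

Lemma prod_indic {R : realType} {T : Type} (I : eqType) (s : seq I)
    (B : I -> set T) (w : T) :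
  \prod_(i <- s) \1_(B i) w = \1_(\bigcap_(i in [set` s]) B i) w :> R.
Proof.
rewrite indicE; case: (boolP (w \in _)) => [/set_mem Bw|].
  by rewrite big1_seq// => i /andP[_ is_]; rewrite indicE mem_set//; exact: Bw.
rewrite notin_setE => /existsNP[i /not_implyP[/= is_ Bw]].
by rewrite (big_rem i)//= indicE memNset// mul0r.
Qed.

Section independence.
Context {R : realType} {dO : measure_display} {Omega : measurableType dO}.
Context {dT : measure_display} {T : measurableType dT}.
Variable P : probability Omega R.

Import HBNNSimple.

Section weighted.
Variables (W : Omega -> R) (X : Omega -> T) (c : R).
Hypotheses (mW : measurable_fun setT W) (W0 : forall w, 0 <= W w).
Hypotheses (mX : measurable_fun setT X) (c0 : 0 <= c).
Hypothesis Wc : forall A, measurable A ->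
  (\int[P]_w (W w * \1_A (X w))%:E = c%:E * \int[P]_w (\1_A (X w))%:E)%E.

Let m_indic A : measurable A -> measurable_fun setT (fun w => \1_A (X w) : R).
Proof.
by move=> mA; apply: (@measurableT_comp _ _ _ _ _ _ (\1_A : T -> R) _ X).
Qed.

Let expand (V : Omega -> R) (h : {nnsfun T >-> R}) :
    (forall w, 0 <= V w) -> measurable_fun setT V ->
  (\int[P]_w (V w * h (X w))%:E = \sum_(r \in range h)
     (r%:E * \int[P]_w (V w * \1_(h @^-1` [set r]) (X w))%:E))%E.
Proof.
move=> V0 mV.
have mr r : measurable_fun setT (fun w => \1_(h @^-1` [set r]) (X w) : R).
  exact: m_indic.
have mVr r : measurable_fun setT
    (fun w => (V w * \1_(h @^-1` [set r]) (X w))%:E).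
  by apply/measurable_EFinP/measurable_funM.
transitivity (\int[P]_w (\sum_(r \in range h)
    (r%:E * (V w * \1_(h @^-1` [set r]) (X w))%:E)))%E.
  apply: eq_integral => w _; rewrite EFinM fimfunE -fsumEFin//.
  rewrite ge0_mule_fsumr; last first.
    by move=> r; rewrite EFinM nnfun_muleindic_ge0.
  by apply: eq_fsbigr => r _; rewrite -!EFinM mulrCA.
rewrite ge0_integral_fsum//.
- apply: eq_fsbigr => r /[!inE] -[t _ ht]; rewrite ge0_integralZl//.
  + by move=> w _; rewrite lee_fin mulr_ge0.
  + by rewrite lee_fin -ht.
- by move=> r; exact: emeasurable_funM.
- move=> r w _; rewrite -EFinM lee_fin mulrCA mulr_ge0//.
  by rewrite -lee_fin EFinM nnfun_muleindic_ge0.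
Qed.

Let weighted_nnsfun (h : {nnsfun T >-> R}) :
  (\int[P]_w (W w * h (X w))%:E = c%:E * \int[P]_w (h (X w))%:E)%E.
Proof.
rewrite expand//.
under [in RHS]eq_integral do rewrite -[h _]mul1r.
rewrite (expand (V := fun=> 1))//.
rewrite ge0_mule_fsumr; last first.
  move=> r; have [->|/set0P[t ht]] := eqVneq (h @^-1` [set r]) set0.
    under eq_integral do rewrite indic0 mulr0.
    by rewrite integral0 mule0.
  apply: mule_ge0; first by rewrite lee_fin -ht.
  by apply: integral_ge0 => w _; rewrite lee_fin mul1r.
apply: eq_fsbigr => r _; rewrite Wc// muleCA; congr (_ * (_ * _))%E.
by apply: eq_integral => w _; rewrite mul1r.
Qed.

(** [Wc] is the case of indicators; linearity extends it to simple functions and monotone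
    convergence to nonnegative ones. *)
Lemma integral_weighted (phi : T -> R) : measurable_fun setT phi ->
  (forall t, 0 <= phi t) ->
  (\int[P]_w (W w * phi (X w))%:E = c%:E * \int[P]_w (phi (X w))%:E)%E.
Proof.
move=> mphi phi0.
have mphi' : measurable_fun setT (EFin \o phi) by exact/measurable_EFinP.
pose f_ := nnsfun_approx measurableT mphi'.
have mf n : measurable_fun setT (fun w => f_ n (X w)).
  by apply: (@measurableT_comp _ _ _ _ _ _ (f_ n) _ X).
have cvgf t : EFin \o f_^~ t @ \oo --> (phi t)%:E.
  by apply: cvg_nnsfun_approx => // ? _; rewrite lee_fin.
have ndf t m n : (m <= n)%N -> (f_ m t <= f_ n t)%R.
  by move=> mn; exact/lefP/nd_nnsfun_approx.
transitivity (limn (fun n => \int[P]_w (W w * f_ n (X w))%:E)%E).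
  rewrite -monotone_convergence//=.
  - apply: eq_integral => w _; apply/esym/cvg_lim => //=.
    rewrite EFinM; under eq_fun do rewrite EFinM.
    by apply: cvgeZl => //; exact: cvgf.
  - by move=> n; apply/measurable_EFinP/measurable_funM.
  - by move=> n w _; rewrite lee_fin mulr_ge0.
  - by move=> w _ m n mn; rewrite lee_fin ler_wpM2l// ndf.
rewrite (_ : (\int[P]_w (phi (X w))%:E)%E =
    limn (fun n => \int[P]_w (f_ n (X w))%:E)%E); last first.
  rewrite -monotone_convergence//=.
  - by apply: eq_integral => w _; apply/esym/cvg_lim => //=; exact: cvgf.
  - by move=> n; exact/measurable_EFinP.
  - by move=> n w _; rewrite lee_fin.
  - by move=> w _ m n mn; rewrite lee_fin ndf.
rewrite -limeMl//.
  by congr (limn _); apply/funext => n; rewrite weighted_nnsfun.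
apply/ereal_nondecreasing_is_cvgn => a b ab; apply: ge0_le_integral => //.
- by move=> w _; rewrite lee_fin.
- exact/measurable_EFinP.
- exact/measurable_EFinP.
- by move=> w _; rewrite lee_fin ndf.
Qed.
End weighted.

(** Indicators are traded for functions one index at a time, by [integral_weighted] with all other
    factors as the weight. This is why the induction runs on the mixed statement [H], for arbitrary
    events in [s2]. *)
Lemma integral_prod_independent (I : finType) (X : I -> {RV P >-> T})
    (phi : I -> T -> R) (e : I -> R) :
  mutually_independent X ->
  (forall i, measurable_fun setT (phi i)) -> (forall i t, 0 <= phi i t) ->
  (forall i, \int[P]_w (phi i (X i w))%:E = (e i)%:E)%E ->
  forall s : seq I, uniq s ->
  (\int[P]_w (\prod_(i <- s) phi i (X i w))%:E = (\prod_(i <- s) e i)%:E)%E.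
Proof.
move=> indep mphi phi0 phie.
have e0 i : 0 <= e i.
  by rewrite -lee_fin -phie integral_ge0// => w _; rewrite lee_fin.
have mX i : measurable_fun setT (X i) by exact: measurable_funPT.
have m_indic i (A : set T) : measurable A ->
    measurable_fun setT (fun w => \1_A (X i w) : R).
  by move=> mA; apply: (@measurableT_comp _ _ _ _ _ _ (\1_A : T -> R) _ (X i)).
suff H s1 : forall (s2 : seq I) (A : I -> set T),
    (forall i, measurable (A i)) -> uniq (s1 ++ s2) ->
    (\int[P]_w (\prod_(i <- s1) phi i (X i w)
      * \prod_(i <- s2) \1_(A i) (X i w))%:E =
     (\prod_(i <- s1) e i * \prod_(i <- s2) fine (P (X i @^-1` A i)))%:E)%E.
  move=> s us; have := H s [::] (fun=> setT) (fun=> measurableT).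
  rewrite cats0 => /(_ us); under eq_integral do rewrite big_nil mulr1.
  by rewrite big_nil mulr1.
have mW (r1 r2 : seq I) (A : I -> set T) : (forall i, measurable (A i)) ->
    measurable_fun setT (fun w => \prod_(i <- r1) phi i (X i w)
      * \prod_(i <- r2) \1_(A i) (X i w)).
  move=> mA; apply: measurable_funM; apply: measurable_prod => i _.
    by apply: (@measurableT_comp _ _ _ _ _ _ (phi i) _ (X i)).
  exact: m_indic.
elim: s1 => [|i s1 IH] s2 A mA us.
  rewrite big_nil mul1r.
  transitivity (\int[P]_w
      (\1_(\bigcap_(i in [set` s2]) X i @^-1` A i) w)%:E)%E.
    apply: eq_integral => w _; rewrite big_nil mul1r -prod_indic.
    by congr EFin; apply: eq_bigr => i _; rewrite !indicE.
  rewrite integral_indic//; last first.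
    apply: fin_bigcap_measurable => // i _.
    rewrite -[_ @^-1` _]setTI; exact: mX.
  rewrite setIT.
  have <- : [set` [set i in s2]%SET] = [set` s2].
    by apply/seteqP; split => i /=; rewrite inE.
  apply: (etrans (indep [set i in s2]%SET A (fun i _ => mA i))).
  rewrite (eq_bigl (mem s2)); last by move=> i; rewrite inE.
  rewrite -big_uniq//= (big_morph EFin EFinM erefl); apply: eq_bigr => i _.
  rewrite fineK// fin_num_measure// -[_ @^-1` _]setTI; exact: mX.
have /andP[is12 us'] : (i \notin s1 ++ s2) && uniq (s1 ++ s2) by [].
under eq_integral do rewrite big_cons -mulrA mulrC.
rewrite big_cons -mulrA mulrC EFinM -phie.
apply: (integral_weighted (X := X i)) => //.
- exact: mW.
- by move=> w; apply: mulr_ge0; apply: prodr_ge0.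
move=> B mB.
(* The index [i] moves from the functions to the events, with event [B]. It occurs in neither [s1]
   nor [s2], so no other factor changes. *)
pose A' k := if k == i then B else A k.
have A'i : A' i = B by rewrite /A' eqxx.
have s2A k : k \in s2 -> A' k = A k.
  move=> ks2; rewrite /A'; case: eqP => // ki.
  by move: is12; rewrite mem_cat -ki ks2 orbT.
have mXB : measurable (X i @^-1` B).
  by rewrite -[_ @^-1` _]setTI; exact: mX.
have -> : (\int[P]_w (\1_B (X i w))%:E = (fine (P (X i @^-1` B)))%:E)%E.
  rewrite fineK ?fin_num_measure//.
  by rewrite (integral_indic _ measurableT mXB) setIT.
transitivity (\int[P]_w (\prod_(i <- s1) phi i (X i w)
      * \prod_(i <- i :: s2) \1_(A' i) (X i w))%:E)%E.
  apply: eq_integral => w _; congr EFin; rewrite -mulrA; congr (_ * _).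
  rewrite big_cons mulrC A'i; congr (_ * _).
  by apply: eq_big_seq => k ks /=; rewrite s2A.
rewrite IH.
- rewrite big_cons -EFinM -mulrA [X in _ * X]mulrC; congr (_ * (_ * _))%:E.
    by apply: eq_big_seq => k ks; rewrite /= (s2A k ks).
  by rewrite A'i.
- by move=> k; rewrite /A'; case: ifP.
- have := perm_uniq (permEl (perm_catCA s1 [:: i] s2)).
  by rewrite /= => ->.
Qed.
End independence.

(** * Exponential moments and a maximal inequality for finite classes *)

Section maximal_inequality.
Context {R : realType} {dO : measure_display} {Omega : measurableType dO}.
Context {dT : measure_display} {T : measurableType dT}.
Variable P : probability Omega R.

(** Inverting exp(-x) >= 1 - x gives exp(x) <= 1/(1 - x), and (1 - x)(1 + x + 2 x^2) = 1 + x^2 (1 -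
    2 x). *)
Lemma expR_le_quadratic (x : R) : `|x| <= 1 / 2 -> expR x <= 1 + x + 2 * x ^+ 2.
Proof.
rewrite ler_norml => /andP[x1 x2]; rewrite -[x in expR x]opprK expRN.
have h : 1 - x <= expR (- x) by exact: expR_ge1Dx.
have h0 : 0 < 1 - x by lra.
apply: le_trans (_ : (1 - x)^-1 <= _).
  by rewrite lef_pV2// posrE (lt_le_trans h0).
rewrite -[X in X <= _]mul1r ler_pdivrMr//.
have : 0 <= x ^+ 2 * (1 - 2 * x) by apply: mulr_ge0; [exact: sqr_ge0|lra].
rewrite -subr_ge0 => h1; rewrite -subr_ge0; apply: le_trans h1 _.
by rewrite le_eqVlt; apply/orP; left; apply/eqP; ring.
Qed.

Lemma bounded_integrable (f : Omega -> R) (b : R) :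
  measurable_fun setT f -> (forall w, `|f w| <= b) ->
  P.-integrable setT (EFin \o f).
Proof.
move=> mf fb; apply: measurable_bounded_integrable => //.
  by rewrite fin_num_fun_lty//; exact: fin_num_measure.
exists b; split => [|M bM w _]; first exact: num_real.
exact: le_trans (fb w) (ltW bM).
Qed.

(** After [expR_le_quadratic] the linear term integrates to 0. As |f - e| <= 2 b, the quadratic one
    is at most 2 (2 l b)^2. *)
Lemma mgf_bound (f : Omega -> R) (b l e : R) : measurable_fun setT f ->
  (forall w, `|f w| <= b) -> (\int[P]_w (f w)%:E = e%:E)%E ->
  `|l| * (2 * b) <= 1 / 2 ->
  (\int[P]_w (expR (l * (f w - e)))%:E <= (expR (8 * l ^+ 2 * b ^+ 2))%:E)%E.
Proof.
move=> mf fb fe lb.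
have intf := bounded_integrable mf fb.
have eb : `|e| <= b.
  rewrite -lee_fin -abse_EFin -fe.
  apply: le_trans (le_abse_integral _ _ _) _ => //; first exact/measurable_EFinP.
  apply: le_trans (_ : \int[P]_w (cst b%:E) w <= _)%E.
    by apply: ge0_le_integral => //; [exact/measurable_EFinP/measurableT_comp|
      move=> w _; rewrite lee_fin].
  by rewrite integral_cst// [X in (_ * X)%E]probability_setT mule1.
have feb w : `|f w - e| <= 2 * b.
  by apply: le_trans (ler_normB _ _) _; have := fb w; lra.
have mfe : measurable_fun setT (fun w => f w - e) by exact: measurable_funB.
apply: le_trans (_ : (\int[P]_w (1 + 8 * l ^+ 2 * b ^+ 2 - l * e + l * f w)%:E)
   <= _)%E.
  apply: ge0_le_integral => //.
  - by apply/measurable_EFinP/measurableT_comp => //; exact: measurable_funM.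
  - by apply/measurable_EFinP/measurable_funD => //; exact: measurable_funM.
  - move=> w _; rewrite lee_fin.
    have h : `|l * (f w - e)| <= 1 / 2.
      by rewrite normrM; apply: le_trans lb; rewrite ler_wpM2l.
    apply: le_trans (expR_le_quadratic h) _.
    have := ler_wpM2l (sqr_ge0 l) (sqr_le_sqr (feb w)).
    rewrite !exprMn; lra.
under eq_integral do rewrite EFinD EFinM.
rewrite integralD//; last 2 first.
- exact: finite_measure_integrable_cst.
- exact: integrableZl.
rewrite integralZl// fe integral_cst// [X in (_ * X)%E]probability_setT mule1 -EFinM -EFinD lee_fin.
by rewrite subrK expR_ge1Dx.
Qed.

Lemma mgf_sum_bound (I : finType) (X : I -> {RV P >-> T}) (g : I -> T -> R)
    (e : I -> R) (s : seq I) (b l : R) :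
  mutually_independent X -> uniq s ->
  (forall i, measurable_fun setT (g i)) -> (forall i t, `|g i t| <= b) ->
  (forall i, \int[P]_w (g i (X i w))%:E = (e i)%:E)%E ->
  `|l| * (2 * b) <= 1 / 2 ->
  (\int[P]_w (expR (l * \sum_(i <- s) (g i (X i w) - e i)))%:E
     <= (expR (8 * l ^+ 2 * b ^+ 2 * (size s)%:R))%:E)%E.
Proof.
move=> indep us mg gb ge lb.
have mgX i : measurable_fun setT (fun w => g i (X i w)).
  by apply: (@measurableT_comp _ _ _ _ _ _ (g i) _ (X i)).
pose phi i t := expR (l * (g i t - e i)).
have mphi i : measurable_fun setT (phi i).
  apply: measurableT_comp => //; apply: measurable_funM => //.
  exact: measurable_funB.
have ub i : (\int[P]_w (phi i (X i w))%:E <= (expR (8 * l ^+ 2 * b ^+ 2))%:E)%E.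
  by apply: mgf_bound (ge i) lb => // w.
have phi0 i : (0 <= \int[P]_w (phi i (X i w))%:E)%E.
  by apply: integral_ge0 => w _; rewrite lee_fin expR_ge0.
pose e' i := fine (\int[P]_w (phi i (X i w))%:E)%E.
have phie i : (\int[P]_w (phi i (X i w))%:E = (e' i)%:E)%E.
  rewrite fineK// ge0_fin_numE//; apply: le_lt_trans (ub i) _; exact: ltry.
have -> : (\int[P]_w (expR (l * \sum_(i <- s) (g i (X i w) - e i)))%:E =
    \int[P]_w (\prod_(i <- s) phi i (X i w))%:E)%E.
  by apply: eq_integral => w _; rewrite mulr_sumr expR_sum.
rewrite (integral_prod_independent indep mphi _ phie us); last first.
  by move=> i t; exact: expR_ge0.
rewrite lee_fin mulrC expRM_natl.
have e'le i : 0 <= e' i <= expR (8 * l ^+ 2 * b ^+ 2).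
  by rewrite -!lee_fin -phie phi0 ub.
elim: s {us} => [|i s IH]; first by rewrite big_nil.
rewrite big_cons /= [leRHS]exprS; have /andP[ei0 ei] := e'le i.
rewrite ler_pM// prodr_ge0// => k _.
by have /andP[] := e'le k.
Qed.

(** From l |S| <= L + exp(l |S| - L), with the exponentials summed over the family instead of
    maximised. The choice of [L] makes the two signs of these exponentials contribute at most 2 to
    the expectation. *)
Lemma maximal_inequality (I F : finType) (X : I -> {RV P >-> T})
    (g : F -> I -> T -> R) (e : F -> I -> R) (s : seq I) (b l L : R) :
  mutually_independent X -> uniq s ->
  (forall f i, measurable_fun setT (g f i)) ->
  (forall f i t, `|g f i t| <= b) ->
  (forall f i, \int[P]_w (g f i (X i w))%:E = (e f i)%:E)%E ->
  0 < l -> l * (2 * b) <= 1 / 2 -> 0 <= L ->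
  #|F|%:R * expR (8 * l ^+ 2 * b ^+ 2 * (size s)%:R) <= expR L ->
  exists M : Omega -> R, [/\ measurable_fun setT M, forall w, 0 <= M w,
    forall f w, `|\sum_(i <- s) (g f i (X i w) - e f i)| <= M w &
    (\int[P]_w (M w)%:E <= ((L + 2) / l)%:E)%E].
Proof.
move=> indep us mg gb ge l0 lb L0 cardF.
pose S f w := \sum_(i <- s) (g f i (X i w) - e f i).
have mS f : measurable_fun setT (S f).
  apply: measurable_sum => i; apply: measurable_funB => //.
  by apply: (@measurableT_comp _ _ _ _ _ _ (g f i) _ (X i)).
have mE c f : measurable_fun setT (fun w => expR (c * S f w)).
  by apply: measurableT_comp => //; exact: measurable_funM.
pose c := expR (- L) / l.
have c0 : 0 <= c by rewrite divr_ge0 ?expR_ge0// ltW.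
pose V f w := expR (l * S f w) + expR (- l * S f w).
have V0 f w : 0 <= V f w by rewrite addr_ge0 ?expR_ge0.
have mV f : measurable_fun setT (V f) by exact: measurable_funD.
exists (fun w => L / l + \sum_f c * V f w); split.
- apply: measurable_funD => //; apply: measurable_sum => f.
  exact: measurable_funM.
- move=> w; rewrite addr_ge0 ?divr_ge0// ?(ltW l0)//.
  by apply: sumr_ge0 => f _; exact: mulr_ge0.
- move=> f w; rewrite -/(S f w).
  have h1 : l * `|S f w| - L <= expR (l * `|S f w| - L).
    by apply: le_trans (expR_ge1Dx _); rewrite lerDr.
  have h2 : expR (l * `|S f w| - L) <= expR (- L) * V f w.
    rewrite expRD mulrC ler_wpM2l ?expR_ge0// /V.
    case: (ger0P (S f w)) => _; first by rewrite lerDl expR_ge0.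
    by rewrite mulrN mulNr lerDr expR_ge0.
  have h3 : c * V f w <= \sum_f c * V f w.
    rewrite (bigD1 f)//= lerDl; apply: sumr_ge0 => k _; exact: mulr_ge0.
  apply: le_trans (lerD (lexx _) h3).
  rewrite /c mulrAC -mulrDl ler_pdivlMr// mulrC; lra.
- under eq_integral do rewrite EFinD -sumEFin.
  rewrite ge0_integralD//; last 3 first.
  + by move=> w _; rewrite lee_fin divr_ge0// ltW.
  + by move=> w _; apply: sume_ge0 => f _; rewrite lee_fin mulr_ge0.
  + apply: emeasurable_sum => f; apply/measurable_EFinP.
    exact: measurable_funM.
  rewrite integral_cst// [X in (_ * X)%E]probability_setT mule1.
  rewrite ge0_integral_sum//; last 2 first.
  + by move=> f; apply/measurable_EFinP; exact: measurable_funM.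
  + by move=> f w _; rewrite lee_fin mulr_ge0.
  have fE f : (\int[P]_w (c * V f w)%:E <=
      (c * (2 * expR (8 * l ^+ 2 * b ^+ 2 * (size s)%:R)))%:E)%E.
    under eq_integral do rewrite EFinM.
    rewrite ge0_integralZl//; last 2 first.
    + exact/measurable_EFinP.
    + by move=> w _; rewrite lee_fin.
    rewrite [leRHS]EFinM; apply: lee_wpmul2l; first by rewrite lee_fin.
    under eq_integral do rewrite EFinD.
    rewrite ge0_integralD//; [|exact/measurable_EFinP..].
    rewrite mulrDl mul1r EFinD; apply: leeD.
      apply: (mgf_sum_bound (b := b)) => //.
      by rewrite gtr0_norm.
    rewrite -[l ^+ 2]sqrrN; apply: (mgf_sum_bound (b := b)) => //.
    by rewrite normrN gtr0_norm.
  apply: le_trans (leeD (lexx _) (lee_sum _ (fun f _ => fE f))) _.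
  rewrite sumEFin -EFinD lee_fin sumr_const [(L + 2) / l]mulrDl lerD2l.
  have := ler_wpM2l (ltW (expR_gt0 (- L))) cardF.
  rewrite -expRD addNr expR0; set E := expR (8 * _ * _ * _) => h.
  rewrite [leLHS](_ : _ = 2 * (expR (- L) * (#|F|%:R * E)) / l); last first.
    by rewrite -[_ *+ _]mulr_natl /c; ring.
  by rewrite ler_wpM2r ?invr_ge0 ?(ltW l0)// ler_piMr.
Qed.
End maximal_inequality.

(** * Hahn-Banach in finite dimension *)

Section hahn_banach.
Context {R : realType}.

Definition sublinear (V : lmodType R) (p : V -> R) :=
  (forall h k, p (h + k) <= p h + p k) /\
  (forall b h, 0 <= b -> p (b *: h) <= b * p h).

Lemma sublinear_opp (V : lmodType R) (p : V -> R) h : sublinear p ->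
  0 <= p h + p (- h).
Proof.
move=> [pD pZ]; apply: le_trans (pD _ _); rewrite subrr.
by have := pD 0 0; rewrite addr0; lra.
Qed.

(** No functional is extended from a subspace. Instead [p] is shrunk until it is linear along [v],
    and doing so along a basis makes it linear. *)
Lemma sublinear_step (V : lmodType R) (p : V -> R) v : sublinear p ->
  exists q, [/\ sublinear q, forall h, q h <= p h & q (- v) <= - p v].
Proof.
move=> sp; have [pD pZ] := sp.
pose E h := [set p (h + a *: v) - a * p v | a in [set a : R | 0 <= a]].
have hE h a : 0 <= a -> E h (p (h + a *: v) - a * p v).
  by move=> a0; exists a.
have hI h : has_inf (E h).
  split; first by exists (p (h + 0 *: v) - 0 * p v); exact: hE.
  exists (- p (- h)) => _ [a /= a0 <-].
  have h1 : a * p v <= p (a *: v).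
    have [->|aN0] := eqVneq a 0.
      by rewrite mul0r scale0r; have := sublinear_opp 0 sp; rewrite oppr0; lra.
    have := pZ a^-1 (a *: v); rewrite invr_ge0 => /(_ a0).
    by rewrite scalerA mulVf// scale1r mulrC ler_pdivlMr ?lt0r ?aN0// mulrC.
  have := pD (h + a *: v) (- h); rewrite addrAC subrr add0r; lra.
have ub h a : 0 <= a -> inf (E h) <= p (h + a *: v) - a * p v.
  by move=> a0; apply: ge_inf; [exact: (hI h).2|exact: hE].
have ub0 h : inf (E h) <= p h.
  by have := ub h 0 (lexx _); rewrite scale0r addr0 mul0r subr0.
exists (fun h => inf (E h)); split=> //; last first.
  by have := ub (- v) 1 ler01; rewrite scale1r addNr mul1r;
    have := pZ 0 0 (lexx _); rewrite scale0r mul0r; lra.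
split=> [h k|b h b0].
  rewrite -lerBlDr; apply: lb_le_inf; first exact: (hI h).1.
  move=> _ [a /= a0 <-]; rewrite lerBlDl -lerBlDr.
  apply: lb_le_inf; first exact: (hI k).1.
  move=> _ [a' /= a'0 <-]; have := ub (h + k) _ (addr_ge0 a0 a'0).
  have := pD (h + a *: v) (k + a' *: v).
  by rewrite scalerDl addrACA mulrDl; lra.
have [->|bN0] := eqVneq b 0.
  rewrite scale0r mul0r; apply: le_trans (ub0 _) _.
  by have := pZ 0 0 (lexx _); rewrite scale0r mul0r.
have bgt0 : 0 < b by rewrite lt0r bN0.
rewrite mulrC -ler_pdivrMr//; apply: lb_le_inf; first exact: (hI h).1.
move=> _ [a /= a0 <-]; rewrite ler_pdivrMr//.
have := ub (b *: h) _ (mulr_ge0 b0 a0).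
have := pZ b (h + a *: v) b0.
by rewrite scalerDr scalerA; lra.
Qed.

Lemma sublinear_seq (V : lmodType R) (vs : seq V) (p : V -> R) : sublinear p ->
  exists q, [/\ sublinear q, forall h, q h <= p h &
    forall v, v \in vs -> q (- v) <= - q v].
Proof.
elim: vs p => [|v vs IH] p sp; first by exists p; split.
have [q [sq qp qv]] := sublinear_step v sp.
have [r [sr rq rvs]] := IH q sq.
exists r; split => // [h|w]; first exact: le_trans (qp h).
rewrite inE => /predU1P[->|/rvs//].
apply: le_trans (rq _) _; apply: le_trans qv _.
by rewrite lerN2 (le_trans (rq _)).
Qed.

Lemma finite_hahn_banach (S : finType) (p : {ffun S -> R^o} -> R)
    (h0 : {ffun S -> R^o}) : sublinear p ->
  exists g : S -> R, (forall h : {ffun S -> R^o}, \sum_s g s * h s <= p h) /\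
    p h0 <= \sum_s g s * h0 s.
Proof.
(* The direction [h0] comes first: the later steps only shrink the value at [- h0], so the final
   functional is still at least [p h0] at [h0]. *)
move=> sp; have [p' [sp' p'p p'h0]] := sublinear_step h0 sp.
pose delta s : {ffun S -> R^o} := [ffun t => (t == s)%:R].
have [q [sq qp qd]] := sublinear_seq (map delta (enum S)) sp'.
have [qD qZ] := sq.
have qle h : q h <= \sum_s q (delta s) * h s.
  have q0 : q 0 <= 0 by have := qZ 0 0 (lexx _); rewrite scale0r mul0r.
  rewrite [in leLHS](_ : h = \sum_s h s *: delta s); last first.
    apply/ffunP => t; rewrite sum_ffunE (bigD1 t)//= big1 ?addr0.
      by rewrite !ffunE eqxx [_ *: _]mulr1.
    by move=> s st; rewrite !ffunE eq_sym (negbTE st) [_ *: _]mulr0.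
  apply: (@le_trans _ _ (\sum_s q (h s *: delta s))).
    elim/big_rec2 : _ => // s x y _ xy.
    by apply: le_trans (qD _ _) _; rewrite lerD2l.
  apply: ler_sum => s _; have [hs0|/ltW hs0] := leP 0 (h s).
    by rewrite mulrC qZ.
  have -> : h s *: delta s = (- h s) *: (- delta s) by rewrite scaleNr scalerN opprK.
  apply: le_trans (qZ _ _ _) _; first by rewrite oppr_ge0.
  have /qd qds : delta s \in map delta (enum S) by rewrite map_f// mem_enum.
  have := ler_wpM2l _ qds => /(_ (- h s)); rewrite oppr_ge0 => /(_ hs0).
  by rewrite mulrNN mulrC [X in _ <= X]mulrC [X in X <= _]mulrC.
exists (fun s => q (delta s)); split=> [h|].
  apply: le_trans (p'p _); apply: le_trans (qp _).
  have := qle (- h); have := sublinear_opp h sq.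
  under eq_bigr do rewrite ffunE mulrN.
  rewrite sumrN; lra.
have := qle h0; have := qp (- h0); have := sublinear_opp h0 sq.
by move=> h1 h2 h3; apply: le_trans h3; lra.
Qed.
End hahn_banach.

(** * Multimarginal duality for uniform marginals on finite sets *)

Section finite_duality.
Context {R : realType} {K m : nat}.
Hypotheses (K_gt0 : (0 < K)%N) (m_gt0 : (0 < m)%N).

Definition plan (g : {ffun 'I_K -> 'I_m} -> R) :=
  (forall s, 0 <= g s) /\
  forall k t, \sum_(s : {ffun 'I_K -> 'I_m} | s k == t) g s = m%:R^-1.

Definition dual_value (f : 'I_K -> 'I_m -> R) : R :=
  \sum_k (\sum_t f k t) / m%:R.

Let mR : 0 < m%:R :> R. Proof. by rewrite ltr0n. Qed.

Lemma plan_marginal (g : {ffun 'I_K -> 'I_m} -> R) k (phi : 'I_m -> R) : plan g ->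
  \sum_s g s * phi (s k) = (\sum_t phi t) / m%:R.
Proof.
move=> [_ gm]; rewrite (partition_big (fun s : {ffun 'I_K -> 'I_m} => s k) xpredT)//=.
rewrite mulr_suml; apply: eq_bigr => t _.
rewrite -(gm k t) mulr_sumr; apply: eq_bigr => s /eqP <-.
by rewrite mulrC.
Qed.

Lemma plan_dual_value g f : plan g ->
  \sum_s g s * (\sum_k f k (s k)) = dual_value f.
Proof.
move=> gp; under eq_bigr do rewrite mulr_sumr.
by rewrite exchange_big/=; apply: eq_bigr => k _; exact: plan_marginal.
Qed.

(** The sublinear map [p] sends [h] to the least dual value of potentials dominating [h]. Let [g] be
    a linear minorant that agrees with [p] at [- c]; this agreement is strong duality. Testing [g]
    on minus a point mass gives nonnegativity, and on plus and minus the indicator of [s k == t] the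
    marginals. *)
Lemma finite_duality (c : {ffun 'I_K -> 'I_m} -> R) :
  exists g, plan g /\ forall e, 0 < e -> exists f : 'I_K -> 'I_m -> R,
    (forall s : {ffun 'I_K -> 'I_m}, \sum_k f k (s k) <= c s) /\
    \sum_s g s * c s <= dual_value f + e.
Proof.
pose S := {ffun 'I_K -> 'I_m}.
pose E (h : {ffun S -> R^o}) :=
  [set dual_value f | f in [set f : 'I_K -> 'I_m -> R |
    forall s : S, h s <= \sum_k f k (s k)]].
pose p h := inf (E h).
(* The uniform plan on constant tuples: averaging the constraint over it bounds the dual values
   below, so the infimum is finite. *)
pose diag t : S := [ffun=> t].
have VD f f' : dual_value (fun k t => f k t + f' k t)
    = dual_value f + dual_value f'.
  rewrite /dual_value -big_split; apply: eq_bigr => k _ /=.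
  by rewrite big_split mulrDl.
have VZ b f : dual_value (fun k t => b * f k t) = b * dual_value f.
  rewrite /dual_value mulr_sumr; apply: eq_bigr => k _.
  by rewrite -mulr_sumr mulrA.
have lbE h x : E h x -> (\sum_t h (diag t)) / m%:R <= x.
  move=> [f /= fh <-]; rewrite /dual_value -mulr_suml exchange_big/=.
  rewrite ler_pM2r ?invr_gt0//; apply: ler_sum => t _.
  apply: le_trans (fh _) _.
  by under eq_bigr do rewrite ffunE.
have neE h : E h !=set0.
  pose M : R := \sum_s `|h s|.
  have M0 : 0 <= M by exact: sumr_ge0.
  exists (dual_value (fun _ _ => M)), (fun _ _ => M) => //= s.
  rewrite sumr_const card_ord -[leRHS]mulr_natl.
  apply: (@le_trans _ _ M).
    rewrite /M (bigD1 s)//= (le_trans (ler_norm _))// lerDl.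
    exact: sumr_ge0.
  by rewrite ler_peMl// ler1n.
have hI h : has_inf (E h).
  by split=> //; exists ((\sum_t h (diag t)) / m%:R) => x; exact: lbE.
have ubp (h : {ffun S -> R^o}) f : (forall s : S, h s <= \sum_k f k (s k)) -> p h <= dual_value f.
  by move=> fh; apply: ge_inf; [exact: (hI h).2|exists f].
have sp : sublinear p.
  split=> [h k|b h b0].
    rewrite -lerBlDr; apply: lb_le_inf => // _ [f /= fh <-].
    rewrite lerBlDl -lerBlDr; apply: lb_le_inf => // _ [f' /= fk <-].
    rewrite lerBlDl -VD; apply: ubp => s; rewrite ffunE big_split.
    exact: lerD.
  have [->|bN0] := eqVneq b 0.
    rewrite scale0r mul0r; apply: le_trans (ubp _ (fun _ _ => 0) _) _.
      by move=> s; rewrite ffunE big1.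
    by rewrite /dual_value big1// => k _; rewrite big1// mul0r.
  have bgt0 : 0 < b by rewrite lt0r bN0.
  rewrite mulrC -ler_pdivrMr//; apply: lb_le_inf => // _ [f /= fh <-].
  rewrite ler_pdivrMr// mulrC -VZ; apply: ubp => s.
  by rewrite ffunE -mulr_sumr [_ *: _]/(b * _) ler_wpM2l.
have [g [gp gc]] := finite_hahn_banach (finfun (fun s => - c s)) sp.
exists g; split; first split.
- move=> s; have := gp [ffun t => - (t == s)%:R].
  rewrite (bigD1 s)//= big1 ?addr0; last first.
    by move=> t ts; rewrite ffunE (negbTE ts) oppr0 mulr0.
  rewrite ffunE eqxx mulrN1 => h1.
  have V0 : dual_value (fun _ _ => 0) = 0.
    by rewrite /dual_value big1// => k _; rewrite big1// mul0r.
  have h2 := ubp [ffun t => - (t == s)%:R] (fun _ _ => 0); rewrite V0 in h2.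
  rewrite -oppr_le0; apply: le_trans h1 (h2 _) => t.
  by rewrite ffunE big1// oppr_le0.
- move=> k t; apply/eqP; rewrite eq_le.
  pose ind (b : R) l t' : R := if (l == k) && (t' == t) then b else 0.
  have Vind b : dual_value (ind b) = b / m%:R.
    rewrite /dual_value (bigD1 k)//= [X in _ + X]big1 ?addr0 => [|l /negbTE lk].
      rewrite (bigD1 t)//= big1 ?addr0 => [|t' /negbTE t't].
        by rewrite /ind !eqxx.
      by rewrite /ind t't andbF.
    by rewrite big1 ?mul0r// => t' _; rewrite /ind lk.
  have Sind b (s : S) : \sum_l ind b l (s l) = if s k == t then b else 0.
    rewrite (bigD1 k)//= big1 ?addr0 => [|l /negbTE lk]; last by rewrite /ind lk.
    by rewrite /ind eqxx.
  have H b : (\sum_(s : S | s k == t) g s) * b <= b / m%:R.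
    have := gp [ffun s : S => if s k == t then b else 0].
    have := ubp [ffun s : S => if s k == t then b else 0] (ind b) _.
    rewrite Vind => h1 h2; apply: le_trans (le_trans h2 (h1 _)); last first.
      by move=> s; rewrite ffunE Sind.
    rewrite mulr_suml big_mkcond/=; apply: ler_sum => s _; rewrite ffunE.
    by case: ifP; rewrite ?mulr0.
  have := H 1; have := H (-1); rewrite mulr1 mulrN1 mul1r mulN1r.
  by rewrite lerN2 => -> ->.
move=> e e0; have [_ [f /= fh <-] fe] := inf_adherent e0 (hI (finfun (fun s => - c s))).
exists (fun k t => - 1 * f k t); split=> [s|].
  by rewrite -mulr_sumr mulN1r lerNl; have := fh s; rewrite ffunE.
rewrite VZ mulN1r.
have : \sum_s g s * (finfun (fun s => - c s)) s = - \sum_s g s * c s.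
  by rewrite -sumrN; apply: eq_bigr => s _; rewrite ffunE mulrN.
move=> E1; rewrite E1 in gc; rewrite -/(p _) in fe; lra.
Qed.
End finite_duality.

(** * Feasible potentials on the ball and their tightening *)

Section potentials.
Context {R : realType} {d K : nat}.
Hypothesis K_gt0 : (0 < K)%N.
Local Notation T := (d.-tuple R).
Implicit Types (y : 'I_K -> T) (F : 'I_K -> T -> R) (k l : 'I_K).

Definition mean_coord y (i : 'I_d) : R := K%:R^-1 * \sum_k tnth (y k) i.

Definition cost y : R := \sum_i mean_coord y i ^+ 2.

Definition subst y k (x : T) : 'I_K -> T := fun l => if l == k then x else y l.

Definition in_ball y := forall k, unit_ball (y k).

Definition feasible F := forall y, in_ball y -> \sum_k F k (y k) <= cost y.

Definition tight_at F k := forall x, unit_ball x -> forall e, 0 < e ->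
  exists y, [/\ in_ball y, y k = x & cost y - e <= \sum_l F l (y l)].

Let KR : 0 < K%:R :> R. Proof. by rewrite ltr0n. Qed.

Lemma cost_ge0 y : 0 <= cost y.
Proof. by apply: sumr_ge0 => i _; exact: sqr_ge0. Qed.

Lemma ball0 : unit_ball ([tuple 0 | i < d] : T).
Proof.
by apply/unit_ballP; rewrite big1// => i _; rewrite tnth_mktuple expr0n.
Qed.

Lemma subst_id y k : subst y k (y k) = y.
Proof. by apply/funext => l; rewrite /subst; case: eqP => // ->. Qed.

Lemma subst_in_ball y k x : in_ball y -> unit_ball x -> in_ball (subst y k x).
Proof. by move=> yB xB l; rewrite /subst; case: ifP. Qed.

Lemma sum_subst F y k x :
  \sum_l F l (subst y k x l) = F k x + \sum_(l | l != k) F l (y l).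
Proof.
rewrite (bigD1 k)//= /subst eqxx; congr (_ + _).
by apply: eq_bigr => l /negbTE ->.
Qed.

Lemma tighten F k : feasible F -> exists F',
  [/\ feasible F', forall l x, unit_ball x -> F l x <= F' l x,
      forall l, l != k -> F' l = F l & tight_at F' k].
Proof.
move=> fF.
pose E x := [set cost (subst y k x) - \sum_(l | l != k) F l (y l) | y in in_ball].
have lbE x : unit_ball x -> lbound (E x) (F k x).
  move=> xB _ [y yB <-]; have := fF _ (subst_in_ball k yB xB).
  by rewrite sum_subst; lra.
have neE x : E x !=set0.
  exists (cost (subst (fun=> [tuple 0 | i < d]) k x)
     - \sum_(l | l != k) F l [tuple 0 | i < d]).
  by exists (fun=> [tuple 0 | i < d]) => // l; exact: ball0.
have hI x : unit_ball x -> has_inf (E x).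
  by move=> xB; split=> //; exists (F k x); exact: lbE.
pose F' l x := if l == k then inf (E x) else F l x.
have FF' l x : unit_ball x -> F l x <= F' l x.
  move=> xB; rewrite /F'; case: eqP => // ->.
  by apply: lb_le_inf => //; exact: lbE.
have F'k x : F' k x = inf (E x) by rewrite /F' eqxx.
have F'l l : l != k -> F' l = F l.
  by move=> /negbTE lk; apply/funext => x; rewrite /F' lk.
have SF' y : \sum_(l | l != k) F' l (y l) = \sum_(l | l != k) F l (y l).
  by apply: eq_bigr => l lk; rewrite F'l.
exists F'; split=> //.
  move=> y yB; rewrite (bigD1 k)//= SF' F'k -lerBrDr -{2}(subst_id y k).
  by apply: ge_inf; [exact: (hI _ (yB k)).2|exists y].
move=> x xB e e0.
have [_ [y yB <-] ye] := inf_adherent e0 (hI _ xB).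
exists (subst y k x); split; first exact: subst_in_ball.
  by rewrite /subst eqxx.
by rewrite sum_subst SF' F'k; lra.
Qed.

(** One round suffices. Raising other potentials, as long as they stay feasible, keeps a
    configuration nearly tight, so a tightened index stays tight. *)
Lemma tighten_all F : feasible F -> exists F', [/\ feasible F',
  forall l x, unit_ball x -> F l x <= F' l x & forall k, tight_at F' k].
Proof.
move=> fF.
suff H (ks : seq 'I_K) : exists F', [/\ feasible F',
    forall l x, unit_ball x -> F l x <= F' l x & {in ks, forall k, tight_at F' k}].
  have [F' [? ? tF]] := H (enum 'I_K); exists F'; split=> // k.
  by apply: tF; rewrite mem_enum.
elim: ks => [|k ks [F1 [fF1 FF1 tF1]]]; first by exists F; split.
have [F' [fF' F1F' F'l tF']] := tighten k fF1.
exists F'; split=> // [l x xB|l].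
  exact: le_trans (FF1 _ _ xB) (F1F' _ _ xB).
rewrite inE => /predU1P[->//|/tF1 tl] x xB e e0.
have [y [yB yx ye]] := tl x xB e e0.
exists y; split=> //; apply: le_trans ye _.
by apply: ler_sum => l' _; exact: F1F'.
Qed.

(** Off the sample the potentials get the value [- M], so low that the sum is negative or 0 and the
    constraint follows from [cost_ge0]. The maximum over [t] deals with coinciding sample points. *)
Lemma extend_potentials m (a : 'I_K -> 'I_m -> T) (f : 'I_K -> 'I_m -> R) :
  (forall s : {ffun 'I_K -> 'I_m},
    \sum_k f k (s k) <= cost (fun k => a k (s k))) ->
  exists F, [/\ feasible F,
    (forall k t, unit_ball (a k t) -> f k t <= F k (a k t)) & forall k, tight_at F k].
Proof.
move=> fc.
pose Mk l : R := \sum_t `|f l t|.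
have Mk0 l : 0 <= Mk l by exact: sumr_ge0.
pose M : R := \sum_l Mk l.
pose F0 k x : R := \big[Order.max/- M]_(t | a k t == x) f k t.
have F0M l x : F0 l x <= Mk l.
  apply: bigmax_le => [|t _].
    by rewrite (@le_trans _ _ 0)// oppr_le0 sumr_ge0.
  by rewrite (le_trans (ler_norm _))// /Mk (bigD1 t)//= lerDl sumr_ge0.
have [] := @tighten_all F0; last first.
  move=> F [fF F0F tF]; exists F; split=> // k t aB.
  by apply: le_trans (F0F _ _ aB); exact: le_bigmax_cond.
move=> y yB.
case: (pselect (exists k, F0 k (y k) <= - M)) => [[k kM]|/forallNP nM].
  apply: le_trans (cost_ge0 y); rewrite (bigD1 k)//=.
  have : \sum_(l | l != k) F0 l (y l) <= \sum_(l | l != k) Mk l.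
    by apply: ler_sum => l _; exact: F0M.
  have : M = Mk k + \sum_(l | l != k) Mk l by rewrite /M (bigD1 k).
  by have := Mk0 k; lra.
have /choice[s sP] : forall k, exists t, a k t = y k /\ F0 k (y k) <= f k t.
  move=> k; have /bigmax_geP[/nM//|[t /eqP at_ ft]] := lexx (F0 k (y k)).
  by exists t.
apply: le_trans (_ : \sum_k f k (finfun s k) <= _).
  by apply: ler_sum => k _; rewrite ffunE; exact: (sP k).2.
apply: le_trans (fc _) _; rewrite le_eqVlt; apply/orP; left; apply/eqP.
by congr cost; apply/funext => k; rewrite ffunE (sP k).1.
Qed.

Lemma cost_subst y k x : cost (subst y k x) = cost y
  + 2 / K%:R * (\sum_i mean_coord y i * (tnth x i - tnth (y k) i))
  + (\sum_i (tnth x i - tnth (y k) i) ^+ 2) / K%:R ^+ 2.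
Proof.
rewrite /cost mulr_sumr mulr_suml -!big_split/=; apply: eq_bigr => i _.
have -> : mean_coord (subst y k x) i =
    mean_coord y i + (tnth x i - tnth (y k) i) / K%:R.
  rewrite /mean_coord (bigD1 k)//= [in RHS](bigD1 k)//= /subst eqxx.
  rewrite (eq_bigr (fun l => tnth (y l) i)); last by move=> l /negbTE ->.
  by field; rewrite gt_eqF.
by field; rewrite gt_eqF.
Qed.

Lemma ball_dist_le x x' : @unit_ball R d x -> unit_ball x' ->
  \sum_i (tnth x i - tnth x' i) ^+ 2 <= 4.
Proof.
move=> /unit_ballP xB /unit_ballP x'B.
have : 0 <= \sum_i (tnth x i + tnth x' i) ^+ 2.
  by apply: sumr_ge0 => i _; exact: sqr_ge0.
have -> : \sum_i (tnth x i + tnth x' i) ^+ 2 = 2 * \sum_i tnth x i ^+ 2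
   + 2 * \sum_i tnth x' i ^+ 2 - \sum_i (tnth x i - tnth x' i) ^+ 2.
  by rewrite !mulr_sumr -big_split -sumrB; apply: eq_bigr => i _ /=; ring.
lra.
Qed.

(** Feasibility after replacing the [k]-th entry by [x], compared with near equality at [y]: slopes
    of [F k] are read off from the mean of [y]. *)
Lemma tight_supergradient F y e k x : feasible F -> in_ball y ->
  cost y - e <= \sum_l F l (y l) -> unit_ball x ->
  F k x <= F k (y k)
    + 2 / K%:R * (\sum_i mean_coord y i * (tnth x i - tnth (y k) i))
    + (\sum_i (tnth x i - tnth (y k) i) ^+ 2) / K%:R ^+ 2 + e.
Proof.
move=> fF yB ye xB; have := fF _ (subst_in_ball k yB xB).
rewrite sum_subst cost_subst; move: ye; rewrite (bigD1 k)//=; lra.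
Qed.

Section sample.
Variables (m : nat) (a : 'I_K -> 'I_m -> T) (F : 'I_K -> T -> R).
Hypotheses (m_gt0 : (0 < m)%N) (aB : forall k t, unit_ball (a k t)).
Hypotheses (fF : feasible F) (tF : forall k, tight_at F k).

Definition sample_mean (i : 'I_d) : R :=
  K%:R^-1 * \sum_k (\sum_t tnth (a k t) i) / m%:R.

Definition sample_value : R := dual_value (fun k t => F k (a k t)).

Let mR : 0 < m%:R :> R. Proof. by rewrite ltr0n. Qed.

(* The supergradient inequality at a nearly tight configuration, averaged over
   the sample. *)
Lemma tight_mean_close y e : in_ball y -> cost y - e <= \sum_l F l (y l) ->
  sample_value + \sum_i (mean_coord y i - sample_mean i) ^+ 2
    <= \sum_i sample_mean i ^+ 2 + 4 / K%:R + K%:R * e.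
Proof.
move=> yB ye.
have h k : (\sum_t F k (a k t)) / m%:R <= F k (y k) + 2 / K%:R *
    (\sum_i mean_coord y i * ((\sum_t tnth (a k t) i) / m%:R - tnth (y k) i))
    + 4 / K%:R ^+ 2 + e.
  rewrite ler_pdivrMr//.
  apply: le_trans (_ : \sum_t (F k (y k)
    + 2 / K%:R * (\sum_i mean_coord y i * (tnth (a k t) i - tnth (y k) i))
    + 4 / K%:R ^+ 2 + e) <= _).
    apply: ler_sum => t _; apply: le_trans (tight_supergradient k fF yB ye (aB k t)) _.
    rewrite lerD2r lerD2l ler_wpM2r ?invr_ge0 ?exprn_ge0 ?(ltW KR)//.
    exact: ball_dist_le.
  rewrite le_eqVlt; apply/orP; left; apply/eqP.
  rewrite !big_split/= !sumr_const card_ord -mulr_sumr exchange_big/=.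
  rewrite -[F k (y k) *+ m]mulr_natr -[e *+ m]mulr_natr -[4 / _ *+ m]mulr_natr.
  have D4 (u v w x n : R) : (u + v + w + x) * n = u * n + v * n + w * n + x * n.
    by ring.
  rewrite [RHS]D4; congr (_ + _ + _ + _); rewrite -[RHS]mulrA; congr (_ * _).
  rewrite mulr_suml; apply: eq_bigr => i _.
  rewrite -mulr_sumr sumrB sumr_const card_ord -[tnth _ _ *+ m]mulr_natr.
  by field; rewrite gt_eqF.
have : sample_value <= \sum_k (F k (y k) + 2 / K%:R *
    (\sum_i mean_coord y i * ((\sum_t tnth (a k t) i) / m%:R - tnth (y k) i))
    + 4 / K%:R ^+ 2 + e) by apply: ler_sum => k _; exact: h.
rewrite !big_split/= !sumr_const card_ord -[e *+ K]mulr_natl -[4 / _ *+ K]mulr_natl.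
have -> : K%:R * (4 / K%:R ^+ 2) = 4 / K%:R :> R by field; rewrite gt_eqF.
have -> : \sum_k 2 / K%:R * (\sum_i mean_coord y i *
    ((\sum_t tnth (a k t) i) / m%:R - tnth (y k) i)) =
    2 * \sum_i mean_coord y i * (sample_mean i - mean_coord y i).
  rewrite -mulr_sumr exchange_big/= -mulrA; congr (_ * _); rewrite mulr_sumr.
  apply: eq_bigr => i _; rewrite -mulr_sumr sumrB /sample_mean /mean_coord.
  by field; rewrite gt_eqF.
have := fF yB; rewrite /cost.
have -> : \sum_i (mean_coord y i - sample_mean i) ^+ 2 =
    - (2 * \sum_i mean_coord y i * (sample_mean i - mean_coord y i))
    - \sum_i mean_coord y i ^+ 2 + \sum_i sample_mean i ^+ 2.
  rewrite mulr_sumr -!sumrN -!big_split; apply: eq_bigr => i _ /=; ring.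
lra.
Qed.

Lemma sample_value_le : sample_value <= \sum_i sample_mean i ^+ 2 + 4 / K%:R.
Proof.
apply/ler_addgt0Pr => e e0.
have [y [yB _ ye]] := tF (Ordinal K_gt0) ball0 (divr_gt0 e0 KR).
have := tight_mean_close yB ye; rewrite mulrCA divff ?gt_eqF// mulr1.
have : 0 <= \sum_i (mean_coord y i - sample_mean i) ^+ 2.
  by apply: sumr_ge0 => i _; exact: sqr_ge0.
lra.
Qed.

(* By [tight_mean_close] the factor K^(3/2) brings the slopes to order 1. *)
Definition profile k (x : T) : R := - (K%:R * Num.sqrt K%:R) *
  (F k x - F k [tuple 0 | i < d] - 2 / K%:R * (\sum_i sample_mean i * tnth x i)
   - (\sum_i tnth x i ^+ 2) / K%:R ^+ 2).

Let sK : 1 <= Num.sqrt K%:R :> R.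
Proof. by rewrite -[leLHS]sqrtr1 ler_sqrt// ler1n. Qed.

Let sK2 : Num.sqrt K%:R ^+ 2 = K%:R :> R.
Proof. by rewrite sqr_sqrtr// ltW. Qed.

Lemma profile_eq k x : F k x = F k [tuple 0 | i < d]
  + 2 / K%:R * (\sum_i sample_mean i * tnth x i)
  + (\sum_i tnth x i ^+ 2) / K%:R ^+ 2 - profile k x / (K%:R * Num.sqrt K%:R).
Proof.
have s0 : 0 < Num.sqrt K%:R :> R by exact: lt_le_trans sK.
by rewrite /profile; field; rewrite !gt_eqF.
Qed.

(** Subtracting |x|^2/K^2 makes the upper bound of [tight_supergradient] affine in the new point,
    hence the convexity of [profile]. The slope is -2 sqrt(K) times the gap between the mean of [y]
    and [sample_mean], plus 2 x / sqrt(K). The gap is at most 3 / sqrt(K) in each coordinate, so 6 +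
    2 = 8. *)
Lemma profile_convex_lip k :
  \sum_i sample_mean i ^+ 2 <= sample_value + K%:R^-1 -> convex_lip 8 (profile k).
Proof.
move=> Vge; split.
  have z1 : \sum_i sample_mean i * tnth [tuple 0 | i < d] i = 0.
    by rewrite big1// => i _; rewrite tnth_mktuple mulr0.
  have z2 : \sum_(i < d) tnth [tuple 0 | i < d] i ^+ 2 = 0 :> R.
    by rewrite big1// => i _; rewrite tnth_mktuple expr0n.
  by rewrite /profile z1 z2 subrr mulr0 mul0r !subr0 mulr0.
move=> e e0.
have s0 : 0 < Num.sqrt K%:R :> R by exact: lt_le_trans sK.
have Ks0 : 0 < K%:R * Num.sqrt K%:R :> R by exact: mulr_gt0.
(* The first bound survives the factor K^(3/2) of [profile]; the second makes the slack [K e'] of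
   [tight_mean_close] at most 1/K. *)
pose e' : R := Num.min (e / (K%:R * Num.sqrt K%:R)) (K%:R ^- 2).
have e'0 : 0 < e' by rewrite lt_min divr_gt0// invr_gt0 exprn_gt0.
suff /choice[p pP] : forall x, exists q : 'I_d -> R, unit_ball x ->
    (forall i, `|q i| <= 8%:R) /\ forall x', unit_ball x' ->
    profile k x + \sum_i q i * (tnth x' i - tnth x i) - e <= profile k x'.
  by exists p => x xB; have := pP x xB.
move=> x; case: (pselect (unit_ball x)) => [xB|]; last by exists (fun=> 0).
have [y [yB yx ye]] := tF k xB e'0.
exists (fun i => - (2 * Num.sqrt K%:R * (mean_coord y i - sample_mean i))
   + 2 * tnth x i / Num.sqrt K%:R) => _; split.
  move=> i.
  have zc : `|mean_coord y i - sample_mean i| * Num.sqrt K%:R <= 3.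
    rewrite -[X in _ * X]gtr0_norm// -normrM; apply: norm_le_sqr => //.
    rewrite exprMn sK2.
    have h1 : (mean_coord y i - sample_mean i) ^+ 2 <=
        \sum_i (mean_coord y i - sample_mean i) ^+ 2.
      by rewrite (bigD1 i)//= lerDl; apply: sumr_ge0 => j _; exact: sqr_ge0.
    have h2 := tight_mean_close yB ye.
    have h3 : K%:R * e' <= K%:R^-1.
      apply: le_trans (_ : K%:R * K%:R ^- 2 <= _).
        by rewrite ler_wpM2l ?(ltW KR)// ge_min lexx orbT.
      by rewrite expr2 invfM mulrA divff ?gt_eqF// mul1r.
    have h4 : 0 <= K%:R^-1 :> R by rewrite invr_ge0 ltW.
    have : (mean_coord y i - sample_mean i) ^+ 2 <= 9 / K%:R by lra.
    by rewrite ler_pdivlMr// => /le_trans; apply; rewrite -natrX ler_nat.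
  have xc : `|tnth x i / Num.sqrt K%:R| <= 1.
    rewrite normrM normfV (gtr0_norm s0) ler_pdivrMr// mul1r.
    by apply: le_trans (unit_ball_coord i xB) _.
  apply: le_trans (ler_normD _ _) _; rewrite normrN -[2 * tnth x i / _]mulrA.
  rewrite ![`|2 * _|]normrM ![`|2 * _ * _|]normrM normrM (gtr0_norm s0) [`|2|]ger0_norm//.
  by move: zc xc; rewrite mulrC; lra.
move=> x' x'B.
have := tight_supergradient k fF yB ye x'B; rewrite yx => h.
have e'e : e' * (K%:R * Num.sqrt K%:R) <= e.
  by rewrite -ler_pdivlMr// ge_min lexx.
have -> : \sum_i (- (2 * Num.sqrt K%:R * (mean_coord y i - sample_mean i))
     + 2 * tnth x i / Num.sqrt K%:R) * (tnth x' i - tnth x i) =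
   - (K%:R * Num.sqrt K%:R) * (2 / K%:R *
       (\sum_i mean_coord y i * (tnth x' i - tnth x i))
     + (\sum_i (tnth x' i - tnth x i) ^+ 2) / K%:R ^+ 2
     - 2 / K%:R * (\sum_i sample_mean i * tnth x' i)
     + 2 / K%:R * (\sum_i sample_mean i * tnth x i)
     - (\sum_i tnth x' i ^+ 2) / K%:R ^+ 2
     + (\sum_i tnth x i ^+ 2) / K%:R ^+ 2).
  rewrite !mulr_sumr !mulr_suml -!big_split/= -!sumrN -!big_split/= mulr_sumr.
  apply: eq_bigr => i _; move: sK2 s0; move: (Num.sqrt K%:R) => s <- s0.
  by field; rewrite gt_eqF.
have := ler_wpM2l (ltW Ks0) h; rewrite /profile; lra.
Qed.
End sample.
End potentials.

(** * Optimal plans and potentials of a fixed sample *)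

Section sample_potentials.
Context {R : realType} {d K m : nat}.
Hypotheses (K_gt0 : (0 < K)%N) (m_gt0 : (0 < m)%N).
Local Notation T := (d.-tuple R).
Variable a : 'I_K -> 'I_m -> T.

Definition select (s : {ffun 'I_K -> 'I_m}) : 'I_K -> T := fun k => a k (s k).

Let KR : K%:R != 0 :> R. Proof. by rewrite pnatr_eq0 -lt0n. Qed.
Let mR : m%:R != 0 :> R. Proof. by rewrite pnatr_eq0 -lt0n. Qed.

Lemma plan_sum1 (g : {ffun 'I_K -> 'I_m} -> R) : plan g -> \sum_s g s = 1.
Proof.
move=> gp; have := plan_dual_value (fun _ _ => K%:R^-1) gp.
rewrite /dual_value.
under eq_bigr do rewrite sumr_const card_ord -[_ *+ _]mulr_natl mulfV// mulr1.
move=> ->; under eq_bigr do rewrite sumr_const card_ord -[_ *+ m]mulr_natl.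
by rewrite sumr_const card_ord -[_ *+ K]mulr_natl; field; rewrite KR mR.
Qed.

Lemma plan_mean g i : plan g ->
  \sum_s g s * mean_coord (select s) i = sample_mean a i.
Proof.
move=> gp; have := plan_dual_value (fun k t => K%:R^-1 * tnth (a k t) i) gp.
under eq_bigr do rewrite -mulr_sumr.
rewrite /mean_coord /select => ->; rewrite /dual_value /sample_mean mulr_sumr.
by apply: eq_bigr => k _; rewrite -mulr_sumr mulrA.
Qed.

(** Jensen's inequality: the barycenter has the same mean, [sample_mean], under every plan. *)
Lemma plan_cost_ge g : plan g ->
  \sum_i sample_mean a i ^+ 2 <= \sum_s g s * cost (select s).
Proof.
move=> gp; under [leRHS]eq_bigr do rewrite /cost mulr_sumr.
rewrite [leRHS]exchange_big/=; apply: ler_sum => i _.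
have : 0 <= \sum_s g s * (mean_coord (select s) i - sample_mean a i) ^+ 2.
  by apply: sumr_ge0 => s _; rewrite mulr_ge0 ?sqr_ge0//; exact: gp.1.
have -> : \sum_s g s * (mean_coord (select s) i - sample_mean a i) ^+ 2 =
   \sum_s g s * mean_coord (select s) i ^+ 2
   - 2 * sample_mean a i * (\sum_s g s * mean_coord (select s) i)
   + sample_mean a i ^+ 2 * (\sum_s g s).
  rewrite !mulr_sumr -sumrB -big_split; apply: eq_bigr => s _ /=; ring.
rewrite (plan_mean i gp) (plan_sum1 gp); lra.
Qed.

Lemma sample_potentials : (forall k t, unit_ball (a k t)) ->
  exists g : {ffun 'I_K -> 'I_m} -> R, plan g /\ forall e, 0 < e ->
  exists (F : 'I_K -> T -> R) (C : 'I_K -> R) (h : 'I_K -> T -> R),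
    [/\ forall k x, F k x = C k
          + 2 / K%:R * (\sum_i sample_mean a i * tnth x i)
          + (\sum_i tnth x i ^+ 2) / K%:R ^+ 2
          - h k x / (K%:R * Num.sqrt K%:R),
        forall k, convex_lip 8 (h k), feasible F,
        \sum_s g s * cost (select s) <= sample_value a F + e &
        sample_value a F <= \sum_i sample_mean a i ^+ 2 + 4 / K%:R].
Proof.
move=> aB; have [g [gp gd]] := finite_duality K_gt0 m_gt0 (fun s => cost (select s)).
exists g; split=> // e e0.
(* Optimality up to 1/K is what [profile_convex_lip] asks for. *)
have e'0 : 0 < Num.min e K%:R^-1 by rewrite lt_min e0 invr_gt0 ltr0n.
have [f [fc gf]] := gd _ e'0.
have [F [fF Ff tF]] := extend_potentials fc.
have Vf : dual_value f <= sample_value a F.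
  apply: ler_sum => k _; rewrite ler_wpM2r ?invr_ge0//.
  by apply: ler_sum => t _; exact: Ff.
exists F, (fun k => F k [tuple 0 | i < d]), (profile a F); split=> //.
- by move=> k x; exact: profile_eq.
- move=> k; apply: profile_convex_lip => //.
  apply: le_trans (plan_cost_ge gp) _; apply: le_trans gf _.
  by rewrite lerD// ge_min lexx orbT.
- by apply: le_trans gf _; rewrite lerD// ge_min lexx.
- exact: sample_value_le.
Qed.

(* A minimum over finitely many plans is visibly measurable in the sample,
   unlike the optimal cost. *)
Lemma plan_net (e : R) : 0 < e ->
  exists (p : nat) (G : nat -> {ffun 'I_K -> 'I_m} -> R),
    (forall n, plan (G n)) /\ forall g, plan g ->
    exists2 n, (n <= p)%N & forall s, `|G n s - g s| <= e.
Proof.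
move=> e0.
have g0 : exists g : {ffun 'I_K -> 'I_m} -> R, plan g.
  by have [g []] := finite_duality K_gt0 m_gt0 (fun _ => 0 : R); exists g.
have [g0' g0p] := g0.
pose M := (Num.truncn (e^-1)).+1.
have M0 : 0 < M%:R :> R by rewrite ltr0n.
have Me : M%:R^-1 <= e.
  by rewrite invf_ple ?posrE// ltW// truncnS_gt.
pose N := {ffun {ffun 'I_K -> 'I_m} -> 'I_(2 * M).+1}.
pose near (r : N) (g : {ffun 'I_K -> 'I_m} -> R) :=
  forall s : {ffun 'I_K -> 'I_m}, `|g s - (r s)%:R * (2 * M%:R)^-1| <= (2 * M%:R)^-1.
(* A rounded plan need not be a plan, so each grid vector that is close to some plan is represented
   by one such plan. *)
have /choice[G GP] : forall r : N, exists g, plan g /\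
    ((exists2 g', plan g' & near r g') -> near r g).
  move=> r; case: (pselect (exists2 g', plan g' & near r g')) => [[g gp rg]|nr].
    by exists g.
  by exists g0'.
exists #|N|, (fun n => G (nth [ffun=> ord0] (enum N) n)).
split=> [n|g gp]; first exact: (GP _).1.
have M20 : 0 < 2 * M%:R :> R by rewrite mulr_gt0.
have rP s : exists r : 'I_(2 * M).+1,
    `|g s - r%:R * (2 * M%:R)^-1| <= (2 * M%:R)^-1.
  have gs0 : 0 <= g s * (2 * M%:R) by rewrite mulr_ge0 ?(gp.1 s)// ltW.
  have gs1 : g s <= 1.
    rewrite -(plan_sum1 gp) (bigD1 s)//= lerDl.
    by apply: sumr_ge0 => s' _; exact: gp.1.
  have /andP[r1 r2] := truncn_itv gs0.
  have rM : (Num.truncn (g s * (2 * M%:R)) < (2 * M).+1)%N.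
    rewrite ltnS -(ler_nat R); apply: le_trans r1 _.
    by rewrite natrM ler_piMl// ltW.
  exists (Ordinal rM) => /=; move: r1 r2; set r := Num.truncn _.
  rewrite -[r.+1%:R]natr1 => r1 r2.
  rewrite -(ler_pM2r M20) -{2}(gtr0_norm M20) -normrM mulrBl mulrVK ?unitfE ?gt_eqF//.
  rewrite mulVf ?gt_eqF// ler_norml; apply/andP; split; lra.
have {rP} /choice[r rP] := rP.
exists (index (finfun r) (enum N)).
  by rewrite cardE ltnW// index_mem mem_enum.
move=> s; rewrite nth_index ?mem_enum//.
have : near (finfun r) (G (finfun r)).
  by apply: (GP _).2; exists g => // s'; rewrite ffunE.
move=> /(_ s); rewrite ffunE; have := rP s; rewrite distrC.
have := ler_distD ((r s)%:R * (2 * M%:R)^-1) (G (finfun r) s) (g s).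
have -> : (2 * M%:R)^-1 = M%:R^-1 / 2 :> R by rewrite invfM mulrC.
by move: Me; lra.
Qed.
End sample_potentials.

(** * Finite mixtures and images of measures *)

Section mixtures.
Context {R : realType} {dT : measure_display} {T : measurableType dT}.

Lemma mixture_exists (J : finType) (w : J -> {nonneg R})
    (nu : J -> {measure set T -> \bar R}) :
  exists mu : {measure set T -> \bar R},
    (forall A, mu A = \sum_j (w j)%:num%:E * nu j A)%E /\
    forall f : T -> \bar R, measurable_fun setT f -> (forall x, 0 <= f x)%E ->
      (\int[mu]_x f x = \sum_j (w j)%:num%:E * \int[nu j]_x f x)%E.
Proof.
pose L : seq (measure T R) := [seq (mscale (w j) (nu j) : measure T R) | j <- enum J].
pose z : measure T R := @mzero _ T R.
pose mu : {measure set T -> \bar R} := msum (nth z L) (size L).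
have E (F : measure T R -> \bar R) : (\sum_(n < size L) F (nth z L n) =
    \sum_j F (mscale (w j) (nu j)))%E.
  by rewrite -(big_mkord xpredT (fun n => F (nth z L n))) -(big_nth _ xpredT)
     big_map big_enum.
exists mu; split=> [A|f mf f0].
  exact: (E (fun m => m A)).
rewrite ge0_integral_measure_sum// (E (fun m => \int[m]_x f x)%E).
by apply: eq_bigr => j _; rewrite ge0_integral_mscale.
Qed.

(** An alias of [mu] that carries the proof of total mass 1, from which its instance of probability
    measure is built. *)
Definition of_total_mass1 (mu : {measure set T -> \bar R})
  (mu1 : mu setT = 1%E) : set T -> \bar R := mu.

Section of_total_mass1.
Variables (mu : {measure set T -> \bar R}) (mu1 : mu setT = 1%E).

HB.instance Definition _ := Measure.copy (of_total_mass1 mu1) mu.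

HB.instance Definition _ := Measure_isProbability.Build _ _ _
  (of_total_mass1 mu1) mu1.

End of_total_mass1.

Lemma probability_exists (mu : {measure set T -> \bar R}) : mu setT = 1%E ->
  exists p : probability T R, forall A, p A = mu A.
Proof. by move=> mu1; exists (of_total_mass1 mu1). Qed.

Lemma null_cover (mu : {measure set T -> \bar R}) (I : finType)
    (N : I -> set T) : (forall i, measurable (N i)) ->
  (forall i, mu (N i) = 0%E) ->
  exists N', [/\ measurable N', mu N' = 0%E & forall i, N i `<=` N'].
Proof.
move=> mN N0; suff H (s : seq I) : exists N', [/\ measurable N', mu N' = 0%E &
    forall i, i \in s -> N i `<=` N'].
  have [N' [mN' N'0 NN']] := H (enum I).
  by exists N'; split=> // i; apply: NN'; rewrite mem_enum.
elim: s => [|i s [N' [mN' N'0 NN']]]; first by exists set0.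
exists (N i `|` N'); split; first exact: measurableU.
- apply/eqP; rewrite eq_le measure_ge0 andbT.
  apply: le_trans (measureU2 _ (mN i) mN') _.
  by rewrite [X in (X + _)%E]N0 [X in (_ + X)%E]N'0 adde0.
- move=> j; rewrite inE => /predU1P[->|/NN' NjN']; first exact: subsetUl.
  by move=> x /NjN'; right.
Qed.
End mixtures.

Lemma integral_image {R : realType} {d1 d2 : measure_display}
    {X : measurableType d1} {Y : measurableType d2} (phi : X -> Y)
    (mphi : measurable_fun setT phi) (m : {measure set X -> \bar R})
    (nu : {measure set Y -> \bar R}) (f : Y -> \bar R) :
  measurable_fun setT f -> (forall y, 0 <= f y)%E ->
  (forall A, measurable A -> m (phi @^-1` A) = nu A) ->
  (\int[m]_x f (phi x) = \int[nu]_y f y)%E.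
Proof.
move=> mf f0 mnu.
pose pm : {measure set Y -> \bar R} :=
  measure_function_pushforward__canonical__measure_function_Measure m mphi.
transitivity (\int[pm]_y f y)%E.
  by rewrite (ge0_integral_pushforward mphi m measurableT mf).
by apply: eq_measure_integral => A mA _; exact: mnu.
Qed.

(** * Upper and lower bounds on the optimal cost *)

Section couplings.
Context {R : realType} {d K : nat}.
Local Notation T := (d.-tuple R).
Hypothesis K_gt0 : (0 < K)%N.

Lemma norm2_barycenter (y : K.-tuple T) :
  norm2 (barycenter y) ^+ 2 = cost (fun k => tnth y k).
Proof.
rewrite /norm2 sqr_sqrtr; last by apply: sumr_ge0 => i _; exact: sqr_ge0.
by apply: eq_bigr => i _; rewrite tnth_mktuple.
Qed.

Lemma measurable_tnth_coord (k : 'I_K) (i : 'I_d) :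
  measurable_fun [set: K.-tuple T] (fun y => tnth (tnth y k) i).
Proof.
apply: (@measurableT_comp _ _ _ _ _ _ (fun x : T => tnth x i) _ (fun y => tnth y k)).
  exact: measurable_coord.
exact: measurable_tnth.
Qed.

Lemma measurable_cost :
  measurable_fun [set: K.-tuple T] (fun y => cost (fun k => tnth y k)).
Proof.
apply: measurable_sum => i; apply: measurable_funX.
apply: measurable_funM => //; apply: measurable_sum => k.
exact: measurable_tnth_coord.
Qed.

Lemma MW2sq_le (mu : 'I_K -> probability T R)
    (gamma : {measure set (K.-tuple T) -> \bar R}) :
  (forall k A, measurable A -> gamma ((fun y => tnth y k) @^-1` A) = mu k A) ->
  (MW2sq mu <= \int[gamma]_y (cost (fun k => tnth y k))%:E)%E.
Proof.
move=> gm; have [p pE] : exists p : probability (K.-tuple T) R, forall A, p A = gamma A.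
  apply: probability_exists; have := gm (Ordinal K_gt0) setT measurableT.
  by rewrite preimage_setT probability_setT.
rewrite (eq_measure_integral p); last by move=> A mA _; exact/esym/pE.
apply: ereal_inf_lbound; exists p => [k A mA|].
  by rewrite /pushforward pE gm.
by apply: eq_integral => y _; rewrite norm2_barycenter.
Qed.

Lemma MW2sq_ge0 (mu : 'I_K -> probability T R) : (0 <= MW2sq mu)%E.
Proof.
apply: le_ereal_inf_tmp => _ [gamma _ <-]; apply: integral_ge0 => y _.
by rewrite lee_fin sqr_ge0.
Qed.

Lemma measurable_unit_ball : measurable (@unit_ball R d).
Proof.
have -> : @unit_ball R d = (fun x => \sum_i tnth x i ^+ 2) @^-1` `]-oo, 1].
  by apply/seteqP; split=> x; rewrite /= in_itv/= => /unit_ballP.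
rewrite -[X in measurable X]setTI; exact: measurable_sum_sqr.
Qed.

(** Weak duality with slack [delta]. The constraint is known only on the ball, which carries every
    coupling up to a null set, and adding [b] to each potential keeps all integrands nonnegative. *)
Lemma MW2sq_ge (mu : 'I_K -> probability T R) (F : 'I_K -> T -> R)
    (b delta : R) (e : 'I_K -> R) :
  (forall k, mu k (@unit_ball R d) = 1%E) ->
  (forall k, measurable_fun setT (F k)) -> (forall k x, `|F k x| <= b) ->
  0 <= delta ->
  (forall k, \int[mu k]_x (F k x)%:E = (e k)%:E)%E ->
  (forall y : 'I_K -> T, in_ball y -> \sum_k F k (y k) <= cost y + delta) ->
  ((\sum_k e k - delta)%:E <= MW2sq mu)%E.
Proof.
move=> muB mF Fb delta0 Fe Fc; apply: le_ereal_inf_tmp => _ [gamma gm <-].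
under eq_integral do rewrite norm2_barycenter.
have b0 : 0 <= b := le_trans (normr_ge0 _) (Fb (Ordinal K_gt0) [tuple 0 | i < d]).
have Fb0 k x : 0 <= F k x + b.
  by have := Fb k x; rewrite ler_norml => /andP[? _]; lra.
have mFk k : measurable_fun [set: K.-tuple T] (fun y => F k (tnth y k)).
  apply: (@measurableT_comp _ _ _ _ _ _ (F k) _ (fun y => tnth y k)) => //.
  exact: measurable_tnth.
have intF k : (\int[gamma]_y (F k (tnth y k) + b)%:E = (e k + b)%:E)%E.
  rewrite (integral_image (measurable_tnth k) (nu := mu k)
     (f := fun x => (F k x + b)%:E)); last 3 first.
  - by apply/measurable_EFinP; exact: measurable_funD.
  - by move=> x; rewrite lee_fin.
  - by move=> A mA; exact: gm.
  under eq_integral do rewrite EFinD.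
  rewrite integralD//.
  - by rewrite Fe integral_cst// [X in (_ * X)%E]probability_setT mule1.
  - exact: bounded_integrable (Fb k).
  - exact: finite_measure_integrable_cst.
have mc := measurable_cost.
suff H : ((\sum_k (e k + b))%:E <=
    \int[gamma]_y ((cost (fun k => tnth y k))%:E + (delta + K%:R * b)%:E))%E.
  move: H; rewrite ge0_integralD//; last 3 first.
  - by move=> y _; rewrite lee_fin cost_ge0.
  - exact/measurable_EFinP.
  - by move=> y _; rewrite lee_fin addr_ge0// mulr_ge0.
  rewrite integral_cst// [X in (_ * X)%E]probability_setT mule1.
  rewrite -leeBlDr// -EFinB; congr (_ <= _)%E; congr EFin.
  by rewrite big_split/= sumr_const card_ord -[_ *+ K]mulr_natl; ring.
rewrite -sumEFin; under eq_bigr do rewrite -intF.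
rewrite -ge0_integral_sum//; last 2 first.
- by move=> k; apply/measurable_EFinP; exact: measurable_funD.
- by move=> k y _; rewrite lee_fin.
apply: ae_ge0_le_integral => //.
- by move=> y _; apply: sume_ge0 => k _; rewrite lee_fin.
- by apply: emeasurable_sum => k; apply/measurable_EFinP; exact: measurable_funD.
- by move=> y _; rewrite -EFinD lee_fin addr_ge0 ?cost_ge0// addr_ge0// mulr_ge0.
- by apply: emeasurable_funD => //; exact/measurable_EFinP.
have mB k : measurable ((fun y : K.-tuple T => tnth y k) @^-1` (~` @unit_ball R d)).
  rewrite -[X in measurable X]setTI; apply: measurable_tnth => //.
  by apply: measurableC; exact: measurable_unit_ball.
have gB k : gamma ((fun y => tnth y k) @^-1` (~` @unit_ball R d)) = 0%E.
  have := gm k _ (measurableC measurable_unit_ball); rewrite /pushforward => ->.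
  by rewrite probability_setC ?muB ?subee//; exact: measurable_unit_ball.
have [N [mN N0 BN]] := null_cover mB gB.
exists N; split=> // y /= h; apply: contrapT => nN; apply: h => _.
rewrite sumEFin -EFinD lee_fin big_split/= sumr_const card_ord -[b *+ K]mulr_natl.
rewrite addrA lerD2r; apply: Fc => k; apply: contrapT => yB; apply: nN.
by apply: (BN k).
Qed.
End couplings.

(** * Couplings of empirical measures given by plans *)

Section sampled_couplings.
Context {R : realType} {d K m : nat}.
Local Notation T := (d.-tuple R).
Hypotheses (K_gt0 : (0 < K)%N) (m_gt0 : (0 < m)%N).
Local Notation index := {ffun 'I_K -> 'I_m}.

Let mR : 0 < m%:R :> R. Proof. by rewrite ltr0n. Qed.

Lemma integral_empirical (x : 'I_m -> T) (f : T -> R) (b : R) :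
  measurable_fun setT f -> (forall t, `|f t| <= b) ->
  (\int[empirical R m_gt0 x]_t (f t)%:E = ((\sum_i f (x i)) / m%:R)%:E)%E.
Proof.
move=> mf fb.
have fb0 t : 0 <= f t + b.
  by have := fb t; rewrite ler_norml => /andP[? _]; lra.
have mi0 : 0 <= m%:R^-1 :> R by rewrite invr_ge0 ltW.
have [mu [muE mui]] := mixture_exists (fun=> NngNum mi0) (fun i : 'I_m => \d_(x i)).
have mfb : measurable_fun setT (fun t => (f t + b)%:E).
  by apply/measurable_EFinP; exact: measurable_funD.
have : (\int[empirical R m_gt0 x]_t (f t + b)%:E =
    ((\sum_i (f (x i) + b)) / m%:R)%:E)%E.
  rewrite (eq_measure_integral mu); last first.
    move=> A mA _; rewrite [RHS]muE;
    by rewrite -ge0_sume_distrr.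
  rewrite mui//.
  under eq_bigr => i _ do rewrite integral_dirac// diracT mul1e /= -EFinM mulrC.
  by rewrite sumEFin -mulr_suml.
have intf : (empirical R m_gt0 x).-integrable setT (EFin \o f).
  exact: bounded_integrable fb.
under eq_integral do rewrite EFinD.
rewrite integralD//; last exact: finite_measure_integrable_cst.
rewrite integral_cst// [X in (_ * X)%E]probability_setT mule1.
rewrite big_split/= sumr_const card_ord mulrDl -[b *+ m]mulr_natr mulfK ?gt_eqF//.
rewrite EFinD => /(congr1 (fun z => z - b%:E)%E).
by rewrite !addeK.
Qed.

Definition index_tuple (z : 'I_K -> 'I_m -> T) (s : index) : K.-tuple T :=
  [tuple z k (s k) | k < K].

Lemma cost_index_tuple z s :
  cost (fun k => tnth (index_tuple z s) k) = cost (select z s).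
Proof. by congr cost; apply/funext => k; rewrite tnth_mktuple. Qed.

Lemma MW2sq_empirical_le (z : 'I_K -> 'I_m -> T) (g : index -> R) : plan g ->
  (MW2sq (fun k => empirical R m_gt0 (z k))
     <= (\sum_s g s * cost (select z s))%:E)%E.
Proof.
move=> gp; have [gamma [gE gi]] := mixture_exists
  (fun s : index => NngNum (gp.1 s)) (fun s => \d_(index_tuple z s)).
apply: le_trans (MW2sq_le K_gt0 (gamma := gamma) _) _.
  move=> k A mA; rewrite gE /= /empirical.
  have -> : (\sum_i \d_(z k i) A)%E = (\sum_i (z k i \in A)%:R)%:E :> \bar R.
    by rewrite -sumEFin; apply: eq_bigr => i _; rewrite diracE.
  rewrite -EFinM mulrC -(plan_marginal k _ gp) -sumEFin; apply: eq_bigr => s _.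
  rewrite EFinM; congr (_ * _)%E; rewrite diracE; congr ((nat_of_bool _)%:R)%:E.
  by apply/idP/idP; rewrite !inE /= tnth_mktuple.
rewrite gi; last 2 first.
- by apply/measurable_EFinP; exact: measurable_cost.
- by move=> y; rewrite lee_fin cost_ge0.
rewrite -sumEFin; apply: lee_sum => s _.
rewrite integral_dirac//; last by apply/measurable_EFinP; exact: measurable_cost.
by rewrite diracT mul1e cost_index_tuple.
Qed.
End sampled_couplings.

(** * Averaging sample couplings over the probability space *)

Lemma integral_mrestr {R : realType} {d1 : measure_display}
    {X : measurableType d1} (m : {measure set X -> \bar R}) (E : set X)
    (mE : measurable E) (f : X -> \bar R) :
  measurable_fun setT f -> (forall x, 0 <= f x)%E ->
  (\int[mrestr m mE]_x f x = \int[m]_(x in E) f x)%E.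
Proof.
move=> mf f0.
rewrite [LHS](ge0_negligible_integral (measurableC mE))//; last first.
  by rewrite /= /mrestr setICl measure0.
rewrite setTD setCK; apply: eq_measure_integral => A mA AE.
by rewrite /= /mrestr setIidl.
Qed.

Section running_min.
Context {R : realType}.

Fixpoint running_min (c : nat -> R) n : R :=
  if n is n'.+1 then Num.min (running_min c n') (c n) else c 0%N.

Lemma running_min_le c n j : (j <= n)%N -> running_min c n <= c j.
Proof.
elim: n => [|n IH]; first by rewrite leqn0 => /eqP ->.
rewrite leq_eqVlt => /predU1P[->|jn] /=; first by rewrite ge_min lexx orbT.
by rewrite ge_min IH.
Qed.

Lemma running_min_attained c n : exists2 j, (j <= n)%N & c j = running_min c n.
Proof.
elim: n => [|n [j jn cj]]; first by exists 0%N.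
rewrite /=; case: (leP (running_min c n) (c n.+1)) => _; last by exists n.+1.
by exists j => //; exact: leqW.
Qed.

Lemma measurable_running_min {dX : measure_display} {X : measurableType dX}
    (c : nat -> X -> R) n : (forall j, measurable_fun setT (c j)) ->
  measurable_fun setT (fun x => running_min (c^~ x) n).
Proof.
move=> mc; elim: n => [|n IH] /=; first exact: mc.
exact: measurable_minr.
Qed.
End running_min.

Section averaged_coupling.
Context {R : realType} {d K m : nat}.
Context {dO : measure_display} {Omega : measurableType dO}.
Local Notation T := (d.-tuple R).
Hypotheses (K_gt0 : (0 < K)%N) (m_gt0 : (0 < m)%N).
Variables (P : probability Omega R) (Y : 'I_K -> 'I_m -> Omega -> T).
Hypothesis mY : forall k t, measurable_fun setT (Y k t).
Variable mu : 'I_K -> probability T R.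
Hypothesis Y_law : forall k t A, measurable A -> P (Y k t @^-1` A) = mu k A.
Local Notation index := {ffun 'I_K -> 'I_m}.

Definition sample w : 'I_K -> 'I_m -> T := fun k t => Y k t w.

Definition plan_cost (g : index -> R) w : R :=
  \sum_s g s * cost (select (sample w) s).

Let mtuple s : measurable_fun setT (fun w => index_tuple (sample w) s).
Proof.
apply/measurable_fun_tnthP => k.
rewrite (_ : _ \o _ = Y k (s k))//.
by apply/funext => w; rewrite /= tnth_mktuple.
Qed.

Let mcost s : measurable_fun setT (fun w => cost (select (sample w) s)).
Proof.
under eq_fun do rewrite -cost_index_tuple.
exact: (measurableT_comp measurable_cost (mtuple s)).
Qed.

Lemma measurable_plan_cost g : measurable_fun setT (plan_cost g).
Proof. by apply: measurable_sum => s; exact: (measurable_funM _ (mcost s)). Qed.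

Lemma plan_cost_ge0 g w : plan g -> 0 <= plan_cost g w.
Proof.
by move=> gp; apply: sumr_ge0 => s _; rewrite mulr_ge0 ?cost_ge0// gp.1.
Qed.

(* Averaging over [w] an optimal coupling of the sample marginals gives a
   coupling of the true marginals. *)
Lemma MW2sq_le_average (G : nat -> index -> R) p : (forall j, plan (G j)) ->
  (MW2sq mu <=
   \int[P]_w (running_min (fun j => plan_cost (G j) w) p)%:E)%E.
Proof.
move=> Gp; pose c j w := plan_cost (G j) w.
pose M w := running_min (c^~ w) p.
have mc j : measurable_fun setT (c j) by exact: measurable_plan_cost.
have mM : measurable_fun setT M by exact: measurable_running_min.
have M0 w : 0 <= M w.
  by rewrite /M; have [j _ <-] := running_min_attained (c^~ w) p; exact: plan_cost_ge0.
pose A j := [set w | c j w <= M w].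
have mA j : measurable (A j).
  by rewrite -[A j]setTI; apply: measurable_fun_le.
(* [E j] is the event that [j] is the first index attaining the minimum; [G j] is the plan used
   there. *)
pose E := seqDU A.
have mE j : measurable (E j) by exact: seqDU_measurable.
have tE : trivIset setT E by exact: trivIset_seqDU.
have UE : \big[setU/set0]_(j < p.+1) E j = setT.
  rewrite -bigsetU_seqDU -bigcup_mkord; apply/seteqP; split=> // w _.
  have [j jp cj] := running_min_attained (c^~ w) p.
  by exists j => //; rewrite /A /= [c j w]cj.
have PE B : measurable B -> (\sum_(j < p.+1) P (B `&` E j) = P B)%E.
  move=> mB; rewrite -[in RHS](setIT B) -UE -bigcup_mkord setI_bigcupr.
  rewrite bigcup_mkord; apply/esym; apply: (measure_bigsetU P (F := fun j => B `&` E j)).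
  - by move=> j; exact: measurableI.
  - exact: trivIset_setIl.
pose J := ('I_p.+1 * index)%type.
(* For [js = (j, s)], the image of [P] restricted to [E j] under the sample tuple selected by [s];
   its weight in the mixture is [G j s]. *)
pose nu (js : J) : {measure set (K.-tuple T) -> \bar R} :=
  measure_function_pushforward__canonical__measure_function_Measure
    (mrestr P (mE js.1)) (mtuple js.2).
have [gamma [gE gi]] := mixture_exists
  (fun js : J => NngNum ((Gp js.1).1 js.2)) nu.
apply: le_trans (MW2sq_le K_gt0 (gamma := gamma) _) _.
  move=> k B mB; rewrite gE.
  have mBt t : measurable (Y k t @^-1` B) by rewrite -[_ @^-1` _]setTI; exact: mY.
  have nuE (js : J) : nu js ((fun y => tnth y k) @^-1` B) =
      (fine (P (Y k (js.2 k) @^-1` B `&` E js.1)))%:E.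
    rewrite fineK; last by apply: fin_num_measure; exact: measurableI.
    rewrite /nu /= /pushforward /mrestr; congr (P (_ `&` _)).
    by apply/seteqP; split=> w /=; rewrite tnth_mktuple.
  under eq_bigr do rewrite nuE -EFinM.
  rewrite sumEFin -(pair_bigA _ (fun (j : 'I_p.+1) (s : index) => G j s *
    fine (P (Y k (s k) @^-1` B `&` E j))))/=.
  under eq_bigr => j _ do
    rewrite (plan_marginal k (fun t => fine (P (Y k t @^-1` B `&` E j))) (Gp j)).
  rewrite -mulr_suml exchange_big/=.
  have -> : \sum_t \sum_(j < p.+1) fine (P (Y k t @^-1` B `&` E j)) =
      \sum_(t < m) fine (mu k B).
    apply: eq_bigr => t _; rewrite -(Y_law k t mB) -(PE _ (mBt t)) sum_fine//.
    by move=> j _; apply: fin_num_measure; exact: measurableI.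
  rewrite sumr_const card_ord -[_ *+ m]mulr_natr mulfK ?pnatr_eq0 -?lt0n//.
  by rewrite fineK// fin_num_measure.
rewrite gi; last 2 first.
- by apply/measurable_EFinP; exact: measurable_cost.
- by move=> y; rewrite lee_fin cost_ge0.
have nui (js : J) : (\int[nu js]_y (cost (fun k => tnth y k))%:E =
    \int[P]_(w in E js.1) (cost (select (sample w) js.2))%:E)%E.
  rewrite -(integral_image (mtuple js.2) (m := mrestr P (mE js.1))); last 3 first.
  - by apply/measurable_EFinP; exact: measurable_cost.
  - by move=> y; rewrite lee_fin cost_ge0.
  - by [].
  rewrite integral_mrestr//; last 2 first.
  - apply/measurable_EFinP; exact: (measurableT_comp measurable_cost (mtuple js.2)).
  - by move=> w; rewrite lee_fin cost_ge0.
  by apply: eq_integral => w _; rewrite cost_index_tuple.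
under eq_bigr do rewrite nui.
rewrite -(pair_bigA _ (fun (j : 'I_p.+1) (s : index) => (G j s)%:E *
  \int[P]_(w in E j) (cost (select (sample w) s))%:E)%E)/=.
have -> : (\int[P]_w (M w)%:E = \sum_(j < p.+1) \int[P]_(w in E j) (M w)%:E)%E.
  rewrite -UE -(big_mkord xpredT E) ge0_integral_bigsetU//.
  - by rewrite big_mkord.
  - exact: iota_uniq.
  - exact: sub_trivIset tE.
  - by apply: measurable_funTS; exact/measurable_EFinP.
  - by move=> w _; rewrite lee_fin.
apply: lee_sum => j _.
have mcE s : measurable_fun (E j) (fun w => (cost (select (sample w) s))%:E).
  by apply: measurable_funTS; exact/measurable_EFinP.
under eq_bigr => s _.
  rewrite -ge0_integralZl//; last 2 first.
  - by move=> w _; rewrite lee_fin cost_ge0.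
  - by rewrite lee_fin (Gp j).1.
  over.
rewrite -ge0_integral_sum//; last 2 first.
- by move=> s; apply: emeasurable_funM => //.
- by move=> s w _; rewrite -EFinM lee_fin mulr_ge0 ?cost_ge0// (Gp j).1.
apply: ge0_le_integral => //.
- move=> w _; apply: sume_ge0 => s _.
  by rewrite -EFinM lee_fin mulr_ge0 ?cost_ge0// (Gp j).1.
- by apply: emeasurable_sum => s; apply: emeasurable_funM.
- by apply: measurable_funTS; exact/measurable_EFinP.
- move=> w /(@subset_seqDU _ A j) /= cM.
  by under eq_bigr do rewrite -EFinM; rewrite sumEFin lee_fin.
Qed.
End averaged_coupling.

(** * Chaining over convex functions *)

Lemma integral_image_bounded {R : realType} {d1 d2 : measure_display}
    {X : measurableType d1} {Y : measurableType d2} (phi : X -> Y)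
    (mphi : measurable_fun setT phi) (P : probability X R)
    (nu : probability Y R) (f : Y -> R) (b : R) :
  measurable_fun setT f -> (forall y, `|f y| <= b) ->
  (forall A, measurable A -> P (phi @^-1` A) = nu A) ->
  (\int[P]_x (f (phi x))%:E = \int[nu]_y (f y)%:E)%E.
Proof.
move=> mf fb Pnu.
have mfphi : measurable_fun setT (fun x => f (phi x)).
  exact: (measurableT_comp mf mphi).
have := integral_image mphi (m := P) (nu := nu) (f := fun y => (f y + b)%:E).
have shift dZ (Z : measurableType dZ) (Q : probability Z R) (g : Z -> R) :
    measurable_fun setT g -> (forall z, `|g z| <= b) ->
    (\int[Q]_z (g z + b)%:E = \int[Q]_z (g z)%:E + b%:E)%E.
  move=> mg gb; under eq_integral do rewrite EFinD.
  rewrite integralD//; last 2 first.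
  - exact: bounded_integrable gb.
  - exact: finite_measure_integrable_cst.
  by rewrite integral_cst// [X in (_ * X)%E]probability_setT mule1.
rewrite !shift// => H.
suff /(congr1 (fun z => z - b%:E)%E) : (\int[P]_x (f (phi x))%:E + b%:E =
    \int[nu]_y (f y)%:E + b%:E)%E by rewrite !addeK.
apply: H => //.
- by apply/measurable_EFinP; exact: measurable_funD.
- by move=> y; rewrite lee_fin; have := fb y; rewrite ler_norml; lra.
Qed.

Section clipping.
Context {R : realType}.

Definition clip (b x : R) : R := Num.max (- b) (Num.min b x).

Lemma clip_le b x : 0 <= b -> `|clip b x| <= b.
Proof.
move=> b0; rewrite ler_norml /clip le_max lexx/= ge_max.
by rewrite ge_min lexx/= andbT; lra.
Qed.

Lemma clip_id b x : `|x| <= b -> clip b x = x.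
Proof.
by rewrite ler_norml /clip => /andP[bx xb]; rewrite min_r// max_r.
Qed.
End clipping.

Section chaining.
Context {R : realType} {d : nat}.
Local Notation T := (d.-tuple R).

Definition ball_indic (x : T) : R := \1_(@unit_ball R d) x.

Lemma measurable_ball_indic : measurable_fun setT ball_indic.
Proof. by apply: measurable_indic; exact: measurable_unit_ball. Qed.

(** An increment of a chain, bounded on the whole space and equal to [f - g] at points of the ball
    where the two differ by at most [b]. *)
Definition link (b : R) (f g : T -> R) x : R :=
  clip b (f x - g x) * ball_indic x.

Lemma measurable_link b f g : measurable_fun setT f -> measurable_fun setT g ->
  measurable_fun setT (link b f g).
Proof.
move=> mf mg; apply: measurable_funM; last exact: measurable_ball_indic.
apply: measurable_maxr => //; apply: measurable_minr => //.
exact: measurable_funB.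
Qed.

Lemma link_le b f g x : 0 <= b -> `|link b f g x| <= b.
Proof.
move=> b0; rewrite normrM; apply: le_trans (clip_le (f x - g x) b0).
by rewrite ler_piMr// /ball_indic indicE; case: (_ \in _); rewrite ?normr1// normr0.
Qed.

(** Chaining from 0 up to the net of level [J], where [h] is replaced by a net element [g] on the
    ball. The increments of level [j] have size of order 4^(-j) and number at most exp(2 a 2^(j d)).
    The list [s] picks out the variables with one common law. *)
Lemma uniform_deviation (A : nat) : (0 < d)%N -> exists a D : R, 0 < a /\ 0 < D /\
  forall (dO : measure_display) (Omega : measurableType dO)
    (P : probability Omega R) (I : finType) (X : I -> {RV P >-> T})
    (nu : I -> probability T R) (s : seq I) (k0 : I) (J : nat),
  mutually_independent X ->
  (forall i B, measurable B -> P (X i @^-1` B) = nu i B) ->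
  uniq s -> {in s, forall i, nu i = nu k0} -> (0 < size s)%N ->
  (2 ^ (J * d) <= size s)%N ->
  exists M : Omega -> R, [/\ measurable_fun setT M, forall w, 0 <= M w,
    (\int[P]_w (M w)%:E <= (D / Num.sqrt (size s)%:R *
       \sum_(j < J.+1) mesh j ^+ 2 * Num.sqrt (2 ^+ (j * d)))%:E)%E &
    forall h, convex_lip A h -> exists (g : T -> R) (b e : R),
      [/\ measurable_fun setT g, forall x, `|g x| <= b,
          (\int[nu k0]_x (g x)%:E = e%:E)%E,
          forall x, unit_ball x -> `|h x - g x| <= a * mesh J ^+ 2 &
          forall w, `|(\sum_(i <- s) g (X i w)) / (size s)%:R - e| <= M w]].
Proof.
move=> d0; have [a a0 cov] := convex_lip_covering (R := R) A d0.
(* Two consecutive nets differ by at most a 4^(-j) + a 4^(1-j) = 5 a 4^(-j) on the approximations of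
   one function. The other term bounds [h] itself, for the first increment. *)
pose D0 : R := 5 * a + (d * A + 1)%:R.
have D00 : 0 < D0 by rewrite ltr_wpDr// mulr_gt0.
(* This is (L + 2) / l of [maximal_inequality]: [L + 2] is at most (2 a + 3) q^2, since q >= 1, and
   1/l contains the factor 4 D0. *)
pose D : R := 4 * (2 * a + 3) * D0.
exists a, D; split => //; split.
  by rewrite !mulr_gt0// addr_gt0// mulr_gt0.
have [Ic covI] := @choice nat finType _ cov.
pose Fc j := sval (cid (covI j)).
have covF j : [/\ forall i, measurable_fun setT (Fc j i),
        #|Ic j|%:R <= expR (a * 2 ^+ (j * d)) &
        forall h, convex_lip A h -> exists i, forall x, unit_ball x ->
          `|h x - Fc j i x| <= a * mesh j ^+ 2] := svalP (cid (covI j)).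
move=> dO Omega P I X nu s k0 J indep law us nus s0 Js.
set m := size s.
have mR : 0 < m%:R :> R by rewrite ltr0n.
have sm : 0 < Num.sqrt m%:R :> R by rewrite sqrtr_gt0.
have sm2 : Num.sqrt m%:R ^+ 2 = m%:R :> R by rewrite sqr_sqrtr// ltW.
(* Before level 0 stands the zero function; its index, formally in [Ic 0], is a dummy. *)
pose prevF j (i : Ic j.-1) : T -> R := if j is 0 then fun=> 0 else Fc j.-1 i.
have mprev j i : measurable_fun setT (prevF j i).
  case: j i => [|j] i; first exact: measurable_cst.
  by have [mF _ _] := covF j; exact: (mF i).
have mFc j i : measurable_fun setT (Fc j i) by have [+ _ _] := covF j; apply.
pose bj j : R := D0 * mesh j ^+ 2.
have bj0 j : 0 < bj j by rewrite mulr_gt0// exprn_gt0// mesh_gt0.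
pose lk j (ii : Ic j * Ic j.-1) := link (bj j) (Fc j ii.1) (prevF j ii.2).
have mlk j ii : measurable_fun setT (lk j ii) by exact: measurable_link.
have lkb j ii x : `|lk j ii x| <= bj j by apply: link_le; exact: ltW.
have mX i : measurable_fun setT (X i) by exact: measurable_funPT.
pose e j ii i := fine (\int[nu i]_x (lk j ii x)%:E)%E.
have eE j ii i : (\int[nu i]_x (lk j ii x)%:E = (e j ii i)%:E)%E.
  rewrite fineK//; apply: integrable_fin_num => //.
  exact: bounded_integrable (lkb j ii).
have eX j ii i : (\int[P]_w (lk j ii (X i w))%:E = (e j ii i)%:E)%E.
  by rewrite -eE; apply: integral_image_bounded (lkb j ii) _ => //; exact: law.
have level (j : 'I_J.+1) : exists M : Omega -> R,
    [/\ measurable_fun setT M, forall w, 0 <= M w,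
      forall ii w, `|\sum_(i <- s) (lk j ii (X i w) - e j ii i)| <= M w &
      (\int[P]_w (M w)%:E <= (m%:R * (D / Num.sqrt m%:R *
         (mesh j ^+ 2 * Num.sqrt (2 ^+ (j * d)))))%:E)%E].
  have p0 : 0 < 2 ^+ (j * d) :> R by exact: exprn_gt0.
  pose q : R := Num.sqrt (2 ^+ (j * d)).
  have q0 : 0 < q by rewrite sqrtr_gt0.
  have q2 : q ^+ 2 = 2 ^+ (j * d) by rewrite sqr_sqrtr// ltW.
  have q1 : 1 <= q ^+ 2 by rewrite q2 exprn_ege1// ler1n.
  have qm : q <= Num.sqrt m%:R.
    rewrite ler_sqrt// -natrX ler_nat; apply: leq_trans Js.
    by rewrite leq_pexp2l// leq_mul2r leq_ord orbT.
  (* This makes the exponent 8 l^2 b^2 m equal to q^2/2, comparable to the logarithm of the number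
     of pairs. The requirement l (2 b) <= 1/2 becomes q <= sqrt(m), which follows from 2^(J d) <=
     m. *)
  pose l := q / (4 * bj j * Num.sqrt m%:R).
  have l0 : 0 < l by apply: divr_gt0 => //; apply: mulr_gt0 => //; apply: mulr_gt0.
  pose L : R := (2 * a + 1) * q ^+ 2.
  have lbE : l * bj j = q / Num.sqrt m%:R / 4.
    by rewrite /l; field; rewrite !gt_eqF.
  have [||||M [mM M0 MS ME]] := @maximal_inequality _ _ _ _ _ P I
      (Ic j * Ic j.-1)%type X (fun ii _ => lk j ii) (e j) s (bj j) l L indep us
      (fun ii _ => mlk j ii) (fun ii _ => lkb j ii) (eX j).
  - exact: l0.
  - rewrite mulrCA lbE; have : q / Num.sqrt m%:R <= 1 by rewrite ler_pdivrMr ?mul1r.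
    lra.
  - by rewrite mulr_ge0 ?sqr_ge0// addr_ge0// mulr_ge0// ltW.
  - rewrite card_prod natrM.
    have [_ c1 _] := covF j; have [_ c2 _] := covF j.-1.
    have c12 := ler_pM (ler0n R #|Ic j|) (ler0n R #|Ic j.-1|) c1 c2.
    apply: le_trans (ler_wpM2r (expR_ge0 _) c12) _.
    rewrite -!expRD ler_expR -/m -[8 * _ * _]mulrA -exprMn lbE !exprMn exprVn sm2.
    have -> : 8 * (q ^+ 2 / m%:R * 4^-1 ^+ 2) * m%:R = q ^+ 2 / 2.
      by field; rewrite gt_eqF.
    have h1 : 2 ^+ (j.-1 * d) <= q ^+ 2.
      by rewrite q2 ler_eXn2l ?ltr1n// leq_mul2r leq_pred orbT.
    have := ler_wpM2l (ltW a0) h1; rewrite -q2 /L; have := sqr_ge0 q; lra.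
  exists M; split=> //; apply: le_trans ME _; rewrite lee_fin.
  have -> : m%:R * (D / Num.sqrt m%:R * (mesh j ^+ 2 * q)) =
      ((2 * a + 3) * q ^+ 2) / l.
    rewrite -{1}sm2 /D /l /bj; field.
    by rewrite !gt_eqF// ?mesh_gt0.
  rewrite ler_wpM2r ?invr_ge0 ?(ltW l0)// /L; lra.
have /choice[M MP] := level.
exists (fun w => \sum_j M j w / m%:R); split.
- by apply: measurable_sum => j; apply: measurable_funM => //; have [] := MP j.
- move=> w; apply: sumr_ge0 => j _; apply: divr_ge0; last exact: ltW.
  by have [_ + _ _] := MP j.
- under eq_integral do rewrite -sumEFin.
  rewrite ge0_integral_sum//; last 2 first.
  + move=> j; apply/measurable_EFinP; apply: measurable_funM => //.
    by have [] := MP j.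
  + move=> j w _; rewrite lee_fin; apply: divr_ge0; last exact: ltW.
    by have [_ + _ _] := MP j.
  rewrite mulr_sumr -sumEFin; apply: lee_sum => j _.
  have [mM M0 _ ME] := MP j.
  under eq_integral do rewrite EFinM muleC.
  rewrite ge0_integralZl//; [|exact/measurable_EFinP|by move=> w _; rewrite lee_fin].
  apply: le_trans (lee_wpmul2l _ ME) _; first by rewrite lee_fin invr_ge0 ltW.
  by rewrite -EFinM mulKf ?gt_eqF.
move=> h hA.
have hcov j : exists i : Ic j, forall x, unit_ball x ->
    `|h x - Fc j i x| <= a * mesh j ^+ 2 by have [_ _] := covF j; apply.
pose i j := sval (cid (hcov j)).
have iP j : forall x, unit_ball x ->
    `|h x - Fc j (i j) x| <= a * mesh j ^+ 2 := svalP (cid (hcov j)).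
pose ii j : Ic j * Ic j.-1 := (i j, i j.-1).
exists (fun x => \sum_(j < J.+1) lk j (ii j) x), (\sum_(j < J.+1) bj j),
  (\sum_(j < J.+1) e j (ii j) k0).
have clipped j x : unit_ball x -> lk j (ii j) x = Fc j (i j) x - prevF j (i j.-1) x.
  move=> xB; rewrite /lk /link /ball_indic indicE mem_set// mulr1 clip_id//.
  case: j => [|j] /=.
    rewrite subr0 /bj /mesh expr0 expr1n mulr1.
    have := iP 0%N _ xB; rewrite /mesh expr0 expr1n mulr1 distrC => h1.
    have [h0 hp] := hA; have [p ph] := hp 1 ltr01.
    have h2 := convex_bound ph h0 xB.
    have := ler_distD (h x) (Fc 0%N (i 0%N) x) 0; rewrite !subr0 => h3.
    by rewrite /D0 natrD natrM; lra.
  have h1 := iP j.+1 _ xB; have h2 := iP j _ xB.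
  rewrite distrC in h1; apply: le_trans (ler_distD (h x) _ _) _.
  apply: le_trans (lerD h1 h2) _; rewrite (meshS j) /bj /D0 exprMn.
  have : 0 <= (d * A + 1)%:R * mesh j.+1 ^+ 2 :> R by rewrite mulr_ge0// sqr_ge0.
  lra.
split.
- by apply: measurable_sum => j; exact: mlk.
- by move=> x; apply: le_trans (ler_norm_sum _ _ _) _; apply: ler_sum => j _.
- under eq_integral do rewrite -sumEFin.
  rewrite integral_sum//.
    by rewrite -sumEFin; apply: eq_bigr => j _; exact: eE.
  by move=> j; exact: bounded_integrable (lkb j (ii j)).
- move=> x xB.
  have -> : \sum_(j < J.+1) lk j (ii j) x = Fc J (i J) x; last exact: iP.
  elim: (J) => [|j IH]; first by rewrite big_ord_recl big_ord0 addr0 clipped// subr0.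
  by rewrite big_ord_recr/= IH clipped//= addrC subrK.
- move=> w; have -> : (\sum_(k <- s) \sum_(j < J.+1) lk j (ii j) (X k w)) / m%:R
      - \sum_(j < J.+1) e j (ii j) k0 =
      \sum_(j < J.+1) (\sum_(k <- s) (lk j (ii j) (X k w) - e j (ii j) k)) / m%:R.
    rewrite exchange_big/= mulr_suml -sumrB; apply: eq_bigr => j _.
    rewrite sumrB mulrBl; congr (_ - _).
    rewrite (eq_big_seq (fun=> e j (ii j) k0)); last first.
      by move=> k ks; rewrite /e nus.
    by rewrite big_const_seq count_predT iter_addr addr0 -/m -[e _ _ _ *+ m]mulr_natr mulfK ?gt_eqF.
  apply: le_trans (ler_norm_sum _ _ _) _; apply: ler_sum => j _.
  rewrite normrM normfV (gtr0_norm mR) ler_wpM2r ?invr_ge0 ?(ltW mR)//.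
  by have [_ _ + _] := MP j; apply.
Qed.
End chaining.

(** * Deviations of means, and lower bounds from potentials *)

Section lower_bounds.
Context {R : realType} {d : nat}.
Local Notation T := (d.-tuple R).

(** The d + 1 statistics through which the explicit part of a potential sees the data, cut off
    outside the ball to be bounded by 1. *)
Definition ball_stat (o : option 'I_d) (x : T) : R :=
  (if o is Some i then tnth x i else \sum_i tnth x i ^+ 2) * ball_indic x.

Lemma measurable_ball_stat o : measurable_fun setT (ball_stat o).
Proof.
apply: measurable_funM; last exact: measurable_ball_indic.
by case: o => [i|]; [exact: measurable_coord|exact: measurable_sum_sqr].
Qed.

Lemma ball_stat_le o x : `|ball_stat o x| <= 1.
Proof.
rewrite /ball_stat /ball_indic indicE.
case: (boolP (x \in _)) => [/set_mem xB|_]; last by rewrite mulr0 normr0.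
rewrite mulr1; case: o => [i|]; first exact: unit_ball_coord.
rewrite ger0_norm; first exact/unit_ballP.
by apply: sumr_ge0 => i _; exact: sqr_ge0.
Qed.

Lemma ball_stat_coord i x : unit_ball x -> ball_stat (Some i) x = tnth x i.
Proof. by move=> xB; rewrite /ball_stat /ball_indic indicE mem_set// mulr1. Qed.

Lemma ball_stat_sqr x : unit_ball x -> ball_stat None x = \sum_i tnth x i ^+ 2.
Proof. by move=> xB; rewrite /ball_stat /ball_indic indicE mem_set// mulr1. Qed.

Lemma mean_deviation : exists2 C : R, 0 < C &
  forall (dO : measure_display) (Omega : measurableType dO)
    (P : probability Omega R) (I : finType) (X : I -> {RV P >-> T})
    (e : option 'I_d -> I -> R),
  mutually_independent X -> (0 < #|I|)%N ->
  (forall o i, \int[P]_w (ball_stat o (X i w))%:E = (e o i)%:E)%E ->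
  exists M : Omega -> R, [/\ measurable_fun setT M, forall w, 0 <= M w,
    (\int[P]_w (M w)%:E <= (C / Num.sqrt #|I|%:R)%:E)%E &
    forall o w, `|\sum_i (ball_stat o (X i w) - e o i)| / #|I|%:R <= M w].
Proof.
exists (4 * (d%:R + 4)) => [|dO Omega P I X e indep I0 eE].
  by rewrite mulr_gt0// ltr_wpDl.
set n := #|I|.
have nR : 0 < n%:R :> R by rewrite ltr0n.
have s0 : 0 < Num.sqrt n%:R :> R by rewrite sqrtr_gt0.
have s2 : Num.sqrt n%:R ^+ 2 = n%:R :> R by rewrite sqr_sqrtr// ltW.
have s1 : 1 <= Num.sqrt n%:R :> R by rewrite -[leLHS]sqrtr1 ler_sqrt// ler1n.
(* With this [l] the exponent is 1/2, and (d + 1) e^(1/2) <= e^(d + 2). *)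
pose l : R := (4 * Num.sqrt n%:R)^-1.
have l0 : 0 < l by rewrite invr_gt0 mulr_gt0.
have [||||M [mM M0 MS ME]] := @maximal_inequality _ _ _ _ _ P I
    (option 'I_d) X (fun o _ => ball_stat o) e (enum I) 1 l (d%:R + 2) indep
    (enum_uniq I) (fun o _ => measurable_ball_stat o)
    (fun o _ => ball_stat_le o) eE.
- exact: l0.
- have : l <= 4^-1 by rewrite /l lef_pV2 ?posrE ?mulr_gt0//; lra.
  lra.
- by rewrite addr_ge0.
- rewrite -cardE -/n expr1n mulr1 card_option card_ord.
  have -> : 8 * l ^+ 2 * n%:R = 1 / 2.
    rewrite /l; move: s2 s0; move: (Num.sqrt n%:R) => t <- t0.
    by field; rewrite gt_eqF.
  have -> : d%:R + 2 = (d%:R + 1) + 1 :> R by ring.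
  rewrite [leRHS]expRD ler_pM ?expR_ge0//; last by rewrite ler_expR; lra.
  rewrite -natr1; apply: le_trans (expR_ge1Dx _); lra.
exists (fun w => M w / n%:R); split.
- exact: measurable_funM.
- by move=> w; rewrite divr_ge0// ltW.
- under eq_integral do rewrite EFinM muleC.
  rewrite ge0_integralZl//; [|exact/measurable_EFinP|by move=> w _; rewrite lee_fin].
  apply: le_trans (lee_wpmul2l _ ME) _; first by rewrite lee_fin invr_ge0 ltW.
  rewrite -EFinM lee_fin le_eqVlt; apply/orP; left; apply/eqP.
  rewrite /l -/n; move: s2 s0; move: (Num.sqrt n%:R) => t <- t0.
  by field; rewrite gt_eqF.
- move=> o w; rewrite ler_wpM2r ?invr_ge0 ?(ltW nR)//.
  by have := MS o w; rewrite big_enum.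
Qed.

Section dual_lower_bounds.
Variable K : nat.
Hypothesis K_gt0 : (0 < K)%N.
Variable nu : 'I_K -> probability T R.
Hypothesis nuB : forall k, nu k (@unit_ball R d) = 1%E.
Variable e : option 'I_d -> 'I_K -> R.
Hypothesis eE : forall o k, (\int[nu k]_x (ball_stat o x)%:E = (e o k)%:E)%E.

Let KR : 0 < K%:R :> R. Proof. by rewrite ltr0n. Qed.
Let sK : 0 < Num.sqrt K%:R :> R. Proof. by rewrite sqrtr_gt0. Qed.

Definition true_mean i : R := K%:R^-1 * \sum_k e (Some i) k.

Let int_stat o k : (nu k).-integrable setT (EFin \o ball_stat o).
Proof.
exact: bounded_integrable (measurable_ball_stat o) (ball_stat_le o).
Qed.

(** [F] itself cannot be integrated, so the measurable [g] replaces [h]. This violates the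
    constraint by eta / (K sqrt(K)) for each of the K potentials. *)
Lemma MW2sq_ge_dual (F h g : 'I_K -> T -> R) (C c : _ -> R) (b eg : 'I_K -> R)
    (eta : R) :
  (forall k x, F k x = C k + 2 / K%:R * (\sum_i c i * tnth x i)
     + (\sum_i tnth x i ^+ 2) / K%:R ^+ 2
     - h k x / (K%:R * Num.sqrt K%:R)) ->
  feasible F -> 0 <= eta ->
  (forall k, measurable_fun setT (g k)) -> (forall k x, `|g k x| <= b k) ->
  (forall k, \int[nu k]_x (g k x)%:E = (eg k)%:E)%E ->
  (forall k x, unit_ball x -> `|h k x - g k x| <= eta) ->
  ((\sum_k (C k + 2 / K%:R * (\sum_i c i * e (Some i) k) + e None k / K%:R ^+ 2
      - eg k / (K%:R * Num.sqrt K%:R)) - eta / Num.sqrt K%:R)%:E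
   <= MW2sq nu)%E.
Proof.
move=> FE fF eta0 mg gb geg hg.
pose F' k x := C k + 2 / K%:R * (\sum_i c i * ball_stat (Some i) x)
  + ball_stat None x / K%:R ^+ 2 - g k x / (K%:R * Num.sqrt K%:R).
have mF' k : measurable_fun setT (F' k).
  apply: measurable_funB; last exact: measurable_funM.
  apply: measurable_funD; last first.
    by apply: measurable_funM => //; exact: measurable_ball_stat.
  apply: measurable_funD => //; apply: measurable_funM => //.
  apply: measurable_sum => i; apply: measurable_funM => //.
  exact: measurable_ball_stat.
pose bF k := `|C k| + `|2 / K%:R| * (\sum_i `|c i|) + (K%:R ^+ 2)^-1
  + b k / (K%:R * Num.sqrt K%:R).
have F'b k x : `|F' k x| <= \sum_k bF k.
  apply: le_trans (_ : bF k <= _); last first.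
    rewrite (bigD1 k)//= lerDl; apply: sumr_ge0 => l _.
    apply: addr_ge0; [apply: addr_ge0; [apply: addr_ge0|]|] => //.
    - by apply: mulr_ge0 => //; exact: sumr_ge0.
    - by rewrite divr_ge0 ?mulr_ge0// (le_trans _ (gb l x)).
  rewrite /F' /bF; apply: le_trans (ler_normB _ _) _; apply: lerD; last first.
    rewrite normrM normfV [`|K%:R * _|]gtr0_norm ?mulr_gt0//.
    by rewrite ler_wpM2r// invr_ge0 ltW// mulr_gt0.
  apply: le_trans (ler_normD _ _) _; apply: lerD; last first.
    rewrite normrM normfV [`|K%:R ^+ 2|]gtr0_norm ?exprn_gt0//.
    by rewrite ler_piMl ?ball_stat_le// invr_ge0 exprn_ge0// ltW.
  apply: le_trans (ler_normD _ _) _; rewrite lerD2l normrM ler_wpM2l//.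
  apply: le_trans (ler_norm_sum _ _ _) _; apply: ler_sum => i _.
  by rewrite normrM ler_piMr// ball_stat_le.
apply: (@MW2sq_ge _ _ _ K_gt0 nu F' _ _ (fun k => C k
   + 2 / K%:R * (\sum_i c i * e (Some i) k) + e None k / K%:R ^+ 2
   - eg k / (K%:R * Num.sqrt K%:R)) nuB mF' F'b).
- by rewrite divr_ge0// ltW.
- move=> k; rewrite /F'.
  have i1 i : (nu k).-integrable setT (fun x => (c i)%:E * (ball_stat (Some i) x)%:E)%E.
    by apply: integrableZl => //; exact: int_stat.
  have i2 : (nu k).-integrable setT
      (fun x => \sum_i ((c i)%:E * (ball_stat (Some i) x)%:E))%E.
    by apply: integrable_sum => // i _; exact: i1.
  have i3 : (nu k).-integrable setT (fun x =>
     (2 / K%:R)%:E * \sum_i ((c i)%:E * (ball_stat (Some i) x)%:E))%E.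
    exact: integrableZl.
  have i4 : (nu k).-integrable setT (fun x => (K%:R ^- 2)%:E * (ball_stat None x)%:E)%E.
    by apply: integrableZl => //; exact: int_stat.
  have i5 : (nu k).-integrable setT
      (fun x => (- (K%:R * Num.sqrt K%:R)^-1)%:E * (g k x)%:E)%E.
    by apply: integrableZl => //; exact: bounded_integrable (mg k) (gb k).
  have i0 : (nu k).-integrable setT (fun=> (C k)%:E).
    exact: finite_measure_integrable_cst.
  transitivity (\int[nu k]_x ((C k)%:E
     + (2 / K%:R)%:E * (\sum_i ((c i)%:E * (ball_stat (Some i) x)%:E))
     + (K%:R ^- 2)%:E * (ball_stat None x)%:E
     + (- (K%:R * Num.sqrt K%:R)^-1)%:E * (g k x)%:E))%E.
    apply: eq_integral => x _.
    under [in RHS]eq_bigr do rewrite -EFinM.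
    rewrite sumEFin -!EFinM -!EFinD; congr EFin.
    by rewrite mulNr [K%:R ^- 2 * _]mulrC [_^-1 * g k x]mulrC.
  have i03 := integrableD measurableT i0 i3.
  have i034 := integrableD measurableT i03 i4.
  rewrite (integralD measurableT i034 i5) (integralD measurableT i03 i4).
  rewrite (integralD measurableT i0 i3).
  rewrite integral_cst// [X in (_ * X)%E]probability_setT mule1.
  rewrite !integralZl//; [|exact: bounded_integrable (mg k) (gb k)|exact: int_stat].
  rewrite integral_sum// geg eE.
  rewrite (eq_bigr (fun i => (c i * e (Some i) k)%:E)); last first.
    by move=> i _; rewrite (integralZl _ (int_stat _ k))// eE EFinM.
  rewrite sumEFin -!EFinM -!EFinD; congr EFin.
  by rewrite mulNr [K%:R ^- 2 * _]mulrC [_^-1 * eg k]mulrC.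
- move=> y yB; have := fF y yB.
  suff : \sum_k F' k (y k) <= \sum_k F k (y k)
      + \sum_(k < K) eta / (K%:R * Num.sqrt K%:R).
    rewrite sumr_const card_ord -[_ *+ K]mulr_natl.
    have -> : K%:R * (eta / (K%:R * Num.sqrt K%:R)) = eta / Num.sqrt K%:R.
      by field; rewrite !gt_eqF.
    lra.
  rewrite -big_split; apply: ler_sum => k _ /=; rewrite /F' FE.
  rewrite (ball_stat_sqr (yB k)).
  under eq_bigr do rewrite (ball_stat_coord _ (yB k)).
  have := hg k _ (yB k); rewrite ler_norml => /andP[_ hgk].
  have : (h k (y k) - g k (y k)) / (K%:R * Num.sqrt K%:R)
      <= eta / (K%:R * Num.sqrt K%:R).
    by rewrite ler_wpM2r// invr_ge0 ltW// mulr_gt0.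
  rewrite mulrBl; lra.
Qed.

(** Jensen's inequality as a case of weak duality: the potentials add up to the tangent plane of the
    squared norm at [true_mean]. *)
Lemma MW2sq_ge_mean : ((\sum_i true_mean i ^+ 2)%:E <= MW2sq nu)%E.
Proof.
(* With [h] equal to q |x|^2, the last term in the form required by [MW2sq_ge_dual] cancels the
   quadratic one. *)
pose q : R := Num.sqrt K%:R / K%:R.
have q0 : 0 <= q by rewrite divr_ge0// ltW.
have qE (x : R) : x * q / (K%:R * Num.sqrt K%:R) = x / K%:R ^+ 2.
  by rewrite /q; field; rewrite !gt_eqF.
pose F (k : 'I_K) (x : T) : R := - (\sum_i true_mean i ^+ 2) / K%:R
  + 2 / K%:R * (\sum_i true_mean i * tnth x i).
have := @MW2sq_ge_dual F (fun _ x => (\sum_i tnth x i ^+ 2) * q)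
  (fun _ x => ball_stat None x * q) (fun=> - (\sum_i true_mean i ^+ 2) / K%:R)
  true_mean (fun=> q) (fun k => e None k * q) 0.
set B := (X in (X%:E <= _)%E) => H.
have <- : B = \sum_i true_mean i ^+ 2.
  rewrite /B mul0r subr0; under eq_bigr do rewrite qE addrK.
  rewrite big_split/= sumr_const card_ord -[_ *+ K]mulr_natl -mulr_sumr exchange_big/=.
  rewrite mulrC mulfVK ?gt_eqF//.
  have -> : 2 / K%:R * (\sum_i \sum_k true_mean i * e (Some i) k) =
      2 * \sum_i true_mean i ^+ 2.
    rewrite -[LHS]mulrA; congr (_ * _); rewrite mulr_sumr; apply: eq_bigr => i _.
    by rewrite -mulr_sumr mulrCA -/(true_mean i) expr2.
  ring.
apply: H => //.
- by move=> k x; rewrite qE addrK.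
- move=> y _; rewrite big_split/= sumr_const card_ord -[_ *+ K]mulr_natl -mulr_sumr.
  rewrite exchange_big/= mulrC mulfVK ?gt_eqF//.
  have -> : 2 / K%:R * (\sum_i \sum_k true_mean i * tnth (y k) i) =
      2 * \sum_i true_mean i * mean_coord y i.
    rewrite -[LHS]mulrA; congr (_ * _); rewrite mulr_sumr; apply: eq_bigr => i _.
    by rewrite -mulr_sumr mulrCA.
  have : 0 <= \sum_i (mean_coord y i - true_mean i) ^+ 2.
    by apply: sumr_ge0 => i _; exact: sqr_ge0.
  have -> : \sum_i (mean_coord y i - true_mean i) ^+ 2 = cost y
      - 2 * (\sum_i true_mean i * mean_coord y i) + \sum_i true_mean i ^+ 2.
    rewrite /cost mulr_sumr -sumrB -big_split; apply: eq_bigr => i _ /=; ring.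
  lra.
- by move=> k; apply: measurable_funM => //; exact: measurable_ball_stat.
- by move=> k x; rewrite normrM (ger0_norm q0) ler_piMl// ball_stat_le.
- move=> k; under eq_integral do rewrite EFinM muleC.
  by rewrite (integralZl _ (int_stat _ k))// eE -EFinM mulrC.
- by move=> k x xB; rewrite ball_stat_sqr// subrr normr0.
Qed.
End dual_lower_bounds.
End lower_bounds.

(** * One sample: its dual value against both optimal costs *)

Section comparison.
Context {R : realType} {d K m : nat}.
Local Notation T := (d.-tuple R).
Hypotheses (K_gt0 : (0 < K)%N) (m_gt0 : (0 < m)%N).
Variable z : 'I_K -> 'I_m -> T.
Hypothesis zB : forall k t, unit_ball (z k t).
Variables (F h : 'I_K -> T -> R) (C : 'I_K -> R).
Hypothesis FE : forall k x, F k x = C k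
  + 2 / K%:R * (\sum_i sample_mean z i * tnth x i)
  + (\sum_i tnth x i ^+ 2) / K%:R ^+ 2 - h k x / (K%:R * Num.sqrt K%:R).
Hypotheses (fF : feasible F)
  (Fle : sample_value z F <= \sum_i sample_mean z i ^+ 2 + 4 / K%:R).
Variables (g : 'I_K -> T -> R) (b : 'I_K -> R) (eta : R).
Hypotheses (eta0 : 0 <= eta) (mg : forall k, measurable_fun setT (g k))
  (gb : forall k x, `|g k x| <= b k)
  (hg : forall k x, unit_ball x -> `|h k x - g k x| <= eta).

Let KR : 0 < K%:R :> R. Proof. by rewrite ltr0n. Qed.
Let mR : 0 < m%:R :> R. Proof. by rewrite ltr0n. Qed.
Let sK : 0 < Num.sqrt K%:R :> R. Proof. by rewrite sqrtr_gt0. Qed.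

Definition avg (f : T -> R) k : R := (\sum_t f (z k t)) / m%:R.

Lemma sample_mean_stat i : sample_mean z i = true_mean (fun o => avg (ball_stat o)) i.
Proof.
rewrite /sample_mean /true_mean; congr (_ * _); apply: eq_bigr => k _.
by congr (_ / _); apply: eq_bigr => t _; rewrite ball_stat_coord.
Qed.

Lemma sample_value_dual : sample_value z F <=
  \sum_k (C k + 2 / K%:R * (\sum_i sample_mean z i * avg (ball_stat (Some i)) k)
    + avg (ball_stat None) k / K%:R ^+ 2 - avg (g k) k / (K%:R * Num.sqrt K%:R))
  + eta / Num.sqrt K%:R.
Proof.
have -> : eta / Num.sqrt K%:R = \sum_(k < K) eta / (K%:R * Num.sqrt K%:R).
  rewrite sumr_const card_ord -[eta / _ *+ K]mulr_natl.
  by field; rewrite !gt_eqF.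
rewrite -big_split; apply: ler_sum => k _ /=.
rewrite ler_pdivrMr//.
have -> : (C k + 2 / K%:R * (\sum_i sample_mean z i * avg (ball_stat (Some i)) k)
    + avg (ball_stat None) k / K%:R ^+ 2 - avg (g k) k / (K%:R * Num.sqrt K%:R)
    + eta / (K%:R * Num.sqrt K%:R)) * m%:R =
  \sum_t (C k + 2 / K%:R * (\sum_i sample_mean z i * ball_stat (Some i) (z k t))
    + ball_stat None (z k t) / K%:R ^+ 2 - g k (z k t) / (K%:R * Num.sqrt K%:R)
    + eta / (K%:R * Num.sqrt K%:R)).
  have avgm f : avg f k * m%:R = \sum_t f (z k t) by rewrite /avg mulfVK // gt_eqF.
  rewrite !big_split/= sumrN !sumr_const card_ord -!mulr_suml -mulr_sumr exchange_big/=.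
  have -> : \sum_i \sum_t sample_mean z i * ball_stat (Some i) (z k t) =
      (\sum_i sample_mean z i * avg (ball_stat (Some i)) k) * m%:R.
    by rewrite mulr_suml; apply: eq_bigr => i _; rewrite -mulr_sumr -avgm mulrA.
  rewrite -[C k *+ m]mulr_natr -[eta / _ *+ m]mulr_natr -!avgm; ring.
apply: ler_sum => t _; rewrite FE ball_stat_sqr//.
under [in leRHS]eq_bigr do rewrite ball_stat_coord//.
have := hg k (zB k t); rewrite ler_norml => /andP[hgk _].
have : (g k (z k t) - h k (z k t)) / (K%:R * Num.sqrt K%:R)
    <= eta / (K%:R * Num.sqrt K%:R).
  apply: ler_wpM2r; last lra.
  by rewrite invr_ge0 ltW// mulr_gt0.
rewrite mulrBl; lra.
Qed.

Let emp k : probability T R := empirical R m_gt0 (z k).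

Let emp_ball k : emp k (@unit_ball R d) = 1%E.
Proof.
rewrite /emp /= /empirical (eq_bigr (fun=> (1 : R)%:E)); last first.
  by move=> t _; rewrite diracE mem_set.
by rewrite sumEFin sumr_const card_ord -EFinM mulVf// gt_eqF.
Qed.

Let emp_int (f : T -> R) (c : R) : measurable_fun setT f -> (forall x, `|f x| <= c) ->
  forall k, (\int[emp k]_x (f x)%:E = (avg f k)%:E)%E.
Proof. by move=> mf fc k; exact: integral_empirical fc. Qed.

Let emp_stat o k : (\int[emp k]_x (ball_stat o x)%:E = (avg (ball_stat o) k)%:E)%E.
Proof.
by apply: emp_int; [exact: measurable_ball_stat|exact: ball_stat_le].
Qed.

Lemma MW2sq_empirical_ge :
  ((sample_value z F - 4 / K%:R)%:E <= MW2sq emp)%E.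
Proof.
apply: le_trans (MW2sq_ge_mean K_gt0 emp_ball emp_stat).
rewrite lee_fin lerBlDr; apply: le_trans Fle _; rewrite lerD2r.
by rewrite le_eqVlt; apply/orP; left; apply/eqP;
   apply: eq_bigr => i _; rewrite sample_mean_stat.
Qed.

(** Weak duality, with [eta / sqrt(K)] paid twice: for evaluating the sample averages with [g]
    instead of [h], and for the constraint. *)
Lemma MW2sq_empirical_ge_entropy :
  ((sample_value z F - 2 * (eta / Num.sqrt K%:R))%:E <= MW2sq emp)%E.
Proof.
have H := MW2sq_ge_dual K_gt0 emp_ball emp_stat FE fF eta0 mg gb
  (fun k => emp_int (mg k) (gb k) k) hg.
apply: le_trans H; rewrite lee_fin; have := sample_value_dual; lra.
Qed.

Variable mu : 'I_K -> probability T R.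
Hypothesis muB : forall k, mu k (@unit_ball R d) = 1%E.
Variable e : option 'I_d -> 'I_K -> R.
Hypothesis eE : forall o k, (\int[mu k]_x (ball_stat o x)%:E = (e o k)%:E)%E.
Variable M1 : R.
Hypothesis M1P : forall o,
  `|\sum_t \sum_k (ball_stat o (z k t) - e o k)| / (m * K)%:R <= M1.

Let M1_ge0 : 0 <= M1.
Proof. by apply: le_trans (M1P None); rewrite divr_ge0. Qed.

Let stat_close o :
  `|K%:R^-1 * (\sum_k avg (ball_stat o) k) - K%:R^-1 * \sum_k e o k| <= M1.
Proof.
apply: le_trans (M1P o); rewrite le_eqVlt; apply/orP; left; apply/eqP.
rewrite -[(m * K)%:R]gtr0_norm ?ltr0n ?muln_gt0 ?m_gt0// -normf_div; congr `|_|.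
rewrite exchange_big/= -mulrBr -sumrB [in RHS]mulr_suml mulr_sumr.
apply: eq_bigr => k _; rewrite sumrB sumr_const card_ord -[_ *+ m]mulr_natl /avg natrM.
by field; rewrite !gt_eqF.
Qed.

Let avg_stat_le o k : `|avg (ball_stat o) k| <= 1.
Proof.
rewrite /avg normrM normfV (gtr0_norm mR) ler_pdivrMr// mul1r.
apply: le_trans (ler_norm_sum _ _ _) _.
apply: le_trans (ler_sum _ (fun t _ => ball_stat_le o (z k t))) _.
by rewrite sumr_const card_ord.
Qed.

Let e_le o k : `|e o k| <= 1.
Proof.
rewrite -lee_fin -abse_EFin -eE.
apply: le_trans (le_abse_integral _ _ _) _ => //.
  by apply/measurable_EFinP; exact: measurable_ball_stat.
apply: le_trans (_ : \int[mu k]_w (cst 1%:E) w <= _)%E.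
  apply: ge0_le_integral => //.
    by apply/measurable_EFinP/measurableT_comp => //; exact: measurable_ball_stat.
  by move=> x _; rewrite lee_fin ball_stat_le.
by rewrite integral_cst// [X in (_ * X)%E]probability_setT mule1.
Qed.

Let mean_le1 (f : 'I_K -> R) : (forall k, `|f k| <= 1) ->
  `|K%:R^-1 * \sum_k f k| <= 1.
Proof.
move=> f1; rewrite normrM normfV (gtr0_norm KR) mulrC ler_pdivrMr// mul1r.
apply: le_trans (ler_norm_sum _ _ _) _.
apply: le_trans (ler_sum _ (fun k _ => f1 k)) _.
by rewrite sumr_const card_ord.
Qed.

Let mean_close i : `|sample_mean z i - true_mean e i| <= M1.
Proof. by rewrite sample_mean_stat; exact: stat_close. Qed.

Let sample_mean_le1 i : `|sample_mean z i| <= 1.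
Proof. by rewrite sample_mean_stat; exact: mean_le1 (avg_stat_le _). Qed.

Let true_mean_le1 i : `|true_mean e i| <= 1.
Proof. exact: mean_le1 (e_le _). Qed.

(** Both means have coordinates at most 1, so their squared norms differ by at most 2 d times the
    deviation [M1]. *)
Lemma MW2sq_true_ge :
  ((sample_value z F - (2 * d + 1)%:R * M1 - 4 / K%:R)%:E <= MW2sq mu)%E.
Proof.
apply: le_trans (MW2sq_ge_mean K_gt0 muB eE); rewrite lee_fin.
have : \sum_i sample_mean z i ^+ 2 - \sum_i true_mean e i ^+ 2 <= d%:R * (2 * M1).
  rewrite -sumrB; apply: sum_le_const => i.
  apply: le_trans (ler_norm _) _; rewrite subr_sqr normrM mulrC.
  apply: ler_pM; rewrite ?normr_ge0 ?mean_close//; apply: le_trans (ler_normD _ _) _.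
  by rewrite -[2]/(1 + 1); apply: lerD; [exact: sample_mean_le1|exact: true_mean_le1].
by move: Fle M1_ge0; rewrite natrD natrM; lra.
Qed.

Variables (eg Mg : 'I_K -> R).
Hypothesis egE : forall k, (\int[mu k]_x (g k x)%:E = (eg k)%:E)%E.
Hypothesis MgP : forall k, `|avg (g k) k - eg k| <= Mg k.

(** The same potentials are evaluated on the sample and on [mu]. The linear parts differ by 2 <z, z
    - true mean>, at most 2 d M1, with z the sample mean; the quadratic parts by at most M1 / K; the
    approximated profiles by the [Mg]. *)
Lemma MW2sq_true_ge_entropy :
  ((sample_value z F - (2 * d + 1)%:R * M1 - (2 * (eta / Num.sqrt K%:R)
     + (\sum_k Mg k) / (K%:R * Num.sqrt K%:R)))%:E <= MW2sq mu)%E.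
Proof.
apply: le_trans (MW2sq_ge_dual K_gt0 muB eE FE fF eta0 mg gb egE hg).
rewrite lee_fin.
have h1 := sample_value_dual.
have h2 : \sum_k (eg k - avg (g k) k) / (K%:R * Num.sqrt K%:R) <=
    (\sum_k Mg k) / (K%:R * Num.sqrt K%:R).
  rewrite -mulr_suml; apply: ler_wpM2r; first by rewrite invr_ge0 ltW// mulr_gt0.
  apply: ler_sum => k _; have := MgP k; rewrite ler_norml => /andP[? _]; lra.
have h3 : 2 * \sum_i sample_mean z i * (sample_mean z i - true_mean e i)
    <= d%:R * (2 * M1).
  rewrite mulr_sumr; apply: sum_le_const => i; rewrite ler_pM2l//.
  apply: le_trans (ler_norm _) _; rewrite normrM -[leRHS]mul1r.
  by apply: ler_pM; rewrite ?normr_ge0 ?sample_mean_le1 ?mean_close.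
have h4 : K%:R^-1 * (K%:R^-1 * (\sum_k avg (ball_stat None) k)
    - K%:R^-1 * \sum_k e None k) <= M1.
  apply: le_trans (ler_norm _) _; rewrite normrM -[leRHS]mul1r.
  apply: ler_pM; rewrite ?stat_close//.
  by rewrite gtr0_norm ?invr_gt0// invf_le1// ler1n.
have h5 : 2 * \sum_i sample_mean z i * (sample_mean z i - true_mean e i) =
    \sum_k (2 / K%:R * (\sum_i sample_mean z i * avg (ball_stat (Some i)) k)
           - 2 / K%:R * (\sum_i sample_mean z i * e (Some i) k)).
  rewrite sumrB -!mulr_sumr exchange_big [X in _ = _ - 2 / K%:R * X]exchange_big/=.
  rewrite -mulrBr -sumrB -mulrA; congr (_ * _); rewrite mulr_sumr.
  apply: eq_bigr => i _; rewrite {2}sample_mean_stat /true_mean -!mulr_sumr.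
  by rewrite -mulrBr -[in RHS]mulrBr mulrCA mulrBr.
have h6 : K%:R^-1 * (K%:R^-1 * (\sum_k avg (ball_stat None) k)
    - K%:R^-1 * \sum_k e None k) =
    \sum_k (avg (ball_stat None) k / K%:R ^+ 2 - e None k / K%:R ^+ 2).
  rewrite -mulrBr -sumrB !mulr_sumr; apply: eq_bigr => k _.
  by field; rewrite gt_eqF.
have : \sum_k (C k + 2 / K%:R * (\sum_i sample_mean z i * avg (ball_stat (Some i)) k)
      + avg (ball_stat None) k / K%:R ^+ 2 - avg (g k) k / (K%:R * Num.sqrt K%:R))
    - \sum_k (C k + 2 / K%:R * (\sum_i sample_mean z i * e (Some i) k)
      + e None k / K%:R ^+ 2 - eg k / (K%:R * Num.sqrt K%:R)) =
    2 * \sum_i sample_mean z i * (sample_mean z i - true_mean e i)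
    + K%:R^-1 * (K%:R^-1 * (\sum_k avg (ball_stat None) k)
    - K%:R^-1 * \sum_k e None k)
    + \sum_k (eg k - avg (g k) k) / (K%:R * Num.sqrt K%:R).
  rewrite h5 h6 -sumrB -!big_split; apply: eq_bigr => k _ /=; ring.
move: h1 h2 h3 h4; rewrite natrD natrM; lra.
Qed.
End comparison.

(** * Bounding integrals of functions not known to be measurable *)

Lemma le_integral_nonmeasurable {R : realType} {dO : measure_display}
    {Omega : measurableType dO} (P : {measure set Omega -> \bar R})
    (f g : Omega -> \bar R) :
  (forall w, 0 <= f w)%E -> (forall w, f w <= g w)%E ->
  (\int[P]_w f w <= \int[P]_w g w)%E.
Proof.
(* As a supremum over simple functions below the integrand, the integral is monotone whether or not
   the integrand is measurable. *)
move=> f0 fg; rewrite !ge0_integralTE//; last by move=> w; exact: le_trans (fg w).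
apply: le_ereal_sup => _ [h hf <-]; exists h => // w.
exact: le_trans (hf w) (fg w).
Qed.

(** Everywhere [f] is below [g] made infinite on [N], which is measurable and has the integral of
    [g]. *)
Lemma le_integral_off_null {R : realType} {dO : measure_display}
    {Omega : measurableType dO} (P : {measure set Omega -> \bar R})
    (N : set Omega) (f : Omega -> \bar R) (g : Omega -> R) :
  measurable N -> P N = 0%E -> measurable_fun setT g -> (forall w, 0 <= g w) ->
  (forall w, 0 <= f w)%E -> (forall w, ~ N w -> f w <= (g w)%:E)%E ->
  (\int[P]_w f w <= \int[P]_w (g w)%:E)%E.
Proof.
move=> mN PN mg g0 f0 fg.
pose u w : \bar R := ((g w)%:E + +oo * (\1_N w)%:E)%E.
have uN w : N w -> u w = +oo%E.
  by move=> Nw; rewrite /u indicE mem_set// mule1 addey.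
have uNN w : ~ N w -> u w = (g w)%:E.
  by move=> Nw; rewrite /u indicE memNset// mule0 adde0.
have u0 w : (0 <= u w)%E.
  by case: (pselect (N w)) => [/uN ->//|/uNN ->]; rewrite lee_fin.
apply: le_trans (_ : \int[P]_w u w <= _)%E.
  apply: le_integral_nonmeasurable => // w.
  by case: (pselect (N w)) => [/uN ->|Nw]; [exact: leey|rewrite uNN// fg].
rewrite le_eqVlt; apply/orP; left; apply/eqP.
apply: ge0_ae_eq_integral => //.
- apply: emeasurable_funD; first exact/measurable_EFinP.
  by apply: emeasurable_funM => //; apply/measurable_EFinP; exact: measurable_indic.
- exact/measurable_EFinP.
- by move=> w _; rewrite lee_fin.
- exists N; split=> // w /= h; apply: contrapT => Nw; apply: h => _.
  exact: uNN.
Qed.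

Lemma integral_affine_le {R : realType} {dO : measure_display}
    {Omega : measurableType dO} (P : probability Omega R) (f g : Omega -> R)
    (k a b F G : R) : 0 <= k -> 0 <= a -> 0 <= b ->
  measurable_fun setT f -> (forall w, 0 <= f w) ->
  measurable_fun setT g -> (forall w, 0 <= g w) ->
  (\int[P]_w (f w)%:E <= F%:E)%E -> (\int[P]_w (g w)%:E <= G%:E)%E ->
  (\int[P]_w (a * f w + b * g w + k)%:E <= (a * F + b * G + k)%:E)%E.
Proof.
move=> k0 a0 b0 mf f0 mg g0 fF gG.
have Z (l H : R) (h : Omega -> R) : 0 <= l -> measurable_fun setT h ->
    (forall w, 0 <= h w) -> (\int[P]_w (h w)%:E <= H%:E)%E ->
    (\int[P]_w (l * h w)%:E <= (l * H)%:E)%E.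
  move=> l0 mh h0 hH; under eq_integral do rewrite EFinM.
  rewrite ge0_integralZl//; [|exact/measurable_EFinP|by move=> w _; rewrite lee_fin].
  by rewrite EFinM lee_wpmul2l.
have D (h1 h2 : Omega -> R) : measurable_fun setT h1 -> (forall w, 0 <= h1 w) ->
    measurable_fun setT h2 -> (forall w, 0 <= h2 w) ->
    (\int[P]_w (h1 w + h2 w)%:E = \int[P]_w (h1 w)%:E + \int[P]_w (h2 w)%:E)%E.
  move=> mh1 h10 mh2 h20; under eq_integral do rewrite EFinD.
  by rewrite ge0_integralD//;
    (exact/measurable_EFinP || by move=> w _; rewrite lee_fin).
have maf : measurable_fun setT (fun w => a * f w) by exact: measurable_funM.
have mbg : measurable_fun setT (fun w => b * g w) by exact: measurable_funM.
rewrite D//; last 2 first.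
- exact: measurable_funD.
- by move=> w; rewrite addr_ge0 ?mulr_ge0.
rewrite D//; last 2 first.
- by move=> w; rewrite mulr_ge0.
- by move=> w; rewrite mulr_ge0.
rewrite integral_cst// [X in (_ * X)%E]probability_setT mule1 !EFinD.
by apply: leeD => //; apply: leeD; exact: Z.
Qed.

(** * From pointwise dual bounds to the expected error *)

Section expected_error.
Context {R : realType} {d K m : nat}.
Context {dO : measure_display} {Omega : measurableType dO}.
Local Notation T := (d.-tuple R).
Hypotheses (K_gt0 : (0 < K)%N) (m_gt0 : (0 < m)%N).
Variables (P : probability Omega R) (Y : 'I_K -> 'I_m -> Omega -> T).
Hypothesis mY : forall k t, measurable_fun setT (Y k t).
Variable mu : 'I_K -> probability T R.
Hypothesis Y_law : forall k t A, measurable A -> P (Y k t @^-1` A) = mu k A.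
Hypothesis muB : forall k, mu k (@unit_ball R d) = 1%E.
Variables (M1 T1 : Omega -> R) (c m1 t1 : R).
Hypotheses (c0 : 0 <= c) (mM1 : measurable_fun setT M1) (M10 : forall w, 0 <= M1 w)
  (mT1 : measurable_fun setT T1) (T10 : forall w, 0 <= T1 w).
Hypotheses (M1_int : (\int[P]_w (M1 w)%:E <= m1%:E)%E)
  (T1_int : (\int[P]_w (T1 w)%:E <= t1%:E)%E).

Let z w := sample Y w.
Let emp w k : probability T R := empirical R m_gt0 (z w k).

(** The common interface of the two estimates: [T1] is the constant 4/K when Jensen's inequality is
    used, and the approximation and chaining error otherwise. *)
Hypothesis dual_error : forall w, (forall k t, unit_ball (Y k t w)) ->
  forall (F h : 'I_K -> T -> R) (C : 'I_K -> R),
  (forall k x, F k x = C k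
     + 2 / K%:R * (\sum_i sample_mean (z w) i * tnth x i)
     + (\sum_i tnth x i ^+ 2) / K%:R ^+ 2 - h k x / (K%:R * Num.sqrt K%:R)) ->
  (forall k, convex_lip 8 (h k)) -> feasible F ->
  sample_value (z w) F <= \sum_i sample_mean (z w) i ^+ 2 + 4 / K%:R ->
  ((sample_value (z w) F - T1 w)%:E <= MW2sq (emp w))%E /\
  ((sample_value (z w) F - c * M1 w - T1 w)%:E <= MW2sq mu)%E.

Let exceptional : exists N, [/\ measurable N, P N = 0%E &
  forall w, ~ N w -> forall k t, unit_ball (Y k t w)].
Proof.
have mB := @measurable_unit_ball R d.
have [||N [mN N0 YN]] := @null_cover R _ _ P ('I_K * 'I_m)%type
    (fun kt => Y kt.1 kt.2 @^-1` (~` @unit_ball R d)).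
- move=> kt; rewrite -[_ @^-1` _]setTI; apply: mY => //; exact: measurableC.
- move=> kt; rewrite [LHS]Y_law; last exact: measurableC.
  by rewrite probability_setC// muB subee.
exists N; split=> // w nN k t; apply: contrapT => nB; apply: nN.
exact: (YN (k, t)).
Qed.

Let cost_le_dim w s : (forall k t, unit_ball (Y k t w)) ->
  cost (select (z w) s) <= d%:R.
Proof.
move=> YB; apply: le_trans (sum_le_const (c := 1) _) _; last by rewrite mulr1.
move=> i; rewrite -[leRHS](expr1n _ 2); apply: sqr_le_sqr.
rewrite /mean_coord normrM normfV (gtr0_norm (_ : 0 < K%:R))// ?ltr0n//.
rewrite mulrC ler_pdivrMr ?ltr0n// mul1r.
apply: le_trans (ler_norm_sum _ _ _) _.
apply: le_trans (ler_sum _ (fun k _ => unit_ball_coord i (YB k (s k)))) _.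
by rewrite sumr_const card_ord.
Qed.

(** The measurable minimum [Me] over a net of plans stands for the sampled cost, from which it
    differs by at most [T1] plus a small error. Hence 3 t1: twice from the bound on |Me - MW2sq mu|
    and once from this replacement. *)
Lemma expected_error_le :
  (\int[P]_w `|MW2sq (emp w) - MW2sq mu| <= (2 * c * m1 + 3 * t1)%:E)%E.
Proof.
have [N [mN N0 YB]] := exceptional.
apply/lee_addgt0Pr => eps' eps'0.
(* Four [eps] are spent in [W_int] and two on replacing the sampled cost by [Me]. *)
pose eps := eps' / 6; have eps0 : 0 < eps by rewrite divr_gt0.
pose S : R := #|{ffun 'I_K -> 'I_m}|%:R * d%:R.
have S0 : 0 <= S by rewrite mulr_ge0.
have S10 : 0 < S + 1 by rewrite ltr_wpDl.
(* A change of at most eps / (S + 1) in every weight moves the cost of a plan by at most [eps], each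
   tuple costing at most [d]. *)
have [p [G [Gp Gnet]]] := plan_net K_gt0 m_gt0 (divr_gt0 eps0 S10).
pose Me w := running_min (fun j => plan_cost Y (G j) w) p.
have mMe : measurable_fun setT Me.
  by apply: measurable_running_min => j; exact: measurable_plan_cost.
have Me0 w : 0 <= Me w.
  by rewrite /Me; have [j _ <-] := running_min_attained
    (fun j => plan_cost Y (G j) w) p; exact: plan_cost_ge0.
have Me_le w : ~ N w -> Me w <= d%:R.
  move=> /YB wB; apply: le_trans (running_min_le _ (leq0n p)) _.
  apply: le_trans (_ : \sum_s G 0%N s * d%:R <= _).
    by apply: ler_sum => s _; rewrite ler_wpM2l ?(Gp 0%N).1// cost_le_dim.
  by rewrite -mulr_suml (plan_sum1 K_gt0 m_gt0 (Gp 0%N)) mul1r.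
have Me_int : (\int[P]_w (Me w)%:E <= (d%:R : R)%:E)%E.
  apply: le_trans (_ : \int[P]_w (d%:R : R)%:E <= _)%E.
    exact: (le_integral_off_null (g := fun=> d%:R) mN N0).
  by rewrite integral_cst// [X in (_ * X)%E]probability_setT mule1.
have mu_Me : (MW2sq mu <= \int[P]_w (Me w)%:E)%E.
  exact: (MW2sq_le_average K_gt0 m_gt0 mY Y_law p Gp).
have [w0 muE] : exists w0, MW2sq mu = w0%:E.
  exists (fine (MW2sq mu)); rewrite fineK// ge0_fin_numE ?MW2sq_ge0//.
  by apply: le_lt_trans mu_Me (le_lt_trans Me_int (ltry _)).
have [Ie IeE] : exists Ie, (\int[P]_w (Me w)%:E = Ie%:E)%E.
  exists (fine (\int[P]_w (Me w)%:E)%E); rewrite fineK// ge0_fin_numE.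
    exact: le_lt_trans Me_int (ltry _).
  by apply: integral_ge0 => w _; rewrite lee_fin.
have w00 : 0 <= w0 by rewrite -lee_fin -muE MW2sq_ge0.
have main w : ~ N w -> exists x, [/\ MW2sq (emp w) = x%:E,
    x <= Me w, Me w - T1 w - 2 * eps <= x &
    Me w - w0 <= c * M1 w + T1 w + 2 * eps].
  move=> /YB wB.
  have [g [gp gd]] := sample_potentials K_gt0 m_gt0 wB.
  have [F [C [h [FE hl fF gF Fle]]]] := gd _ eps0.
  have [empT muT] := dual_error wB FE hl fF Fle.
  have emp_le j : (MW2sq (emp w) <= (plan_cost Y (G j) w)%:E)%E.
    exact: MW2sq_empirical_le.
  have MeV : Me w <= sample_value (z w) F + 2 * eps.
    have [j jp Gg] := Gnet g gp.
    apply: le_trans (running_min_le _ jp) _.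
    have : plan_cost Y (G j) w <= \sum_s g s * cost (select (z w) s)
        + \sum_(s : {ffun 'I_K -> 'I_m}) (eps / (S + 1)) * d%:R.
      rewrite /plan_cost -/(z w) -big_split; apply: ler_sum => s _ /=.
      have := ler_wpM2r (cost_ge0 (select (z w) s))
        (le_trans (ler_norm _) (Gg s)).
      have := ler_wpM2l (ltW (divr_gt0 eps0 S10)) (cost_le_dim s wB).
      rewrite mulrBl; lra.
    rewrite sumr_const -[eps / _ * _ *+ _]mulr_natl mulrCA -/S.
    have : eps / (S + 1) * S <= eps.
      by rewrite mulrAC ler_pdivrMr// ler_pM2l// lerDl.
    lra.
  have [j jp MeE] := running_min_attained (fun j => plan_cost Y (G j) w) p.
  exists (fine (MW2sq (emp w))).
  have xE : MW2sq (emp w) = (fine (MW2sq (emp w)))%:E.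
    rewrite fineK// ge0_fin_numE ?MW2sq_ge0//.
    exact: le_lt_trans (emp_le j) (ltry _).
  split => //.
  - by rewrite -lee_fin -xE /Me -MeE.
  - by rewrite -lee_fin -xE; apply: le_trans empT; rewrite lee_fin; lra.
  - by move: muT; rewrite muE lee_fin; lra.
pose W w := `|Me w - w0|.
have mW : measurable_fun setT W.
  by apply: measurableT_comp => //; exact: measurable_funB.
have W0 w : 0 <= W w by exact: normr_ge0.
(* With t = Me - w0, |t| + t is twice the positive part, which the last clause of [main] bounds.
   Integrating, and using that [mu_Me] makes the mean of t nonnegative, leaves the bound on |t|;
   [Me] is moved to the left so that all integrands are nonnegative. *)
have W_int : (\int[P]_w (W w)%:E <= (2 * c * m1 + 2 * t1 + 4 * eps)%:E)%E.
  have : (\int[P]_w (W w + Me w)%:E <=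
      \int[P]_w (2 * c * M1 w + 2 * T1 w + (4 * eps + w0))%:E)%E.
    apply: (le_integral_off_null mN N0).
    - apply: measurable_funD => //; apply: measurable_funD; exact: measurable_funM.
    - move=> w; have := mulr_ge0 c0 (M10 w); have := T10 w; lra.
    - by move=> w; rewrite lee_fin; apply: addr_ge0 => //; exact: normr_ge0.
    - move=> w /main[x [_ _ _ Mw]]; rewrite lee_fin /W.
      have := mulr_ge0 c0 (M10 w); have := T10 w.
      by case: (ger0P (Me w - w0)) => _; lra.
  have Wi := integral_affine_le (addr_ge0 (mulr_ge0 (ler0n R 4) (ltW eps0)) w00)
    (mulr_ge0 (ler0n R 2) c0) (ler0n R 2) mM1 M10 mT1 T10 M1_int T1_int.
  move=> /le_trans /(_ Wi).
  under eq_integral do rewrite EFinD.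
  rewrite ge0_integralD//; try exact/measurable_EFinP;
    try by move=> w _; rewrite lee_fin.
  rewrite IeE -leeBrDr// -EFinB => H; apply: le_trans H _; rewrite lee_fin.
  by move: mu_Me; rewrite muE IeE lee_fin; lra.
have := le_integral_off_null (f := fun w => `|MW2sq (emp w) - MW2sq mu|%E)
  (g := fun w => 1 * W w + 1 * T1 w + 2 * eps) mN N0.
move=> H; apply: le_trans (H _ _ _ _) _.
- apply: measurable_funD => //; apply: measurable_funD; exact: measurable_funM.
- by move=> w; have := T10 w; have := normr_ge0 (Me w - w0); rewrite -/(W w); lra.
- by move=> w; exact: abse_ge0.
- move=> w /main[x [xE xM xl _]]; rewrite xE muE -EFinB abse_EFin lee_fin /W.
  have := T10 w; rewrite !mul1r.
  by case: (ger0P (Me w - w0)) => ?; case: (ger0P (x - w0)) => ?; move: eps0; lra.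
have := integral_affine_le (mulr_ge0 (ler0n R 2) (ltW eps0)) (ler0n R 1)
    (ler0n R 1) mW (fun w => normr_ge0 _) mT1 T10 W_int T1_int.
by move=> /le_trans; apply; rewrite -EFinD lee_fin /eps; lra.
Qed.
End expected_error.

(** * The two error bounds, with the chaining depth free *)

Section error_bounds.
Context {R : realType} {d : nat}.
Hypothesis d_gt0 : (0 < d)%N.
Local Notation T := (d.-tuple R).

Definition chaining_sum (J : nat) : R :=
  \sum_(j < J.+1) mesh j ^+ 2 * Num.sqrt (2 ^+ (j * d)).

(** The first bound takes [T1] equal to 4/K, so 12 is 3 times 4. In the second, the K profiles of
    size K^(-3/2) contribute their average deviation divided by sqrt(K). *)
Lemma error_bounds : exists alpha a D : R, 0 < alpha /\ 0 < a /\ 0 < D /\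
  forall (K m : nat) (K_gt0 : (0 < K)%N) (m_gt0 : (0 < m)%N)
    (mu : 'I_K -> probability T R) (muB : forall k, mu k (@unit_ball R d) = 1%E)
    (dO : measure_display) (Omega : measurableType dO) (P : probability Omega R)
    (Y : 'I_m -> 'I_K -> {RV P >-> T})
    (Y_indep : mutually_independent (fun ik : 'I_m * 'I_K => Y ik.1 ik.2))
    (Y_law : forall i k (A : set T), measurable A ->
       distribution P (Y i k) A = mu k A),
  let error := (\int[P]_w `|MW2sq (fun k => empirical R m_gt0 (fun i => Y i k w)
       : probability T R) - MW2sq mu|)%E in
  (error <= (alpha / Num.sqrt (m * K)%:R + 12 / K%:R)%:E)%E /\
  forall J, (2 ^ (J * d) <= m)%N ->
    (error <= (alpha / Num.sqrt (m * K)%:R + 3 * (2 * a * mesh J ^+ 2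
      + D / Num.sqrt m%:R * chaining_sum J) / Num.sqrt K%:R)%:E)%E.
Proof.
have [C1 C10 dev] := @mean_deviation R d.
have [a [D [a0 [D0 unif]]]] := @uniform_deviation R d 8 d_gt0.
exists (2 * (2 * d + 1)%:R * C1), a, D; split.
  by rewrite !mulr_gt0// ltr0n addn1.
split=> //; split=> // K m K_gt0 m_gt0 mu muB dO Omega P Y Y_indep Y_law error.
have KR : 0 < K%:R :> R by rewrite ltr0n.
have mR : 0 < m%:R :> R by rewrite ltr0n.
have sK : 0 < Num.sqrt K%:R :> R by rewrite sqrtr_gt0.
pose e o k := fine (\int[mu k]_x (ball_stat o x)%:E)%E.
have eE o k : (\int[mu k]_x (ball_stat o x)%:E = (e o k)%:E)%E.
  rewrite fineK//; apply: integrable_fin_num => //.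
  exact: bounded_integrable (measurable_ball_stat o) (ball_stat_le o).
pose X (ik : 'I_m * 'I_K) := Y ik.1 ik.2.
have mY i k : measurable_fun setT (Y i k) by exact: measurable_funPT.
have law i k A : measurable A -> P (Y i k @^-1` A) = mu k A.
  by move=> mA; rewrite -(Y_law i k A mA).
have cardI : #|{: 'I_m * 'I_K}| = (m * K)%N by rewrite card_prod !card_ord.
have [||M1 [mM1 M10 M1_int M1P]] := dev _ _ P _ X (fun o ik => e o ik.2) Y_indep.
- by rewrite cardI muln_gt0 m_gt0.
- move=> o ik; rewrite -eE.
  apply: integral_image_bounded (ball_stat_le o) _ => //.
  + exact: measurable_ball_stat.
  + exact: law.
rewrite cardI in M1_int M1P.
have M1P' o w : `|\sum_t \sum_k (ball_stat o (Y t k w) - e o k)| / (m * K)%:R <= M1 w.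
  by have := M1P o w; rewrite -(pair_bigA _ (fun t k => ball_stat o (Y t k w) - e o k)).
have core (T1 : Omega -> R) t1 := @expected_error_le R d K m dO Omega K_gt0 m_gt0 P
  (fun k t => Y t k) (fun k t => mY t k) mu (fun k t => law t k) muB M1 T1
  (2 * d + 1)%:R (C1 / Num.sqrt (m * K)%:R) t1 (ler0n R _) mM1 M10.
have arith (t : R) : 2 * (2 * d + 1)%:R * (C1 / Num.sqrt (m * K)%:R) + t
   = 2 * (2 * d + 1)%:R * C1 / Num.sqrt (m * K)%:R + t.
  by rewrite mulrA.
split.
  have := core (fun=> 4 / K%:R) (4 / K%:R) (measurable_cst _) _ M1_int _ _.
  rewrite arith [3 * _]mulrA -[3 * 4]natrM; apply.
  - by move=> w; rewrite divr_ge0// ltW.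
  - by rewrite integral_cst// [X in (_ * X)%E]probability_setT mule1.
  - move=> w wB F h C FE hl fF Fle; split.
    + exact: (MW2sq_empirical_ge K_gt0 m_gt0 wB Fle).
    + apply: (MW2sq_true_ge K_gt0 m_gt0 wB Fle muB eE).
      by move=> o; exact: M1P'.
move=> J Jm.
have /choice[M MP] : forall k : 'I_K, exists M : Omega -> R,
   [/\ measurable_fun setT M, forall w, 0 <= M w,
    (\int[P]_w (M w)%:E <= (D / Num.sqrt m%:R * chaining_sum J)%:E)%E &
    forall h, convex_lip 8 h -> exists (g : T -> R) (b e : R),
      [/\ measurable_fun setT g, forall x, `|g x| <= b,
          (\int[mu k]_x (g x)%:E = e%:E)%E,
          forall x, unit_ball x -> `|h x - g x| <= a * mesh J ^+ 2 &
          forall w, `|(\sum_t g (Y t k w)) / m%:R - e| <= M w]].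
  (* The sample of the [k]-th marginal, as a sublist of the jointly independent family. *)
  move=> k; pose s : seq ('I_m * 'I_K) := [seq (t, k) | t <- enum 'I_m].
  have ss : size s = m by rewrite size_map size_enum_ord.
  have [||||M [mM M0 M_int Mh]] := unif _ _ P _ X (fun ik => mu ik.2) s
      (Ordinal m_gt0, k) J Y_indep (fun ik => law ik.1 ik.2).
  - by rewrite map_inj_uniq ?enum_uniq// => t t' [].
  - by move=> ik /mapP[t _ ->].
  - by rewrite ss.
  - by rewrite ss.
  rewrite ss in M_int Mh; exists M; split=> // h hl.
  have [g [b [e' [mg gb ge hg gM]]]] := Mh h hl.
  exists g, b, e'; split=> // w; have := gM w.
  by rewrite big_map big_enum.
pose eta := a * mesh J ^+ 2.
have eta0 : 0 <= eta by rewrite mulr_ge0 ?sqr_ge0// ltW.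
pose T1 w : R := 2 * (eta / Num.sqrt K%:R) + (\sum_k M k w) / (K%:R * Num.sqrt K%:R).
pose S := D / Num.sqrt m%:R * chaining_sum J.
have mM k : measurable_fun setT (M k) by have [] := MP k.
have M0 k w : 0 <= M k w by have [_ + _ _] := MP k; apply.
have mT1 : measurable_fun setT T1.
  apply: measurable_funD => //; apply: measurable_funM => //.
  exact: measurable_sum.
have T10 w : 0 <= T1 w.
  apply: addr_ge0; first by rewrite mulr_ge0// divr_ge0// ltW.
  by rewrite divr_ge0 ?sumr_ge0// ltW// mulr_gt0.
have T1_int : (\int[P]_w (T1 w)%:E <= (2 * (eta / Num.sqrt K%:R)
    + K%:R * S / (K%:R * Num.sqrt K%:R))%:E)%E.
  have SM : (\int[P]_w (\sum_k M k w)%:E <= (K%:R * S)%:E)%E.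
    under eq_integral do rewrite -sumEFin.
    rewrite ge0_integral_sum//; last 2 first.
    - by move=> k; exact/measurable_EFinP.
    - by move=> k w _; rewrite lee_fin.
    apply: le_trans (_ : \sum_(k < K) S%:E <= _)%E.
      by apply: lee_sum => k _; have [_ _ + _] := MP k.
    by rewrite sumEFin sumr_const card_ord -[_ *+ K]mulr_natl.
  have z0 : (\int[P]_w (0 : R)%:E <= (0 : R)%:E)%E by rewrite integral0.
  have c1 : 0 <= 2 * (eta / Num.sqrt K%:R) by rewrite mulr_ge0// divr_ge0// ltW.
  have c2 : 0 <= (K%:R * Num.sqrt K%:R)^-1 :> R.
    by apply: ltW; rewrite invr_gt0; exact: mulr_gt0.
  have mSM : measurable_fun setT (fun w => \sum_k M k w) by exact: measurable_sum.
  have SM0 w : 0 <= \sum_k M k w by apply: sumr_ge0 => k _; exact: M0.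
  have mz : measurable_fun setT ((fun=> 0) : Omega -> R) by exact: measurable_cst.
  have := integral_affine_le c1 c2 ler01 mSM SM0 mz (fun=> lexx 0) SM z0.
  have -> : (K%:R * Num.sqrt K%:R)^-1 * (K%:R * S) + 1 * 0 + 2 * (eta / Num.sqrt K%:R)
    = 2 * (eta / Num.sqrt K%:R) + K%:R * S / (K%:R * Num.sqrt K%:R) by ring.
  apply: le_trans; rewrite le_eqVlt; apply/orP; left; apply/eqP.
  by apply: eq_integral => w _; congr EFin; rewrite /T1; ring.
have := core T1 _ mT1 T10 M1_int T1_int _.
rewrite arith.
have -> : 3 * (2 * (eta / Num.sqrt K%:R) + K%:R * S / (K%:R * Num.sqrt K%:R)) =
   3 * (2 * a * mesh J ^+ 2 + S) / Num.sqrt K%:R.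
  by rewrite /eta; field; rewrite !gt_eqF.
apply=> w wB F h C FE hl fF Fle.
have /choice[g gP] : forall k, exists g : T -> R, exists be : R * R,
      [/\ measurable_fun setT g, forall x, `|g x| <= be.1,
          (\int[mu k]_x (g x)%:E = be.2%:E)%E,
          forall x, unit_ball x -> `|h k x - g x| <= eta &
          forall w, `|(\sum_t g (Y t k w)) / m%:R - be.2| <= M k w].
  move=> k; have [_ _ _ /(_ _ (hl k))[g [b [e' gP]]]] := MP k.
  by exists g, (b, e').
have {gP} /choice[be gP] := gP.
have mg k : measurable_fun setT (g k) by have [] := gP k.
have gb k x : `|g k x| <= (be k).1 by have [_ + _ _ _] := gP k; apply.
have ge k : (\int[mu k]_x (g k x)%:E = (be k).2%:E)%E by have [] := gP k.
have hg k x : unit_ball x -> `|h k x - g k x| <= eta.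
  by have [_ _ _ + _] := gP k; apply.
split.
  apply: le_trans (MW2sq_empirical_ge_entropy K_gt0 m_gt0 wB FE fF eta0 mg gb hg).
  rewrite lee_fin /T1; have : 0 <= (\sum_k M k w) / (K%:R * Num.sqrt K%:R).
    by rewrite divr_ge0 ?sumr_ge0// ltW// mulr_gt0.
  lra.
apply: (MW2sq_true_ge_entropy K_gt0 m_gt0 wB FE fF eta0 mg gb hg muB eE _ ge).
- by move=> o; exact: M1P'.
- by move=> k; have [_ _ _ _] := gP k; apply.
Qed.
End error_bounds.

(** * Choosing the depth *)

Section rates.
Context {R : realType}.

Lemma powRN12 (x : R) : 0 <= x -> x `^ (- (1 / 2)) = (Num.sqrt x)^-1.
Proof. by move=> x0; rewrite powRN div1r powR12_sqrt. Qed.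

(** A geometric sum with ratio 2^(d/2)/4, which is below, equal to or above 1 as d is below, equal
    to or above 4: the origin of the three cases of [rate]. *)
Lemma chaining_sumE (d J : nat) : chaining_sum (R := R) (d := d) J =
  \sum_(j < J.+1) (Num.sqrt (2 ^+ d) / 4) ^+ j.
Proof.
apply: eq_bigr => j _; have s0 : 0 <= Num.sqrt (2 ^+ d) :> R by exact: sqrtr_ge0.
have -> : 2 ^+ (j * d) = (Num.sqrt (2 ^+ d) ^+ j) ^+ 2 :> R.
  by rewrite exprAC sqr_sqrtr ?exprn_ge0// -exprM mulnC.
rewrite sqrtr_sqr ger0_norm ?exprn_ge0// /mesh -exprM mulnC exprM -exprMn.
by congr (_ ^+ _); rewrite mulrC expr2 -invfM -natrM.
Qed.

(** The ratio is at most sqrt(8)/4 <= 3/4, and 4 = 1/(1 - 3/4). *)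
Lemma chaining_sum_lt4 (d J : nat) : (d < 4)%N -> chaining_sum (R := R) (d := d) J <= 4.
Proof.
move=> d4; rewrite chaining_sumE; set t := _ / 4.
have t0 : 0 <= t by rewrite divr_ge0// sqrtr_ge0.
have t34 : t <= 3 / 4.
  rewrite ler_wpM2r// -[leRHS]ger0_norm// -sqrtr_sqr ler_sqrt ?exprn_ge0//.
  apply: (@le_trans _ _ (2 ^+ 3)); first by rewrite ler_eXn2l// ltr1n.
  by rewrite -!natrX ler_nat.
elim: J => [|J IH]; first by rewrite big_ord_recl big_ord0 expr0; lra.
rewrite big_ord_recl expr0.
under eq_bigr do rewrite lift0 exprS.
rewrite -mulr_sumr.
have : t * \sum_(i < J.+1) t ^+ i <= 3 / 4 * 4.
  by apply: ler_pM => //; apply: sumr_ge0 => i _; exact: exprn_ge0.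
lra.
Qed.

Lemma chaining_sum_eq4 (J : nat) : chaining_sum (R := R) (d := 4) J = J.+1%:R.
Proof.
rewrite chaining_sumE; have -> : Num.sqrt (2 ^+ 4) = 4 :> R.
  have -> : 2 ^+ 4 = 4 ^+ 2 :> R by rewrite -!natrX.
  by rewrite sqrtr_sqr ger0_norm.
under eq_bigr do rewrite divff// expr1n.
by rewrite sumr_const card_ord.
Qed.

(** The ratio is at least sqrt(32)/4 >= 5/4, so the last term dominates up to the factor 5 = 1/(1 -
    4/5). *)
Lemma chaining_sum_gt4 (d J m : nat) : (4 < d)%N -> (2 ^ (J * d) <= m)%N ->
  chaining_sum (R := R) (d := d) J <= 5 * mesh J ^+ 2 * Num.sqrt m%:R.
Proof.
move=> d4 Jm; apply: (@le_trans _ _ (5 * (mesh J ^+ 2 * Num.sqrt (2 ^+ (J * d))))).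
  rewrite chaining_sumE.
  have tJ : mesh J ^+ 2 * Num.sqrt (2 ^+ (J * d)) = (Num.sqrt (2 ^+ d) / 4) ^+ J :> R.
    have := chaining_sumE d J; case: (J) => [|J'].
      by rewrite /chaining_sum !big_ord_recl !big_ord0 !addr0.
    move: (chaining_sumE d J').
    rewrite /chaining_sum [in X in _ -> X -> _]big_ord_recr
      [in X in _ -> _ = X -> _]big_ord_recr /=.
    by move=> -> /addrI.
  rewrite tJ; set t := _ / 4.
  have t54 : 5 / 4 <= t.
    rewrite ler_wpM2r// -[leLHS]ger0_norm// -sqrtr_sqr ler_sqrt ?exprn_ge0//.
    apply: (@le_trans _ _ (2 ^+ 5)); last by rewrite ler_eXn2l// ltr1n.
    by rewrite -!natrX ler_nat.
  have t0 : 0 <= t by lra.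
  elim: (J) => [|J' IH]; first by rewrite big_ord_recl big_ord0 expr0; lra.
  rewrite big_ord_recr/=.
  have := ler_wpM2r (exprn_ge0 J' t0) t54; rewrite -exprS; lra.
rewrite -mulrA ler_pM2l// ler_wpM2l ?sqr_ge0// ler_sqrt// -natrX ler_nat//.
Qed.

(** The hypothesis says that level [J+1] is too fine for [m]; the factor 4 is the price of stopping
    one level earlier. *)
Lemma mesh_sqr_le (e m J : nat) : (0 < e)%N -> (0 < m)%N ->
  (m < 2 ^ (e * J.+1))%N -> mesh J ^+ 2 <= 4 * m%:R `^ (- (2 / e%:R)) :> R.
Proof.
move=> e0 m0 mJ.
have eR : 0 < e%:R :> R by rewrite ltr0n.
have mR : 0 < m%:R :> R by rewrite ltr0n.
have h : m%:R `^ (2 / e%:R) <= 4 ^+ J.+1 :> R.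
  have -> : 4 ^+ J.+1 = (2 ^ (e * J.+1))%:R `^ (2 / e%:R) :> R.
    rewrite natrX -[2%:R ^+ (e * _)]powR_mulrn// -powRrM natrM mulrAC.
    have -> : e%:R * (2 / e%:R) * J.+1%:R = (2 * J.+1)%:R :> R.
      by rewrite natrM; field; rewrite gt_eqF.
    by rewrite powR_mulrn// exprM; congr (_ ^+ _); rewrite -natrX.
  apply: ge0_ler_powR; rewrite ?nnegrE ?divr_ge0 ?(ltW eR)//.
  by rewrite ler_nat ltnW.
rewrite powRN (meshS J) exprMn.
have -> : mesh J.+1 ^+ 2 = (4 ^+ J.+1)^-1 :> R.
  by rewrite /mesh -exprM mulnC exprM !exprVn; congr (_ ^+ _)^-1; rewrite -natrX.
have -> : 2 ^+ 2 = 4 :> R by rewrite -natrX.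
by rewrite ler_pM2l// lef_pV2 ?posrE ?exprn_gt0 ?powR_gt0.
Qed.

Lemma expR1_le4 : expR 1 <= 4 :> R.
Proof.
have h : expR (1 / 2) <= 2 :> R.
  apply: le_trans (expR_le_quadratic _) _; last by lra.
  by rewrite ger0_norm; lra.
have -> : expR 1 = expR (1 / 2) * expR (1 / 2) :> R by rewrite -expRD; congr expR; field.
have -> : 4 = 2 * 2 :> R by rewrite -natrM.
by apply: ler_pM => //; exact: expR_ge0.
Qed.

(** For d = 4 and m = 1 the logarithm makes [rate] vanish while the left side stays positive, hence
    the last hypothesis. *)
Lemma rate_bound (a D : R) (d K m : nat) : 0 < a -> 0 < D -> (0 < d)%N ->
  (0 < K)%N -> (0 < m)%N -> (d != 4%N) || (1 < m)%N ->
  exists2 J, (2 ^ (J * d) <= m)%N &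
    3 * (2 * a * mesh J ^+ 2 + D / Num.sqrt m%:R * chaining_sum (d := d) J)
      / Num.sqrt K%:R <= 100 * (a + D) * rate R (m * K) K d.
Proof.
move=> a0 D0 d0 K0 m0 dm.
have KR : 0 < K%:R :> R by rewrite ltr0n.
have mR : 0 < m%:R :> R by rewrite ltr0n.
have sK : 0 < Num.sqrt K%:R :> R by rewrite sqrtr_gt0.
have sm : 0 < Num.sqrt m%:R :> R by rewrite sqrtr_gt0.
(* [J] is the largest level with 2^(e J) <= m. For d > 4 this exhausts the constraint 2^(J d) <= m;
   for d <= 4 it is deep enough, since then 4^(-J) is already of order m^(-1/2), and for d = 4 it
   keeps [J] below ln m. *)
pose e := maxn d 4.
have e0 : (0 < e)%N by rewrite /e leq_max orbT.
have e1 : (1 < 2 ^ e)%N by rewrite -{1}(expn0 2) ltn_exp2l.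
pose J := trunc_log (2 ^ e) m.
have /andP[Jm mJ] := trunc_log_bounds e1 m0.
rewrite -/J -!expnM in Jm mJ.
have Jd : (2 ^ (J * d) <= m)%N.
  by apply: leq_trans Jm; rewrite leq_pexp2l// mulnC leq_mul2r /e leq_maxl orbT.
exists J => //.
have rho := mesh_sqr_le e0 m0 mJ.
have nK : (m * K)%:R / K%:R = m%:R :> R by rewrite natrM mulfK ?gt_eqF.
have sn : (m * K)%:R `^ (- (1 / 2)) = (Num.sqrt m%:R)^-1 / Num.sqrt K%:R :> R.
  by rewrite powRN12// natrM sqrtrM ?ler0n// invfM mulrC.
have rho4 : (d <= 4)%N -> mesh J ^+ 2 <= 4 / Num.sqrt m%:R :> R.
  move=> d4; have e4 : e = 4%N by apply/maxn_idPr.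
  move: rho; rewrite e4; have -> : 2 / 4%:R = 1 / 2 :> R by field.
  by rewrite powRN12.
have aD0 : 0 < a + D by exact: addr_gt0.
have im0 : 0 < (Num.sqrt m%:R)^-1 :> R by rewrite invr_gt0.
rewrite /rate nK; case: ifPn => [d4|]; last first.
  rewrite -leqNgt => d4; rewrite sn.
  case: eqP => [d4'|/eqP d4'].
    rewrite d4' /= in dm *; rewrite [X in _ <= _ * X]mulrAC [leRHS]mulrA.
    rewrite ler_wpM2r ?invr_ge0 ?(ltW sK)// chaining_sum_eq4.
    have Jln : J%:R <= ln m%:R :> R.
      rewrite -(expRK J%:R) ler_ln ?posrE ?expR_gt0//.
      apply: (@le_trans _ _ (2 ^ (e * J))%:R); last by rewrite ler_nat.
      rewrite natrX exprM -[J%:R]mulr1 expRM_natl.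
      apply: lerXn2r; rewrite ?nnegrE ?expR_ge0 ?exprn_ge0//.
      apply: le_trans expR1_le4 _; have -> : 4 = 2 ^+ 2 :> R by rewrite -natrX.
      by rewrite ler_eXn2l ?ltr1n// /e leq_max orbT.
    (* Since m >= 2, the constant terms of the bound are absorbed into multiples of ln m. *)
    have ln12 : 1 / 2 <= ln m%:R :> R.
      rewrite -(expRK (1 / 2)) ler_ln ?posrE ?expR_gt0//.
      apply: le_trans (_ : 2 <= _); last by rewrite ler_nat.
      apply: le_trans (expR_le_quadratic _) _; last by lra.
      by rewrite ger0_norm; lra.
    have := ler_wpM2l (ltW a0) (rho4 d4).
    have := ler_wpM2l (ltW (mulr_gt0 D0 im0)) Jln.
    have := ler_wpM2l (ltW (mulr_gt0 D0 im0)) ln12.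
    have := ler_wpM2l (ltW (mulr_gt0 a0 im0)) ln12.
    have := mulr_gt0 D0 im0; have := mulr_gt0 a0 im0; rewrite -[J.+1%:R]natr1.
    move: (mesh J ^+ 2) (ln m%:R) (J%:R) ((Num.sqrt m%:R)^-1) => r l j i; lra.
  have d3 : (d < 4)%N by rewrite ltn_neqAle d4'.
  rewrite [leRHS]mulrA ler_wpM2r ?invr_ge0 ?(ltW sK)//.
  have := ler_wpM2l (ltW a0) (rho4 d4).
  have := ler_wpM2l (ltW (mulr_gt0 D0 im0)) (chaining_sum_lt4 J d3).
  have := mulr_gt0 D0 im0; have := mulr_gt0 a0 im0.
  lra.
have ed : e = d by apply/maxn_idPl; exact: ltnW.
rewrite ed in rho.
rewrite powRN12 ?ler0n// [X in _ <= _ * X]mulrC [leRHS]mulrA.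
rewrite ler_wpM2r ?invr_ge0 ?(ltW sK)//.
set q := m%:R `^ _ in rho *.
have S := chaining_sum_gt4 d4 Jd.
have S' : D / Num.sqrt m%:R * chaining_sum (d := d) J <= 5 * D * mesh J ^+ 2.
  apply: le_trans (ler_wpM2l (ltW (mulr_gt0 D0 im0)) S) _.
  rewrite le_eqVlt; apply/orP; left; apply/eqP; field; exact/lt0r_neq0.
have := ler_wpM2l (ltW a0) rho; have := ler_wpM2l (ltW D0) rho.
have := mulr_ge0 (ltW a0) (powR_ge0 m%:R (- (2 / d%:R))).
have := mulr_ge0 (ltW D0) (powR_ge0 m%:R (- (2 / d%:R))).
rewrite -/q; lra.
Qed.
End rates.

(** * The final bounds in terms of [rate] *)

Lemma rate_ge0 (R : realType) (n K d : nat) : (0 < K)%N -> (K <= n)%N ->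
  0 <= rate R n K d.
Proof.
move=> K0 Kn; rewrite /rate; case: ifP => _; first by rewrite mulr_ge0 ?powR_ge0.
case: ifP => _; last exact: powR_ge0.
by rewrite mulr_ge0 ?powR_ge0// ln_ge0// ler_pdivlMr ?ltr0n// mul1r ler_nat.
Qed.

Lemma rate_le_log (R : realType) (n K d : nat) : (d <= 4)%N ->
  (0 < K)%N -> (K <= n)%N -> rate R n K d <= (1 + ln n%:R) * n%:R `^ (- (1 / 2)).
Proof.
move=> d4 K0 Kn; have n0 : (0 < n)%N by exact: leq_trans Kn.
have ln0 : 0 <= ln n%:R :> R by rewrite ln_ge0// ler1n.
have p0 : 0 <= n%:R `^ (- (1 / 2)) :> R by exact: powR_ge0.
rewrite /rate ltnNge d4 /=; case: ifP => _; last by rewrite ler_peMl// lerDl.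
rewrite mulrC ler_wpM2r//.
have : ln (n%:R / K%:R) <= ln n%:R :> R.
  rewrite ler_ln ?posrE ?divr_gt0 ?ltr0n// ler_pdivrMr ?ltr0n//.
  by rewrite ler_peMr// ler1n.
lra.
Qed.

Theorem theorem3p1 (R : realType) (d : nat) (d_gt0 : (0 < d)%N) :
  exists (C C' : R) (p : nat), 0 < C /\ 0 < C' /\
    forall (K n : nat) (K_gt0 : (0 < K)%N) (n_gt0 : (0 < n)%N)
      (K_dvd_n : (K %| n)%N)
      (mu : 'I_K -> probability (d.-tuple R) R)
      (mu_ball : forall k, mu k (@unit_ball R d) = 1%E)
      (disp : measure_display) (Omega : measurableType disp)
      (P : probability Omega R)
      (Y : 'I_(n %/ K) -> 'I_K -> {RV P >-> d.-tuple R})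
      (Y_indep : mutually_independent
         (fun ik : 'I_(n %/ K) * 'I_K => Y ik.1 ik.2))
      (Y_law : forall i k (A : set (d.-tuple R)), measurable A ->
         distribution P (Y i k) A = mu k A),
    let mu_hat (w : Omega) (k : 'I_K) : probability (d.-tuple R) R :=
      empirical R (sample_size_gt0 K_gt0 n_gt0 K_dvd_n) (fun i => Y i k w) in
    let error : \bar R :=
      (\int[P]_w `|MW2sq (mu_hat w) - MW2sq mu|)%E in
    (error <= (C * (n%:R `^ (- (1 / 2))
                    + Num.min (1 / K%:R) (rate R n K d)))%:E)%E
    /\ ((d <= 4)%N ->
        (error <= (C' * (1 + ln n%:R) ^+ p * n%:R `^ (- (1 / 2)))%:E)%E).
Proof.
have [alpha [a [D [alpha0 [a0 [D0 bounds]]]]]] := @error_bounds R d d_gt0.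
(* The summands pay for the deviation of means, for the bound by 1/K and for the chaining bound, so
   that one constant serves on either side of the minimum. *)
pose C := alpha + 12 + 100 * (a + D).
have aD0 : 0 < a + D by exact: addr_gt0.
have C0 : 0 < C by rewrite /C; lra.
(* For d <= 4 both n^(-1/2) and the minimum are at most (1 + ln n) n^(-1/2): hence the factor 2 and
   the power 1. *)
exists C, (2 * C), 1%N; split=> //; split; first by rewrite mulr_gt0.
move=> K n K_gt0 n_gt0 K_dvd_n mu mu_ball disp Omega P Y Y_indep Y_law mu_hat error.
set m_gt0 := sample_size_gt0 K_gt0 n_gt0 K_dvd_n in mu_hat error *.
have Kn : (K <= n)%N by exact: dvdn_leq.
have KR : 0 < K%:R :> R by rewrite ltr0n.
have [] := bounds K _ K_gt0 m_gt0 mu mu_ball disp Omega P Y Y_indep Y_law.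
rewrite -/error divnK// -powRN12//; set q := _ `^ _ => trivial_bound chaining_bound.
have q0 : 0 <= q by exact: powR_ge0.
have rate0 := rate_ge0 R d K_gt0 Kn.
have main : (error <= (C * (q + Num.min (1 / K%:R) (rate R n K d)))%:E)%E.
  have [_|_] := leP (1 / K%:R) (rate R n K d).
    apply: le_trans trivial_bound _; rewrite lee_fin.
    have : 0 <= K%:R^-1 :> R by rewrite invr_ge0 ltW.
    rewrite /C div1r; nra.
  have [dm|] := boolP ((d != 4%N) || (1 < n %/ K)%N).
    have [J Jm] := rate_bound a0 D0 d_gt0 K_gt0 m_gt0 dm.
    rewrite divnK// => rJ.
    apply: le_trans (chaining_bound J Jm) _; rewrite lee_fin.
    rewrite /C; nra.
  (* For d = 4 and n = K the rate vanishes, and 1 / K <= n^(-1/2). *)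
  rewrite negb_or negbK -leqNgt => /andP[_ m1].
  have nK : n = K by rewrite -(divnK K_dvd_n) -[RHS]mul1n; congr (_ * K)%N; lia.
  have Kq : K%:R^-1 <= q.
    rewrite /q powRN12// nK lef_pV2 ?posrE ?sqrtr_gt0//.
    rewrite -[leRHS]ger0_norm// -sqrtr_sqr ler_sqrt ?exprn_ge0// expr2.
    by rewrite ler_peMr// ler1n.
  apply: le_trans trivial_bound _; rewrite lee_fin.
  by rewrite /C; nra.
split=> // d4; apply: le_trans main _; rewrite lee_fin expr1.
have ln0 : 0 <= ln n%:R :> R by rewrite ln_ge0// ler1n.
have min_le : Num.min (1 / K%:R) (rate R n K d) <= (1 + ln n%:R) * q.
  by apply: le_trans (rate_le_log R d4 K_gt0 Kn); rewrite ge_min lexx orbT.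
have q_le : q <= (1 + ln n%:R) * q by rewrite ler_peMl// lerDl.
rewrite [2 * C]mulrC -!mulrA ler_pM2l//; lra.
Qed.
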